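(* Let $\mathbf{G}\subset\mathbb{R}^n$ be a bounded open set with real algebraic boundary $\partial\mathbf{G}$, such that $\mathbf{G}=\mathrm{int}\,\overline{\mathbf{G}}$, the boundary $\partial\mathbf{G}$ has degree $d$, and the point $0$ does not belong to the real zero set of the ideal $I(\partial\mathbf{G})$. Let $y_\alpha=\int_{\mathbf{G}}\mathbf{x}^\alpha d\mathbf{x}$. Then the linear system in the unknowns $\mathbf{g}=(g_\beta)_{\beta\in\mathbb{N}^n_d\setminus\{0\}}\in\mathbb{R}^{s(d)-1}$, $$\mathbf{M}^d_{2d}(\mathbf{y})\begin{bmatrix}-1\\ \mathbf{g}\end{bmatrix}=0,\quad\text{i.e.}\quad -y_\alpha+\sum_{0<|\beta|\le d}\frac{n+|\alpha|+|\beta|}{n+|\alpha|}\,y_{\alpha+\beta}\,g_\beta=0\ \ \text{for all }\alpha\in\mathbb{N}^n_{2d},$$ admits a unique solution, and the polynomial $g(\mathbf{x})=\sum_{0<|\beta|\le d}g_\beta\mathbf{x}^\beta$ (coefficient vector $(0,\mathbf{g})$) satisfies $g(\mathbf{x})=1$ for all $\mathbf{x}\in\partial\mathbf{G}$.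
   Context: $\mathbb{N}^n_k:=\{\alpha\in\mathbb{N}^n:|\alpha|\le k\}$, $s(d)=\binom{n+d}{n}$ is the number of monomials of degree $\le d$. For $k,d\in\mathbb{N}$ the matrix $\mathbf{M}^d_k(\mathbf{y})$ has rows indexed by $\alpha\in\mathbb{N}^n_k$, columns indexed by $\beta\in\mathbb{N}^n_d$ (first column $\beta=0$), and entries $\mathbf{M}^d_k(\mathbf{y})(\alpha,\beta)=\frac{n+|\alpha|+|\beta|}{n+|\alpha|}y_{\alpha+\beta}$. Since $\mathbf{G}=\mathrm{int}\,\overline{\mathbf{G}}$ and $\partial\mathbf{G}$ is real algebraic of dimension $n-1$, its vanishing ideal $I(\partial\mathbf{G})\subset\mathbb{R}[\mathbf{x}]$ is principal, generated by a polynomial $h$; the degree of $\partial\mathbf{G}$ is defined as $\deg h$. *)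

(* Defs.v *)
From Stdlib Require Import Reals List Arith Classical ClassicalEpsilon.
Import ListNotations.
Open Scope R_scope.

Fixpoint sumR {A : Type} (l : list A) (f : A -> R) : R :=
  match l with nil => 0 | a :: l' => f a + sumR l' f end.

Definition Rn (n : nat) (x : list R) : Prop := length x = n.

(** Multi-indices in N^n are lists of naturals of length n. *)
Definition mdeg (a : list nat) : nat := fold_right Nat.add 0%nat a.

(** mis n k enumerates N^n_k = {alpha in N^n : |alpha| <= k} (no repetitions). *)
Fixpoint mis (n k : nat) : list (list nat) :=
  match n with
  | O => [nil]
  | S m => flat_map (fun j => map (cons j) (mis m (k - j))) (seq 0 (S k))
  end.

Fixpoint addmi (a b : list nat) : list nat :=
  match a, b with
  | a0 :: a', b0 :: b' => (a0 + b0)%nat :: addmi a' b'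
  | _, _ => nil
  end.

Fixpoint mono (x : list R) (a : list nat) : R :=
  match x, a with
  | x0 :: xs, a0 :: a' => x0 ^ a0 * mono xs a'
  | _, _ => 1
  end.

(** Polynomials in n variables: coefficients on N^n_D for a degree bound D. *)
Record poly := mkpoly { pbound : nat; pcoef : list nat -> R }.

Definition peval (n : nat) (p : poly) (x : list R) : R :=
  sumR (mis n (pbound p)) (fun a => pcoef p a * mono x a).

Definition has_degree (n : nat) (p : poly) (d : nat) : Prop :=
  (exists a, In a (mis n (pbound p)) /\ mdeg a = d /\ pcoef p a <> 0) /\
  (forall a, In a (mis n (pbound p)) -> pcoef p a <> 0 -> (mdeg a <= d)%nat).

Definition dist2 (x z : list R) : R :=
  sumR (combine x z) (fun pr => (fst pr - snd pr) ^ 2).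

Definition is_openRn (n : nat) (G : list R -> Prop) : Prop :=
  (forall x, G x -> Rn n x) /\
  forall x, G x -> exists r, 0 < r /\
    forall z, Rn n z -> dist2 x z < r ^ 2 -> G z.

Definition closureRn (n : nat) (S : list R -> Prop) (x : list R) : Prop :=
  Rn n x /\ forall r, 0 < r -> exists z, S z /\ dist2 x z < r ^ 2.

Definition interiorRn (n : nat) (S : list R -> Prop) (x : list R) : Prop :=
  Rn n x /\ exists r, 0 < r /\ forall z, Rn n z -> dist2 x z < r ^ 2 -> S z.

Definition boundaryRn (n : nat) (S : list R -> Prop) (x : list R) : Prop :=
  closureRn n S x /\ ~ interiorRn n S x.

Definition in_box (a : R) (x : list R) : Prop := Forall (fun xi => Rabs xi < a) x.

Definition boundedRn (n : nat) (G : list R -> Prop) : Prop :=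
  exists a, 0 < a /\ forall x, G x -> in_box a x.

Definition real_algebraic (n : nat) (S : list R -> Prop) : Prop :=
  (forall x, S x -> Rn n x) /\
  exists ps : list poly, forall x, Rn n x ->
    (S x <-> Forall (fun p => peval n p x = 0) ps).

Definition vanishes_on (n : nat) (p : poly) (S : list R -> Prop) : Prop :=
  forall x, S x -> peval n p x = 0.

(** h generates the ideal I(S) (equality of real polynomials = equality as
    functions on R^n). *)
Definition generates_vanishing_ideal (n : nat) (h : poly) (S : list R -> Prop) : Prop :=
  vanishes_on n h S /\
  forall p, vanishes_on n p S ->
    exists q, forall x, Rn n x -> peval n p x = peval n h x * peval n q x.

Definition in_zero_set_of_vanishing_ideal (n : nat) (S : list R -> Prop) (x : list R) : Prop :=
  forall p, vanishes_on n p S -> peval n p x = 0.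

(** Riemann integral on R^n: uniform grids of [-a,a]^n, arbitrary tags. *)
Fixpoint grid (n N : nat) : list (list nat) :=
  match n with
  | O => [nil]
  | S m => flat_map (fun j => map (cons j) (grid m N)) (seq 0 N)
  end.

Definition in_cell (a : R) (N : nat) (k : list nat) (t : list R) : Prop :=
  Forall2 (fun ki ti => - a + INR ki * (2 * a / INR N) <= ti
                        <= - a + INR (S ki) * (2 * a / INR N)) k t.

Definition riemann_box (n : nat) (a : R) (f : list R -> R) (v : R) : Prop :=
  forall eps, 0 < eps -> exists N0 : nat, forall N : nat,
    (N0 <= N)%nat -> (0 < N)%nat ->
    forall t : list nat -> list R,
      (forall k, In k (grid n N) -> in_cell a N k (t k)) ->
      Rabs ((2 * a / INR N) ^ n * sumR (grid n N) (fun k => f (t k)) - v) < eps.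

Definition IntegralRn (n : nat) (f : list R -> R) (v : R) : Prop :=
  exists a, 0 < a /\ (forall x, Rn n x -> f x <> 0 -> in_box a x) /\
            riemann_box n a f v.

Definition indic (S : list R -> Prop) (x : list R) : R :=
  if excluded_middle_informative (S x) then 1 else 0.

Definition Mentry (n : nat) (y : list nat -> R) (a b : list nat) : R :=
  INR (n + mdeg a + mdeg b) / INR (n + mdeg a) * y (addmi a b).

Definition ext_vec (g : list nat -> R) (b : list nat) : R :=
  if Nat.eqb (mdeg b) 0 then -1 else g b.

Definition moment_system (n d : nat) (y : list nat -> R) (g : list nat -> R) : Prop :=
  forall a, In a (mis n (2 * d)) ->
    sumR (mis n d) (fun b => Mentry n y a b * ext_vec g b) = 0.

Definition gpoly (n d : nat) (g : list nat -> R) (x : list R) : R :=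
  sumR (mis n d) (fun b => if Nat.eqb (mdeg b) 0 then 0 else g b * mono x b).

(* Main.v *)
Require Import Defs.
From Stdlib Require Import Reals List Arith Lra Lia Psatz Classical ClassicalEpsilon.
Import ListNotations.
Open Scope R_scope.

(** Write [E] for the Euler operator [sum_i x_i d/dx_i] and [h] for the generator of the ideal of the
    boundary; [h(0) <> 0]. If a polynomial [f] vanishes on the boundary, then [n f + E f = div (f x)] has
    integral [0] over [G]. With [f = x^alpha h] this says that [g = 1 - h / h(0)] solves the system.

    Conversely let [p] be the difference of two solutions. Then [div (q p x)] has integral [0] for all [q] of
    degree at most [2 d], in particular for [q = p (E h)], so the flux of [p^2 (E h) x] through the
    boundary vanishes. The integrand of this flux has a constant sign, because [G] lies on one side of
    [h = 0]: since [h] generates a radical ideal, [E h] is a non-zero-divisor modulo [h], the ideal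
    [(h, E h)] contains a nonzero homogeneous polynomial [D], and on every ray through [0] on which
    [D <> 0] all zeros of [h] are simple, so that the sign of [h] and the membership in [G] change
    simultaneously. Hence [p (E h) = 0] on the boundary, then [p = 0] there, [p] is a multiple of [h], and
    [p(0) = 0] together with the degree bound gives [p = 0].

    Boundary integrals are avoided by multiplying with powers [(1 - h/H)^m], which tend to [0] inside
    [G] and equal [1] on the boundary. *)

(** * Counting cells of a grid *)

(** The boundary may be singular and [G] disconnected, so neither normal vectors nor a constant sign
    of [h] on [G] are given at the start. The fields are radial because the factor
    [n + |alpha| + |beta|] in the matrix is the divergence factor of [x^(alpha + beta) x]. On
    [h = 0] the flux density of [f x] is [f (E h)] up to the length of the gradient; the factor
    [E h] in the test polynomial turns it into a square, and the rows up to degree [2 d] are exactly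
    what admits this factor. The polynomial [D] comes from a Euclidean algorithm in which
    homogeneous polynomials count as units and the degree is replaced by the width, the highest
    minus the lowest degree. The width also ends the proof: [h] has width [d] because [h(0) <> 0],
    and a nonzero [p] without constant term is narrower than any nonzero multiple of [h]. Integrals
    are accessible only as limits of Riemann sums with arbitrary tags, and this freedom carries the
    analysis: on each fine grid the most favourable tags are chosen. *)

Lemma sumR_ext {A} (l : list A) (f g : A -> R) :
  (forall a, In a l -> f a = g a) -> sumR l f = sumR l g.
Proof.
  induction l as [|a l IH]; simpl; intros H; [easy|].
  rewrite (H a), IH; auto.
Qed.

Lemma sumR_le {A} (l : list A) (f g : A -> R) :
  (forall a, In a l -> f a <= g a) -> sumR l f <= sumR l g.
Proof.
  induction l as [|a l IH]; simpl; intros H; [lra|].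
  apply Rplus_le_compat; auto.
Qed.

Lemma sumR_plus {A} (l : list A) (f g : A -> R) :
  sumR l (fun a => f a + g a) = sumR l f + sumR l g.
Proof. induction l as [|a l IH]; simpl; [lra|]; rewrite IH; ring. Qed.

Lemma sumR_minus {A} (l : list A) (f g : A -> R) :
  sumR l (fun a => f a - g a) = sumR l f - sumR l g.
Proof. induction l as [|a l IH]; simpl; [lra|]; rewrite IH; ring. Qed.

Lemma sumR_scal {A} (l : list A) c (f : A -> R) :
  sumR l (fun a => c * f a) = c * sumR l f.
Proof. induction l as [|a l IH]; simpl; [lra|]; rewrite IH; ring. Qed.

Lemma sumR_scalr {A} (l : list A) c (f : A -> R) :
  sumR l (fun a => f a * c) = sumR l f * c.
Proof. induction l as [|a l IH]; simpl; [lra|]; rewrite IH; ring. Qed.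

Lemma sumR_app {A} (l1 l2 : list A) (f : A -> R) :
  sumR (l1 ++ l2) f = sumR l1 f + sumR l2 f.
Proof. induction l1 as [|a l IH]; simpl; [lra|]; rewrite IH; ring. Qed.

Lemma sumR_map {A B} (l : list A) (g : A -> B) (f : B -> R) :
  sumR (map g l) f = sumR l (fun a => f (g a)).
Proof. induction l as [|a l IH]; simpl; [easy|]; now rewrite IH. Qed.

Lemma sumR_flat_map {A B} (l : list A) (g : A -> list B) (f : B -> R) :
  sumR (flat_map g l) f = sumR l (fun a => sumR (g a) f).
Proof. induction l as [|a l IH]; simpl; [easy|]; now rewrite sumR_app, IH. Qed.

Lemma sumR_zero {A} (l : list A) (f : A -> R) :
  (forall a, In a l -> f a = 0) -> sumR l f = 0.
Proof.
  induction l as [|a l IH]; simpl; intros H; [easy|].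
  rewrite (H a), IH; auto; lra.
Qed.

Lemma sumR_swap {A B} (l : list A) (m : list B) (f : A -> B -> R) :
  sumR l (fun a => sumR m (f a)) = sumR m (fun b => sumR l (fun a => f a b)).
Proof.
  induction l as [|a l IH]; simpl.
  - symmetry; now apply sumR_zero.
  - now rewrite IH, <- sumR_plus.
Qed.

Lemma sumR_nonneg {A} (l : list A) (f : A -> R) :
  (forall a, In a l -> 0 <= f a) -> 0 <= sumR l f.
Proof.
  intros H. rewrite <- (sumR_zero l (fun _ => 0)) by auto. now apply sumR_le.
Qed.

Lemma sumR_abs {A} (l : list A) (f : A -> R) :
  Rabs (sumR l f) <= sumR l (fun a => Rabs (f a)).
Proof.
  induction l as [|a l IH]; simpl; [rewrite Rabs_R0; lra|].
  eapply Rle_trans; [apply Rabs_triang|]; lra.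
Qed.

Lemma sumR_const {A} (l : list A) c : sumR l (fun _ => c) = INR (length l) * c.
Proof.
  induction l as [|a l IH]; [simpl; lra|].
  change (length (a :: l)) with (S (length l)). rewrite S_INR. simpl. rewrite IH. ring.
Qed.

Lemma sumR_seq_telescope (u : nat -> R) s N :
  sumR (seq s N) (fun j => u (S j) - u j) = u (s + N)%nat - u s.
Proof.
  revert s; induction N as [|N IH]; intros s; simpl.
  - rewrite Nat.add_0_r; lra.
  - rewrite IH. replace (S s + N)%nat with (s + S N)%nat by lia. lra.
Qed.

Lemma sumR_grid_S n N (f : list nat -> R) :
  sumR (grid (S n) N) f = sumR (seq 0 N) (fun j => sumR (grid n N) (fun k => f (j :: k))).
Proof.
  simpl grid. rewrite sumR_flat_map. apply sumR_ext; intros j _. now rewrite sumR_map.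
Qed.

Lemma in_grid_S n N k :
  In k (grid (S n) N) <-> exists j k', k = j :: k' /\ (j < N)%nat /\ In k' (grid n N).
Proof.
  simpl grid. rewrite in_flat_map. split.
  - intros (j & Hj & Hk). rewrite in_map_iff in Hk. destruct Hk as (k' & <- & Hk').
    apply in_seq in Hj. exists j, k'. repeat split; auto; lia.
  - intros (j & k' & -> & Hj & Hk'). exists j. split; [apply in_seq; lia|].
    apply in_map_iff; eauto.
Qed.

Lemma grid_length n N k : In k (grid n N) -> length k = n.
Proof.
  revert k; induction n as [|n IH]; intros k Hk.
  - destruct Hk as [<-|[]]; easy.
  - apply in_grid_S in Hk. destruct Hk as (j & k' & -> & _ & Hk'). simpl. now rewrite IH.
Qed.

Lemma card_grid n N : INR (length (grid n N)) = INR N ^ n.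
Proof.
  rewrite <- (Rmult_1_r (INR (length _))), <- sumR_const.
  induction n as [|n IH]; [simpl; lra|].
  rewrite sumR_grid_S, IH, sumR_const, length_seq. simpl. lra.
Qed.

Fixpoint prod2 {A B} (w : A -> B -> R) (c : list A) (k : list B) : R :=
  match c, k with
  | c0 :: c', k0 :: k' => w c0 k0 * prod2 w c' k'
  | _, _ => 1
  end.

Lemma prod2_nonneg {A B} (w : A -> B -> R) c k :
  (forall a b, 0 <= w a b) -> 0 <= prod2 w c k.
Proof.
  intros Hw. revert k; induction c as [|a c IH]; intros [|b k]; simpl; try lra.
  now apply Rmult_le_pos.
Qed.

(** The sum of a product over the grid factors into one-dimensional sums, so counting in a box
    reduces to counting in intervals. *)
Lemma sumR_grid_prod2_le {A} (w : A -> nat -> R) N h u (c : list A) :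
  0 <= h -> (forall a j, 0 <= w a j) ->
  (forall a, In a c -> h * sumR (seq 0 N) (w a) <= u) ->
  h ^ length c * sumR (grid (length c) N) (prod2 w c) <= u ^ length c.
Proof.
  intros Hh Hw. induction c as [|a c IH]; intros Hu; [simpl; lra|].
  change (length (a :: c)) with (S (length c)). rewrite sumR_grid_S. simpl prod2.
  erewrite sumR_ext by (intros j _; apply sumR_scal).
  rewrite sumR_scalr. simpl.
  transitivity ((h * sumR (seq 0 N) (w a)) * (h ^ length c * sumR (grid (length c) N) (prod2 w c))); [right; ring|].
  apply Rmult_le_compat; auto.
  - apply Rmult_le_pos; auto. apply sumR_nonneg; auto.
  - apply Rmult_le_pos; [now apply pow_le|]. apply sumR_nonneg; intros; now apply prod2_nonneg.
  - apply Hu; now left.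
  - apply IH; intros; apply Hu; now right.
Qed.

Lemma sumR_grid_prod2_ge {A} (w : A -> nat -> R) N h u (c : list A) :
  0 <= u ->
  (forall a, In a c -> u <= h * sumR (seq 0 N) (w a)) ->
  u ^ length c <= h ^ length c * sumR (grid (length c) N) (prod2 w c).
Proof.
  intros Hpos. induction c as [|a c IH]; intros Hu; [simpl; lra|].
  change (length (a :: c)) with (S (length c)). rewrite sumR_grid_S. simpl prod2.
  erewrite sumR_ext by (intros j _; apply sumR_scal).
  rewrite sumR_scalr. simpl.
  transitivity ((h * sumR (seq 0 N) (w a)) * (h ^ length c * sumR (grid (length c) N) (prod2 w c))); [|right; ring].
  apply Rmult_le_compat; auto.
  - now apply pow_le.
  - apply Hu; now left.
  - apply IH; intros; apply Hu; now right.
Qed.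

Definition clamp (lo hi x : R) : R := Rmax lo (Rmin hi x).

Ltac clamp_lra :=
  unfold clamp, Rmin;
  repeat match goal with |- context [Rle_dec ?a ?b] => destruct (Rle_dec a b) end;
  unfold Rmax;
  repeat match goal with |- context [Rle_dec ?a ?b] => destruct (Rle_dec a b) end; lra.

Lemma clamp_diff lo hi x z : x <= z ->
  0 <= clamp lo hi z - clamp lo hi x <= z - x.
Proof.
  intros; split; clamp_lra.
Qed.

Definition chi (P : Prop) : R := if excluded_middle_informative P then 1 else 0.

Lemma chi_true (P : Prop) : P -> chi P = 1.
Proof. unfold chi; destruct (excluded_middle_informative P); easy. Qed.
Lemma chi_false (P : Prop) : ~ P -> chi P = 0.
Proof. unfold chi; destruct (excluded_middle_informative P); easy. Qed.
Lemma chi_01 (P : Prop) : 0 <= chi P <= 1.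
Proof. unfold chi; destruct (excluded_middle_informative P); lra. Qed.
Lemma chi_le (P Q : Prop) : (P -> Q) -> chi P <= chi Q.
Proof.
  unfold chi; destruct (excluded_middle_informative P), (excluded_middle_informative Q);
    intros; try lra; tauto.
Qed.

Definition node (b : R) (M j : nat) : R := - b + INR j * (2 * b / INR M).

Lemma node_S b M j : node b M (S j) = node b M j + 2 * b / INR M.
Proof. unfold node. rewrite S_INR. ring. Qed.
Lemma node_0 b M : node b M 0 = - b.
Proof. unfold node; simpl; ring. Qed.
Lemma node_M b M : (0 < M)%nat -> node b M M = b.
Proof. intros H. unfold node. field. now apply not_0_INR; lia. Qed.
Lemma mesh_pos b M : 0 < b -> (0 < M)%nat -> 0 < 2 * b / INR M.
Proof. intros. apply Rdiv_lt_0_compat; [lra|]. now apply lt_0_INR. Qed.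

Lemma node_mono b M i j : 0 < b -> (0 < M)%nat -> (i <= j)%nat -> node b M i <= node b M j.
Proof.
  intros Hb HM Hij. unfold node. apply Rplus_le_compat_l, Rmult_le_compat_r.
  - left; now apply mesh_pos.
  - now apply le_INR.
Qed.

(** A cell that meets the interval lies in [[lo - h, hi + h]], so [clamp] grows by exactly one mesh
    across it; elsewhere it does not decrease, and the increments telescope. *)
Lemma count_meet_le b M lo hi : 0 < b -> (0 < M)%nat -> lo <= hi ->
  2 * b / INR M * sumR (seq 0 M) (fun j => chi (lo <= node b M (S j) /\ node b M j < hi))
  <= hi - lo + 2 * (2 * b / INR M).
Proof.
  intros Hb HM Hlh. pose proof (mesh_pos b M Hb HM) as Hh.
  set (h := 2 * b / INR M) in *. rewrite <- sumR_scal.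
  eapply Rle_trans.
  - apply sumR_le with (g := fun j => clamp (lo - h) (hi + h) (node b M (S j))
                                    - clamp (lo - h) (hi + h) (node b M j)).
    intros j _. pose proof (node_S b M j) as E. fold h in E.
    destruct (classic (lo <= node b M (S j) /\ node b M j < hi)) as [H|H].
    + rewrite chi_true by auto. clamp_lra.
    + rewrite chi_false by auto.
      destruct (clamp_diff (lo - h) (hi + h) (node b M j) (node b M (S j))); lra.
  - rewrite (sumR_seq_telescope (fun j => clamp (lo - h) (hi + h) (node b M j))).
    clamp_lra.
Qed.

(** Clamping to [[lo + h, hi - h]] makes the increment zero on every cell not contained in the
    interval. The bounds by [b] let the telescoping sum reach its full height. *)
Lemma count_inside_ge b M lo hi : 0 < b -> (0 < M)%nat -> - b <= lo -> hi <= b ->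
  hi - lo - 2 * (2 * b / INR M) <=
  2 * b / INR M * sumR (seq 0 M) (fun j => chi (lo <= node b M j /\ node b M (S j) < hi)).
Proof.
  intros Hb HM Hlo Hhi. pose proof (mesh_pos b M Hb HM) as Hh.
  set (h := 2 * b / INR M) in *.
  destruct (Rle_dec (hi - h) (lo + h)) as [Hs|Hs].
  { apply Rle_trans with 0; [lra|]. apply Rmult_le_pos; [lra|].
    apply sumR_nonneg; intros; apply chi_01. }
  rewrite <- sumR_scal.
  eapply Rle_trans; [|
   apply sumR_le with (f := fun j => clamp (lo + h) (hi - h) (node b M (S j))
                                    - clamp (lo + h) (hi - h) (node b M j))].
  - rewrite (sumR_seq_telescope (fun j => clamp (lo + h) (hi - h) (node b M j))).
    simpl. rewrite node_0, node_M by auto.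
    clamp_lra.
  - intros j _. pose proof (node_S b M j) as E. fold h in E.
    destruct (classic (lo <= node b M j /\ node b M (S j) < hi)) as [H|H].
    + rewrite chi_true by auto.
      destruct (clamp_diff (lo + h) (hi - h) (node b M j) (node b M (S j))); lra.
    + rewrite chi_false by auto. rewrite Rmult_0_r.
      clamp_lra.
Qed.

(** Half-open, so that the cells of a grid partition the cube and a point on a common face is
    counted once. *)
Definition in_hbox (c : list (R * R)) (x : list R) : Prop :=
  Forall2 (fun I t => fst I <= t < snd I) c x.

Lemma Forall2_cons_iff2 {A B} (P : A -> B -> Prop) a l b m :
  Forall2 P (a :: l) (b :: m) <-> P a b /\ Forall2 P l m.
Proof. split; [intros H; inversion H; auto|intros []; now constructor]. Qed.

Lemma chi_hbox_le (b : R) (M : nat) c k t : in_cell b M k t ->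
  chi (in_hbox c t) <=
  prod2 (fun I j => chi (fst I <= node b M (S j) /\ node b M j < snd I)) c k.
Proof.
  intros H. revert c. induction H as [|k0 t0 k t Hkt H IH]; intros [|I c]; simpl; try apply chi_01.
  - apply Rle_trans with (chi (fst I <= t0 < snd I) * chi (in_hbox c t)).
    + destruct (classic (in_hbox (I :: c) (t0 :: t))) as [Hb|Hb].
      * apply Forall2_cons_iff2 in Hb. destruct Hb.
        rewrite !chi_true; auto; [lra|]. now constructor.
      * rewrite chi_false by auto. apply Rmult_le_pos; apply chi_01.
    + apply Rmult_le_compat; try apply chi_01; auto.
      apply chi_le. fold (node b M k0) (node b M (S k0)) in Hkt. intros; lra.
Qed.

Lemma chi_hbox_ge (b : R) (M : nat) c k t : in_cell b M k t -> length c = length k ->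
  prod2 (fun I j => chi (fst I <= node b M j /\ node b M (S j) < snd I)) c k
  <= chi (in_hbox c t).
Proof.
  intros H. revert c. induction H as [|k0 t0 k t Hkt H IH]; intros [|I c]; simpl; intros E; try easy.
  - rewrite chi_true; [lra|constructor].
  - apply Rle_trans with (chi (fst I <= t0 < snd I) * chi (in_hbox c t)).
    + apply Rmult_le_compat; try apply chi_01; auto.
      * apply prod2_nonneg; intros; apply chi_01.
      * apply chi_le. fold (node b M k0) (node b M (S k0)) in Hkt. intros; lra.
    + destruct (classic (in_hbox (I :: c) (t0 :: t))) as [Hb|Hb].
      * rewrite (chi_true (in_hbox (I :: c) (t0 :: t))) by auto.
        pose proof (chi_01 (fst I <= t0 < snd I)). pose proof (chi_01 (in_hbox c t)). nra.
      * rewrite (chi_false (in_hbox (I :: c) (t0 :: t))) by auto.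
        destruct (classic (fst I <= t0 < snd I)) as [H1|H1].
        -- rewrite (chi_false (in_hbox c t)); [lra|]. intros H2; apply Hb; now constructor.
        -- rewrite (chi_false (fst I <= t0 < snd I)); auto; lra.
Qed.

(** Whatever the tags, their number in a cube of side [w], times the volume of a cell, is [w ^ n] up
    to an error that vanishes with the mesh; [count_hbox_ge] is the other half. *)
Lemma count_hbox_le n b M c (t : list nat -> list R) w : 0 < b -> (0 < M)%nat ->
  length c = n -> (forall k, In k (grid n M) -> in_cell b M k (t k)) ->
  0 <= w -> (forall I, In I c -> snd I - fst I = w) ->
  (2 * b / INR M) ^ n * sumR (grid n M) (fun k => chi (in_hbox c (t k)))
  <= (w + 2 * (2 * b / INR M)) ^ n.
Proof.
  intros Hb HM <- Ht Hw Hc. pose proof (mesh_pos b M Hb HM).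
  eapply Rle_trans; [|apply sumR_grid_prod2_le with
     (w := fun I j => chi (fst I <= node b M (S j) /\ node b M j < snd I)) (N := M) (h := 2 * b / INR M)].
  - apply Rmult_le_compat_l; [apply pow_le; lra|]. apply sumR_le. intros; now apply chi_hbox_le, Ht.
  - lra.
  - intros; apply chi_01.
  - intros I HI. specialize (Hc I HI). rewrite <- Hc. apply count_meet_le; auto; lra.
Qed.

Lemma count_hbox_ge n b M c (t : list nat -> list R) w : 0 < b -> (0 < M)%nat ->
  length c = n -> (forall k, In k (grid n M) -> in_cell b M k (t k)) ->
  2 * (2 * b / INR M) <= w ->
  (forall I, In I c -> snd I - fst I = w /\ - b <= fst I /\ snd I <= b) ->
  (w - 2 * (2 * b / INR M)) ^ n <=
  (2 * b / INR M) ^ n * sumR (grid n M) (fun k => chi (in_hbox c (t k))).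
Proof.
  intros Hb HM <- Ht Hw Hc. pose proof (mesh_pos b M Hb HM).
  eapply Rle_trans; [apply sumR_grid_prod2_ge with
     (w := fun I j => chi (fst I <= node b M j /\ node b M (S j) < snd I)) (N := M) (h := 2 * b / INR M)|].
  - lra.
  - intros I HI. destruct (Hc I HI) as (E & H1 & H2). rewrite <- E. now apply count_inside_ge.
  - apply Rmult_le_compat_l; [apply pow_le; lra|]. apply sumR_le.
    intros k Hk. apply chi_hbox_ge; auto. now rewrite (grid_length _ _ _ Hk).
Qed.

(** * Riemann sums on two boxes *)

Lemma in_cell_length b M k t : in_cell b M k t -> length t = length k.
Proof. intros H; induction H; simpl; auto. Qed.

Lemma mesh_small b d : 0 < b -> 0 < d -> exists M0, forall M, (M0 <= M)%nat -> (0 < M)%nat ->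
  2 * b / INR M < d.
Proof.
  intros Hb Hd. destruct (archimed_cor1 (d / (2 * b))) as (M0 & H0 & H1).
  { apply Rdiv_lt_0_compat; lra. }
  exists M0. intros M HM HM'. unfold Rdiv.
  apply Rle_lt_trans with (2 * b * / INR M0).
  - apply Rmult_le_compat_l; [lra|]. apply Rinv_le_contravar; [now apply lt_0_INR|now apply le_INR].
  - apply Rmult_lt_compat_l with (r := 2 * b) in H0; [|lra].
    replace (2 * b * (d / (2 * b))) with d in H0 by (field; lra). exact H0.
Qed.

Lemma pow_continuous w n eps : 0 < eps -> exists d, 0 < d /\
  forall z, Rabs (z - w) < d -> Rabs (z ^ n - w ^ n) < eps.
Proof.
  intros He.
  destruct (derivable_continuous _ (derivable_pow n) w eps He) as (d & Hd & H).
  exists d; split; [exact Hd|]. intros z Hz.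
  destruct (Req_dec z w) as [->|Hne].
  - rewrite Rminus_diag, Rabs_R0. exact He.
  - apply H. split; [split; [exact I|auto]|exact Hz].
Qed.

Definition hcell (a : R) (N : nat) (c : list nat) : list (R * R) :=
  map (fun j => (node a N j, node a N (S j))) c.

Lemma sumR_chi_interval a N x : 0 < a -> (0 < N)%nat ->
  sumR (seq 0 N) (fun j => chi (node a N j <= x < node a N (S j))) = chi (- a <= x < a).
Proof.
  intros Ha HN.
  rewrite (sumR_ext _ _ (fun j => chi (x < node a N (S j)) - chi (x < node a N j))).
  - rewrite (sumR_seq_telescope (fun j => chi (x < node a N j))). simpl.
    rewrite node_0, node_M by auto. unfold chi.
    repeat match goal with |- context [excluded_middle_informative ?P] =>
      destruct (excluded_middle_informative P) end; lra.
  - intros j _. pose proof (node_mono a N j (S j) Ha HN ltac:(lia)). unfold chi.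
    repeat match goal with |- context [excluded_middle_informative ?P] =>
      destruct (excluded_middle_informative P) end; lra.
Qed.

Lemma chi_and (P Q : Prop) : chi (P /\ Q) = chi P * chi Q.
Proof.
  unfold chi.
    repeat match goal with |- context [excluded_middle_informative ?P] =>
      destruct (excluded_middle_informative P) end; try lra; tauto.
Qed.

Lemma chi_iff (P Q : Prop) : (P <-> Q) -> chi P = chi Q.
Proof. intros H. apply Rle_antisym; apply chi_le; tauto. Qed.

Lemma sumR_chi_hcell n a N x : 0 < a -> (0 < N)%nat -> Rn n x ->
  sumR (grid n N) (fun c => chi (in_hbox (hcell a N c) x)) = chi (Forall (fun t => - a <= t < a) x).
Proof.
  intros Ha HN. revert x; induction n as [|n IH]; intros x Hx.
  - destruct x; [|discriminate]. simpl. rewrite !chi_true; [lra|constructor|constructor].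
  - destruct x as [|x0 x]; [discriminate|]. injection Hx as Hx. rewrite sumR_grid_S.
    erewrite sumR_ext.
    2:{ intros j _. erewrite sumR_ext.
        2:{ intros c _.
            rewrite (chi_iff (in_hbox (hcell a N (j :: c)) (x0 :: x))
              (node a N j <= x0 < node a N (S j) /\ in_hbox (hcell a N c) x))
              by exact (Forall2_cons_iff2 (fun (I : R * R) t => fst I <= t < snd I) _ _ _ _).
            rewrite chi_and. reflexivity. }
        rewrite sumR_scal, IH by easy. reflexivity. }
    simpl. rewrite sumR_scalr, sumR_chi_interval, <- chi_and by auto.
    apply chi_iff. split; [intros []; now constructor|intros H; inversion H; auto].
Qed.

Lemma in_hcell_cell a N c x : in_hbox (hcell a N c) x -> in_cell a N c x.
Proof.
  revert x; induction c as [|j c IH]; intros x H; inversion H; subst; constructor; auto.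
  - unfold node in *; simpl in *; lra.
  - now apply IH.
Qed.

Lemma hcell_widths n a N b c I : 0 < a <= b -> (0 < N)%nat -> In c (grid n N) -> In I (hcell a N c) ->
  snd I - fst I = 2 * a / INR N /\ - b <= fst I /\ snd I <= b.
Proof.
  intros Ha HN Hc HI. apply in_map_iff in HI. destruct HI as (j & <- & Hj). simpl.
  assert (Hj' : (j < N)%nat).
  { clear - Hc Hj. revert c Hc Hj; induction n as [|n IH]; intros c Hc Hj.
    - destruct Hc as [<-|[]]; easy.
    - apply in_grid_S in Hc. destruct Hc as (i & k & -> & Hi & Hk).
      destruct Hj as [<-|Hj]; eauto. }
  rewrite node_S. split; [ring|].
  pose proof (node_mono a N 0 j ltac:(lra) HN ltac:(lia)).
  pose proof (node_mono a N (S j) N ltac:(lra) HN ltac:(lia)).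
  rewrite node_0 in *. rewrite node_M in * by auto. rewrite node_S in *. lra.
Qed.

(** The tags of the fine grid are grouped by the coarse half-open cell containing them; each coarse
    cell receives nearly its own volume, although the grids need not be nested. [M0] is fixed before
    [t] and [s], because [riemann_upper] builds [s] from the tags. *)
Lemma cell_comparison n a N b B eps : 0 < a <= b -> (0 < N)%nat -> 0 <= B -> 0 < eps ->
  exists M0, forall M, (M0 <= M)%nat -> (0 < M)%nat ->
  forall t, (forall k, In k (grid n M) -> in_cell b M k (t k)) ->
  forall f s, (forall x, Rn n x -> f x <> 0 -> in_box a x) ->
  (forall c, In c (grid n N) -> Rabs (s c) <= B) ->
  (forall k c, In k (grid n M) -> In c (grid n N) -> in_hbox (hcell a N c) (t k) -> f (t k) <= s c) ->
  (2 * b / INR M) ^ n * sumR (grid n M) (fun k => f (t k))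
  <= (2 * a / INR N) ^ n * sumR (grid n N) s + eps.
Proof.
  intros Ha HN HB He. set (w := 2 * a / INR N).
  assert (Hw : 0 < w) by (apply mesh_pos; [lra|auto]).
  set (K := INR (length (grid n N))). assert (HK : 0 <= K) by apply pos_INR.
  (* The tolerance for one count: [K] coarse cells with weights at most [B] share the error [eps];
     the [+ 1] keeps the denominator positive. *)
  assert (He' : 0 < eps / (B * K + 1)).
  { apply Rdiv_lt_0_compat; [auto|]. pose proof (Rmult_le_pos _ _ HB HK). lra. }
  destruct (pow_continuous w n _ He') as (d & Hd & Hpow).
  destruct (mesh_small b (Rmin (d / 2) (w / 2))) as (M0 & HM0).
  { lra. } { apply Rmin_pos; lra. }
  exists M0. intros M HM HM' t Ht f s Hf HsB Hs. specialize (HM0 M HM HM').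
  assert (Hb : 0 < b) by lra.
  pose proof (mesh_pos b M Hb HM') as Hh. set (h := 2 * b / INR M) in *.
  pose proof (Rmin_l (d / 2) (w / 2)). pose proof (Rmin_r (d / 2) (w / 2)).
  set (cnt := fun c => h ^ n * sumR (grid n M) (fun k => chi (in_hbox (hcell a N c) (t k)))).
  assert (Hcnt : forall c, In c (grid n N) -> Rabs (cnt c - w ^ n) <= eps / (B * K + 1)).
  { intros c Hc. assert (HL : length (hcell a N c) = n).
    { unfold hcell. rewrite length_map. now apply grid_length with N. }
    assert (Hup : cnt c <= (w + 2 * h) ^ n).
    { apply count_hbox_le; auto; [lra|]. intros I HI. now destruct (hcell_widths n a N b c I). }
    assert (Hlo : (w - 2 * h) ^ n <= cnt c).
    { apply count_hbox_ge; auto. fold h. lra. intros I HI. now apply (hcell_widths n a N b c I). }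
    pose proof (Hpow (w + 2 * h)) as H1. pose proof (Hpow (w - 2 * h)) as H2.
    rewrite Rabs_pos_eq in H1 by lra. rewrite Rabs_left in H2 by lra.
    specialize (H1 ltac:(lra)). specialize (H2 ltac:(lra)).
    apply Rabs_def2 in H1. apply Rabs_def2 in H2. apply Rabs_le. lra. }
  assert (Hsum : sumR (grid n M) (fun k => f (t k)) <=
     sumR (grid n N) (fun c => s c * sumR (grid n M) (fun k => chi (in_hbox (hcell a N c) (t k))))).
  { erewrite (sumR_ext (grid n N)) by (intros; rewrite <- sumR_scal; reflexivity).
    rewrite sumR_swap. apply sumR_le. intros k Hk.
    assert (Hx : Rn n (t k)).
    { red. rewrite (in_cell_length _ _ _ _ (Ht k Hk)). now apply grid_length with M. }
    (* The indicators of the coarse cells add up to [1] wherever [f] is nonzero, since its support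
       lies in the coarse cube. *)
    assert (E : f (t k) = sumR (grid n N) (fun c => f (t k) * chi (in_hbox (hcell a N c) (t k)))).
    { rewrite sumR_scal, sumR_chi_hcell by (auto; lra).
      destruct (Req_dec (f (t k)) 0) as [->|Hne]; [ring|].
      rewrite chi_true; [ring|]. specialize (Hf _ Hx Hne). revert Hf. apply Forall_impl.
      intros u Hu. apply Rabs_def2 in Hu. lra. }
    rewrite E. apply sumR_le. intros c Hc.
    destruct (classic (in_hbox (hcell a N c) (t k))) as [Hin|Hin].
    - rewrite chi_true by auto. specialize (Hs k c Hk Hc Hin). lra.
    - rewrite chi_false by auto. lra. }
  apply Rle_trans with (sumR (grid n N) (fun c => s c * cnt c)).
  { unfold cnt. eapply Rle_trans; [apply Rmult_le_compat_l; [apply pow_le; lra|exact Hsum]|].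
    rewrite <- sumR_scal. right. apply sumR_ext. intros. ring. }
  apply Rle_trans with (sumR (grid n N) (fun c => w ^ n * s c + B * (eps / (B * K + 1)))).
  { apply sumR_le. intros c Hc. specialize (Hcnt c Hc). specialize (HsB c Hc).
    assert (Rabs (s c * (cnt c - w ^ n)) <= B * (eps / (B * K + 1))).
    { rewrite Rabs_mult. apply Rmult_le_compat; auto using Rabs_pos. }
    pose proof (Rle_abs (s c * (cnt c - w ^ n))). lra. }
  rewrite sumR_plus, sumR_scal, sumR_const. fold K.
  assert (K * (B * (eps / (B * K + 1))) <= eps); [|lra].
  assert (0 <= B * K) by now apply Rmult_le_pos.
  replace (K * (B * (eps / (B * K + 1)))) with (eps * ((B * K) / (B * K + 1))) by (field; lra).
  rewrite <- (Rmult_1_r eps) at 2. apply Rmult_le_compat_l; [lra|].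
  apply Rmult_le_reg_r with (B * K + 1); [lra|]. unfold Rdiv. rewrite Rmult_assoc, Rinv_l; lra.
Qed.

Lemma argmax {A} (l : list A) (P : A -> Prop) (f : A -> R) :
  (forall a, In a l -> ~ P a) \/
  exists a, In a l /\ P a /\ forall a', In a' l -> P a' -> f a' <= f a.
Proof.
  induction l as [|a l [IH|(m & Hm & HP & IH)]].
  - left; easy.
  - destruct (classic (P a)) as [Ha|Ha].
    + right. exists a. repeat split; [now left|auto|]. intros a' [<-|H] H'; [lra|]. now elim (IH a').
    + left. intros a' [<-|H]; auto.
  - right. destruct (classic (P a /\ f m <= f a)) as [[Ha Hle]|Ha].
    + exists a. repeat split; [now left|auto|]. intros a' [<-|H] H'; [lra|].
      specialize (IH a' H H'); lra.
    + exists m. repeat split; [now right|auto|]. intros a' [<-|H] H'; auto.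
      destruct (Rle_dec (f a) (f m)); auto. elim Ha. split; auto; lra.
Qed.

Definition corner (a : R) (N : nat) (c : list nat) : list R := map (node a N) c.

Lemma corner_in_cell a N c : 0 < a -> (0 < N)%nat -> in_cell a N c (corner a N c).
Proof.
  intros Ha HN. induction c as [|j c IH]; constructor; auto.
  pose proof (node_mono a N j (S j) Ha HN ltac:(lia)).
  fold (node a N j) (node a N (S j)). lra.
Qed.

(** Each coarse cell is tagged with the fine sample point in it at which [f] is largest. The fine
    sum is then dominated by a coarse Riemann sum, which is close to [v] for every choice of
    tags. *)
Lemma riemann_upper n a b f v B eps : 0 < a <= b -> 0 <= B -> 0 < eps ->
  (forall x, Rn n x -> f x <> 0 -> in_box a x) -> (forall x, Rn n x -> Rabs (f x) <= B) ->
  riemann_box n a f v ->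
  exists M0, forall M, (M0 <= M)%nat -> (0 < M)%nat ->
  forall t, (forall k, In k (grid n M) -> in_cell b M k (t k)) ->
  (2 * b / INR M) ^ n * sumR (grid n M) (fun k => f (t k)) <= v + eps.
Proof.
  intros Ha HB He Hf HfB Hv.
  destruct (Hv (eps / 2) ltac:(lra)) as (N0 & HN0).
  set (N := S N0).
  destruct (cell_comparison n a N b B (eps / 2)) as (M0 & HM0); auto; try (unfold N; lia); [lra|].
  exists M0. intros M HM HM' t Ht.
  assert (Hchoose : forall c, exists x, In c (grid n N) ->
     in_cell a N c x /\ forall k, In k (grid n M) -> in_hbox (hcell a N c) (t k) -> f (t k) <= f x).
  { intros c. destruct (argmax (grid n M) (fun k => in_hbox (hcell a N c) (t k)) (fun k => f (t k)))
      as [Hno|(k & Hk & HP & Hmax)].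
    - exists (corner a N c). intros Hc. split; [apply corner_in_cell; [lra|unfold N; lia]|].
      intros k Hk H; now elim (Hno k).
    - exists (t k). intros Hc. split; [now apply in_hcell_cell|auto]. }
  destruct (ClassicalEpsilon.choice _ Hchoose) as (x & Hx).
  assert (Hlen : forall c, In c (grid n N) -> Rn n (x c)).
  { intros c Hc. red. destruct (Hx c Hc) as [H _]. rewrite (in_cell_length _ _ _ _ H).
    now apply grid_length with N. }
  eapply Rle_trans.
  - apply (HM0 M HM HM' t Ht f (fun c => f (x c))); auto.
    intros k c Hk Hc Hin. now apply Hx.
  - specialize (HN0 N ltac:(unfold N; lia) ltac:(unfold N; lia) x ltac:(intros; now apply Hx)).
    apply Rabs_def2 in HN0. lra.
Qed.

Lemma riemann_box_scal n a f v c : riemann_box n a f v -> riemann_box n a (fun x => c * f x) (c * v).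
Proof.
  intros Hf eps He. assert (0 < Rabs c + 1) by (pose proof (Rabs_pos c); lra).
  destruct (Hf (eps / (Rabs c + 1))) as (N0 & H0).
  { now apply Rdiv_lt_0_compat. }
  exists N0. intros N HN HN' t Ht. rewrite sumR_scal.
  specialize (H0 N HN HN' t Ht).
  replace (_ - _) with (c * ((2 * a / INR N) ^ n * sumR (grid n N) (fun k => f (t k)) - v)) by ring.
  rewrite Rabs_mult. apply Rle_lt_trans with (Rabs c * (eps / (Rabs c + 1))).
  - apply Rmult_le_compat_l; [apply Rabs_pos|lra].
  - pose proof (Rabs_pos c). replace (Rabs c * (eps / (Rabs c + 1))) with (eps * (Rabs c / (Rabs c + 1))) by (field; lra).
    rewrite <- (Rmult_1_r eps) at 2. apply Rmult_lt_compat_l; [lra|].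
    apply Rmult_lt_reg_r with (Rabs c + 1); [lra|]. unfold Rdiv. rewrite Rmult_assoc, Rinv_l; lra.
Qed.

Lemma riemann_box_plus n a f g v w : riemann_box n a f v -> riemann_box n a g w ->
  riemann_box n a (fun x => f x + g x) (v + w).
Proof.
  intros Hf Hg eps He. destruct (Hf (eps / 2)) as (N0 & H0); [lra|].
  destruct (Hg (eps / 2)) as (N1 & H1); [lra|].
  exists (Nat.max N0 N1). intros N HN HN' t Ht. rewrite sumR_plus.
  specialize (H0 N ltac:(lia) HN' t Ht). specialize (H1 N ltac:(lia) HN' t Ht).
  apply Rabs_def2 in H0, H1. apply Rabs_def1; lra.
Qed.

Lemma riemann_box_ext n a f g v : (forall x, Rn n x -> f x = g x) ->
  riemann_box n a f v -> riemann_box n a g v.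
Proof.
  intros E Hf eps He. destruct (Hf eps He) as (N0 & H0). exists N0. intros N HN HN' t Ht.
  rewrite (sumR_ext _ _ (fun k => f (t k))); auto.
  intros k Hk. symmetry. apply E. red. rewrite (in_cell_length _ _ _ _ (Ht k Hk)). now apply grid_length with N.
Qed.

(** Every moment is integrated over a cube of its own, and sums of moments require a common cube.
    The lower bound is the upper bound for [- f]. *)
Lemma riemann_box_enlarge n a b f v B : 0 < a <= b -> 0 <= B ->
  (forall x, Rn n x -> f x <> 0 -> in_box a x) -> (forall x, Rn n x -> Rabs (f x) <= B) ->
  riemann_box n a f v -> riemann_box n b f v.
Proof.
  intros Ha HB Hf HfB Hv eps He.
  destruct (riemann_upper n a b f v B (eps / 2)) as (M1 & H1); auto; [lra|].
  destruct (riemann_upper n a b (fun x => - 1 * f x) (- 1 * v) B (eps / 2)) as (M2 & H2);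
    [auto|auto|lra| | | |].
  { intros x Hx Hne. apply Hf; auto. intros E; apply Hne; rewrite E; ring. }
  { intros x Hx. replace (- 1 * f x) with (- f x) by ring. rewrite Rabs_Ropp. auto. }
  { now apply riemann_box_scal. }
  exists (Nat.max M1 M2). intros M HM HM' t Ht.
  specialize (H1 M ltac:(lia) HM' t Ht). specialize (H2 M ltac:(lia) HM' t Ht).
  rewrite sumR_scal in H2. apply Rabs_def1; lra.
Qed.

(** * Formal polynomials *)

(** Formal polynomials; the same multi-index may occur several times. *)
Definition pl := list (R * list nat).

Definition ev (p : pl) (x : list R) : R := sumR p (fun m => fst m * mono x (snd m)).

Definition wf (n : nat) (p : pl) : Prop := Forall (fun m => length (snd m) = n) p.

(** Operators that are diagonal in the monomials: scalar multiples, the Euler operator, the factors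
    [E - j] and the divergence are all of this form. *)
Definition pw (w : list nat -> R) (p : pl) : pl := map (fun m => (w (snd m) * fst m, snd m)) p.

Definition pscal (c : R) (p : pl) : pl := pw (fun _ => c) p.

(** The Euler operator [sum_i x_i d/dx_i]. *)
Definition pE (p : pl) : pl := pw (fun a => INR (mdeg a)) p.

Definition pmul (p q : pl) : pl :=
  flat_map (fun m => map (fun m' => (fst m * fst m', addmi (snd m) (snd m'))) q) p.

Definition pconst (n : nat) (c : R) : pl := [(c, repeat 0%nat n)].

Fixpoint ppow (n : nat) (p : pl) (m : nat) : pl :=
  match m with O => pconst n 1 | S m' => pmul p (ppow n p m') end.

Definition pcomp (j : nat) (p : pl) : pl := filter (fun m => Nat.eqb (mdeg (snd m)) j) p.

Definition feq (n : nat) (p q : pl) : Prop := forall x, Rn n x -> ev p x = ev q x.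
Definition fnz (n : nat) (p : pl) : Prop := exists x, Rn n x /\ ev p x <> 0.

Lemma mono_addmi n a b x : length a = n -> length b = n -> Rn n x ->
  mono x (addmi a b) = mono x a * mono x b.
Proof.
  revert a b x; induction n as [|n IH]; intros [|a0 a] [|b0 b] [|x0 x] Ha Hb Hx; try discriminate.
  - simpl; ring.
  - injection Ha as Ha. injection Hb as Hb. injection Hx as Hx. simpl.
    rewrite IH, pow_add by auto. ring.
Qed.

Lemma mdeg_addmi n a b : length a = n -> length b = n -> mdeg (addmi a b) = (mdeg a + mdeg b)%nat.
Proof.
  revert a b; induction n as [|n IH]; intros [|a0 a] [|b0 b] Ha Hb; try discriminate; [easy|].
  injection Ha as Ha. injection Hb as Hb. unfold mdeg in *. simpl. rewrite IH by auto. lia.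
Qed.

Lemma length_addmi n a b : length a = n -> length b = n -> length (addmi a b) = n.
Proof.
  revert a b; induction n as [|n IH]; intros [|a0 a] [|b0 b] Ha Hb; try discriminate; [easy|].
  injection Ha as Ha. injection Hb as Hb. simpl. now rewrite IH.
Qed.

Lemma mdeg_repeat n : mdeg (repeat 0%nat n) = 0%nat.
Proof. induction n; simpl; auto. Qed.

Lemma mono_repeat n x : mono x (repeat 0%nat n) = 1.
Proof. revert x; induction n; intros [|x0 x]; simpl; auto. rewrite IHn; ring. Qed.

Lemma mdeg_0 a : mdeg a = 0%nat -> a = repeat 0%nat (length a).
Proof.
  induction a as [|a0 a IH]; [easy|]. unfold mdeg in *. simpl. intros H.
  rewrite <- IH by lia. f_equal; lia.
Qed.

Lemma wf_app n p q : wf n p -> wf n q -> wf n (p ++ q).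
Proof. intros; apply Forall_app; auto. Qed.
Lemma wf_pw n w p : wf n p -> wf n (pw w p).
Proof. intros H. apply Forall_map. exact H. Qed.
Lemma wf_pscal n c p : wf n p -> wf n (pscal c p).
Proof. apply wf_pw. Qed.
Lemma wf_pE n p : wf n p -> wf n (pE p).
Proof. apply wf_pw. Qed.
Lemma wf_pmul n p q : wf n p -> wf n q -> wf n (pmul p q).
Proof.
  unfold wf. rewrite !Forall_forall. intros Hp Hq m Hm. unfold pmul in Hm.
  apply in_flat_map in Hm. destruct Hm as (m1 & H1 & Hm). apply in_map_iff in Hm.
  destruct Hm as (m2 & <- & H2). simpl. apply length_addmi; auto.
Qed.
Lemma wf_pconst n c : wf n (pconst n c).
Proof. constructor; [apply repeat_length|constructor]. Qed.
Lemma wf_ppow n p m : wf n p -> wf n (ppow n p m).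
Proof. intros H; induction m; simpl; auto using wf_pconst, wf_pmul. Qed.
Lemma wf_pcomp n j p : wf n p -> wf n (pcomp j p).
Proof. unfold wf, pcomp. intros H. apply incl_Forall with p; auto. apply incl_filter. Qed.

#[global] Hint Resolve wf_app wf_pw wf_pscal wf_pE wf_pmul wf_pconst wf_ppow wf_pcomp : wf.

Lemma ev_app p q x : ev (p ++ q) x = ev p x + ev q x.
Proof. apply sumR_app. Qed.
Lemma ev_pscal c p x : ev (pscal c p) x = c * ev p x.
Proof. unfold ev, pscal, pw. rewrite sumR_map, <- sumR_scal. apply sumR_ext; intros; simpl; ring. Qed.
Lemma ev_pconst n c x : ev (pconst n c) x = c.
Proof. unfold ev, pconst; simpl. rewrite mono_repeat. ring. Qed.

Lemma sumR_pmul n p q (F : R * list nat -> R) (G : R * list nat -> R * list nat -> R) :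
  wf n p -> wf n q ->
  (forall m m', length (snd m) = n -> length (snd m') = n ->
     F (fst m * fst m', addmi (snd m) (snd m')) = G m m') ->
  sumR (pmul p q) F = sumR p (fun m => sumR q (G m)).
Proof.
  unfold wf, pmul. rewrite !Forall_forall. intros Hp Hq H. rewrite sumR_flat_map.
  apply sumR_ext; intros m Hm. rewrite sumR_map. apply sumR_ext. auto.
Qed.

Lemma sumR_prod {A B} (l : list A) (m : list B) f g :
  sumR l (fun a => sumR m (fun b => f a * g b)) = sumR l f * sumR m g.
Proof.
  rewrite <- sumR_scalr. apply sumR_ext; intros. apply sumR_scal.
Qed.

Lemma ev_pmul n p q x : wf n p -> wf n q -> Rn n x -> ev (pmul p q) x = ev p x * ev q x.
Proof.
  intros Hp Hq Hx. unfold ev. erewrite (sumR_pmul n); [|auto|auto|].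
  2:{ intros m m' Hm Hm'. simpl. rewrite (mono_addmi n) by auto.
      instantiate (1 := fun m m' => (fst m * mono x (snd m)) * (fst m' * mono x (snd m'))). simpl; ring. }
  apply sumR_prod.
Qed.

Lemma ev_ppow n p m x : wf n p -> Rn n x -> ev (ppow n p m) x = ev p x ^ m.
Proof.
  intros Hp Hx. induction m; simpl; [apply ev_pconst|].
  rewrite (ev_pmul n), IHm; auto with wf.
Qed.

Lemma ev_pE_pmul n p q x : wf n p -> wf n q -> Rn n x ->
  ev (pE (pmul p q)) x = ev (pE p) x * ev q x + ev p x * ev (pE q) x.
Proof.
  intros Hp Hq Hx. unfold ev, pE, pw. rewrite !sumR_map.
  erewrite (sumR_pmul n); [|auto|auto|].
  2:{ intros m m' Hm Hm'. simpl. rewrite (mono_addmi n), (mdeg_addmi n), plus_INR by auto.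
      instantiate (1 := fun m m' => (INR (mdeg (snd m)) * fst m * mono x (snd m)) * (fst m' * mono x (snd m'))
       + (fst m * mono x (snd m)) * (INR (mdeg (snd m')) * fst m' * mono x (snd m'))). simpl; ring. }
  simpl. rewrite <- !sumR_prod, <- sumR_plus. apply sumR_ext; intros. now rewrite sumR_plus.
Qed.

Lemma ev_pE_app p q x : ev (pE (p ++ q)) x = ev (pE p) x + ev (pE q) x.
Proof. unfold pE, pw. rewrite map_app. apply ev_app. Qed.
Lemma ev_pE_pscal c p x : ev (pE (pscal c p)) x = c * ev (pE p) x.
Proof.
  unfold ev, pE, pscal, pw. rewrite !sumR_map, <- sumR_scal. apply sumR_ext; intros; simpl; ring.
Qed.
Lemma ev_pE_pconst n c x : ev (pE (pconst n c)) x = 0.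
Proof. unfold ev, pE, pw, pconst; simpl. rewrite mdeg_repeat. simpl; ring. Qed.

Lemma ev_pE_ppow n p m x : wf n p -> Rn n x ->
  ev (pE (ppow n p (S m))) x = INR (S m) * ev p x ^ m * ev (pE p) x.
Proof.
  intros Hp Hx. induction m as [|m IH].
  - simpl ppow. rewrite (ev_pE_pmul n), ev_pconst, ev_pE_pconst by auto with wf. simpl; ring.
  - change (ppow n p (S (S m))) with (pmul p (ppow n p (S m))).
    rewrite (ev_pE_pmul n), IH, (ev_ppow n), (S_INR (S m)) by auto with wf. simpl (_ ^ S m). ring.
Qed.

Definition scal (t : R) (x : list R) : list R := map (Rmult t) x.

Lemma Rn_scal n t x : Rn n x -> Rn n (scal t x).
Proof. unfold Rn, scal. now rewrite length_map. Qed.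

Lemma mono_scal t x a : length x = length a -> mono (scal t x) a = t ^ mdeg a * mono x a.
Proof.
  revert x; induction a as [|a0 a IH]; intros [|x0 x]; simpl; try discriminate; intros H; [ring|].
  injection H as H. rewrite IH, pow_add, Rpow_mult_distr by auto. unfold mdeg. ring.
Qed.

Lemma scal_1 x : scal 1 x = x.
Proof. unfold scal. rewrite <- (map_id x) at 2. apply map_ext; intros; ring. Qed.
Lemma scal_0 n x : Rn n x -> scal 0 x = repeat 0 n.
Proof.
  intros <-. induction x as [|x0 x IH]; simpl; [easy|]. rewrite <- IH. unfold scal. f_equal; ring.
Qed.

Lemma ev_scal n p t x : wf n p -> Rn n x ->
  ev p (scal t x) = sumR p (fun m => t ^ mdeg (snd m) * (fst m * mono x (snd m))).
Proof.
  unfold wf; rewrite Forall_forall. intros Hp Hx. apply sumR_ext. intros m Hm.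
  rewrite mono_scal; [ring|]. rewrite Hx. symmetry; auto.
Qed.

Lemma derivable_pt_lim_sumR {A} (l : list A) (f : A -> R -> R) (d : A -> R) t :
  (forall a, In a l -> derivable_pt_lim (f a) t (d a)) ->
  derivable_pt_lim (fun s => sumR l (fun a => f a s)) t (sumR l d).
Proof.
  induction l as [|a l IH]; intros H; simpl.
  - apply (derivable_pt_lim_const 0).
  - apply (derivable_pt_lim_plus (f a) (fun s => sumR l (fun a => f a s))).
    + apply H; now left.
    + apply IH; intros; apply H; now right.
Qed.

(** [E] is [t d/dt] along the ray; the product form [t * d] also covers [t = 0]. *)
Lemma ev_ray_derivable n p x t : wf n p -> Rn n x -> exists d,
  derivable_pt_lim (fun s => ev p (scal s x)) t d /\ t * d = ev (pE p) (scal t x).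
Proof.
  intros Hp Hx.
  exists (sumR p (fun m => INR (mdeg (snd m)) * t ^ pred (mdeg (snd m)) * (fst m * mono x (snd m)))).
  split.
  - assert (H : derivable_pt_lim (fun s => sumR p (fun m => s ^ mdeg (snd m) * (fst m * mono x (snd m)))) t
     (sumR p (fun m => INR (mdeg (snd m)) * t ^ pred (mdeg (snd m)) * (fst m * mono x (snd m))))).
    { apply derivable_pt_lim_sumR. intros m _.
      replace (INR (mdeg (snd m)) * t ^ pred (mdeg (snd m)) * (fst m * mono x (snd m))) with
       (INR (mdeg (snd m)) * t ^ pred (mdeg (snd m)) * (fst m * mono x (snd m)) + t ^ mdeg (snd m) * 0) by ring.
      apply (derivable_pt_lim_mult (fun s => s ^ mdeg (snd m)) (fun _ => fst m * mono x (snd m))).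
      - apply derivable_pt_lim_pow.
      - apply derivable_pt_lim_const. }
    intros eps He. destruct (H eps He) as (dl & Hd). exists dl. intros h Hh0 Hh.
    rewrite !(ev_scal n) by auto. now apply Hd.
  - rewrite (ev_scal n) by auto with wf. unfold pE, pw. rewrite sumR_map, <- sumR_scal.
    apply sumR_ext. intros m _. simpl. destruct (mdeg (snd m)) as [|k]; simpl pred; [simpl; ring|].
    simpl (t ^ S k). ring.
Qed.

(** [pE] acts on formal sums, and different sums may be the same function; the derivative along the
    ray at [t = 1] shows that the result depends on the function only. *)
Lemma feq_pE n p q : wf n p -> wf n q -> feq n p q -> feq n (pE p) (pE q).
Proof.
  intros Hp Hq H x Hx.
  destruct (ev_ray_derivable n p x 1 Hp Hx) as (d1 & H1 & E1).
  destruct (ev_ray_derivable n q x 1 Hq Hx) as (d2 & H2 & E2).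
  rewrite scal_1 in *. rewrite <- E1, <- E2. f_equal.
  apply uniqueness_limite with (fun s => ev p (scal s x)) 1; auto.
  intros eps He. destruct (H2 eps He) as (dl & Hd). exists dl. intros h Hh0 Hh.
  rewrite !H by now apply Rn_scal. now apply Hd.
Qed.

Definition cev (j : nat) (p : pl) (x : list R) : R := ev (pcomp j p) x.

Lemma cev_eq j p x : cev j p x =
  sumR p (fun m => if Nat.eqb (mdeg (snd m)) j then fst m * mono x (snd m) else 0).
Proof.
  unfold cev, ev, pcomp. induction p as [|m p IH]; simpl; [easy|].
  destruct (Nat.eqb (mdeg (snd m)) j); simpl; rewrite IH; lra.
Qed.

Definition degs (lo hi : nat) (p : pl) : Prop :=
  Forall (fun m => (lo <= mdeg (snd m) <= hi)%nat) p.

Lemma degs_exists p : exists hi, degs 0 hi p.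
Proof.
  induction p as [|m p (hi & IH)]; [exists 0%nat; constructor|].
  exists (Nat.max (mdeg (snd m)) hi). constructor; [lia|].
  revert IH; apply Forall_impl; intros; lia.
Qed.

Lemma degs_weaken lo hi lo' hi' p : (lo' <= lo)%nat -> (hi <= hi')%nat -> degs lo hi p -> degs lo' hi' p.
Proof. intros H1 H2. apply Forall_impl. intros; lia. Qed.

Lemma cev_out lo hi p j x : degs lo hi p -> (j < lo \/ hi < j)%nat -> cev j p x = 0.
Proof.
  intros H Hj. rewrite cev_eq. apply sumR_zero. intros m Hm.
  red in H. rewrite Forall_forall in H. specialize (H m Hm).
  destruct (Nat.eqb_spec (mdeg (snd m)) j); [lia|easy].
Qed.

Lemma sumR_seq_single K j (f : nat -> R) : (j < K)%nat ->
  sumR (seq 0 K) (fun i => if Nat.eqb j i then f i else 0) = f j.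
Proof.
  intros Hj. induction K as [|K IH]; [lia|].
  rewrite seq_S, sumR_app. simpl. destruct (Nat.eqb_spec j K) as [->|Hne].
  - rewrite sumR_zero; [lra|]. intros i Hi. apply in_seq in Hi.
    destruct (Nat.eqb_spec K i); [lia|easy].
  - rewrite IH by lia. lra.
Qed.

Lemma ev_scal_comps n p t x hi : wf n p -> Rn n x -> degs 0 hi p ->
  ev p (scal t x) = sumR (seq 0 (S hi)) (fun j => t ^ j * cev j p x).
Proof.
  intros Hp Hx Hd. rewrite (ev_scal n) by auto.
  erewrite (sumR_ext (seq 0 (S hi))) by (intros; rewrite cev_eq, <- sumR_scal; reflexivity).
  rewrite sumR_swap. apply sumR_ext. intros m Hm.
  red in Hd. rewrite Forall_forall in Hd. specialize (Hd m Hm).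
  rewrite <- (sumR_seq_single (S hi) (mdeg (snd m)) (fun i => t ^ i * (fst m * mono x (snd m)))) by lia.
  apply sumR_ext. intros i _. destruct (Nat.eqb_spec (mdeg (snd m)) i); ring.
Qed.

Lemma ev_comps n p x hi : wf n p -> Rn n x -> degs 0 hi p ->
  ev p x = sumR (seq 0 (S hi)) (fun j => cev j p x).
Proof.
  intros Hp Hx Hd. rewrite <- (scal_1 x) at 1. rewrite (ev_scal_comps n p 1 x hi) by auto.
  apply sumR_ext; intros. rewrite pow1; ring.
Qed.

(** Letting [t] tend to [0] isolates [c 0]; dividing by [t] then shortens the sum. *)
Lemma poly1_uniq K (c : nat -> R) :
  (forall t, 0 < t < 1 -> sumR (seq 0 K) (fun j => t ^ j * c j) = 0) ->
  forall j, (j < K)%nat -> c j = 0.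
Proof.
  revert c; induction K as [|K IH]; intros c H j Hj; [lia|].
  assert (Hs : forall t, sumR (seq 0 (S K)) (fun j => t ^ j * c j) =
     c 0%nat + t * sumR (seq 0 K) (fun j => t ^ j * c (S j))).
  { intros t. simpl. rewrite <- seq_shift, sumR_map, <- sumR_scal, Rmult_1_l. f_equal.
    apply sumR_ext; intros; simpl; ring. }
  assert (H0 : c 0%nat = 0).
  { set (C := sumR (seq 0 K) (fun j => Rabs (c (S j)))).
    assert (HC : 0 <= C) by (apply sumR_nonneg; intros; apply Rabs_pos).
    assert (Hle : forall t, 0 < t < 1 -> Rabs (c 0%nat) <= t * C).
    { intros t Ht. specialize (H t Ht). rewrite Hs in H.
      replace (c 0%nat) with (- (t * sumR (seq 0 K) (fun j => t ^ j * c (S j)))) by lra.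
      rewrite Rabs_Ropp, Rabs_mult, (Rabs_pos_eq t) by lra. apply Rmult_le_compat_l; [lra|].
      eapply Rle_trans; [apply sumR_abs|]. apply sumR_le. intros i _.
      rewrite Rabs_mult. transitivity (1 * Rabs (c (S i))); [|lra].
      apply Rmult_le_compat_r; [apply Rabs_pos|]. rewrite Rabs_pos_eq by (apply pow_le; lra).
      rewrite <- (pow1 i). apply pow_incr; lra. }
    destruct (Req_dec (c 0%nat) 0) as [E|E]; [exact E|]. apply Rabs_pos_lt in E.
    (* Small enough that [t * C] is at most half of [Rabs (c 0)]. *)
    set (t := Rmin (1 / 2) (Rabs (c 0%nat) / (2 * (C + 1)))).
    assert (Ht : 0 < t) by (apply Rmin_pos; [lra|apply Rdiv_lt_0_compat; lra]).
    pose proof (Rmin_l (1/2) (Rabs (c 0%nat) / (2 * (C + 1)))).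
    pose proof (Rmin_r (1/2) (Rabs (c 0%nat) / (2 * (C + 1)))). fold t in H0, H1.
    specialize (Hle t ltac:(lra)).
    assert (t * C <= Rabs (c 0%nat) / (2 * (C + 1)) * (C + 1)) by (apply Rmult_le_compat; lra).
    replace (Rabs (c 0%nat) / (2 * (C + 1)) * (C + 1)) with (Rabs (c 0%nat) / 2) in H2 by (field; lra).
    lra. }
  destruct j as [|j]; [exact H0|].
  apply (IH (fun j => c (S j))); [|lia]. intros t Ht. specialize (H t Ht). rewrite Hs, H0 in H.
  apply Rmult_eq_reg_l with t; lra.
Qed.

(** On the ray through [x] the component of degree [j] is the coefficient of [t ^ j], so it depends
    on the function only. *)
Lemma feq_cev n p q j : wf n p -> wf n q -> feq n p q -> forall x, Rn n x -> cev j p x = cev j q x.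
Proof.
  intros Hp Hq H x Hx.
  destruct (degs_exists p) as (h1 & H1). destruct (degs_exists q) as (h2 & H2).
  set (K := Nat.max j (Nat.max h1 h2)).
  apply (degs_weaken 0 h1 0 K) in H1; [|lia|unfold K; lia].
  apply (degs_weaken 0 h2 0 K) in H2; [|lia|unfold K; lia].
  apply Rminus_diag_uniq.
  apply (poly1_uniq (S K) (fun j => cev j p x - cev j q x)); [|unfold K; lia].
  intros t Ht. erewrite sumR_ext by (intros; rewrite Rmult_minus_distr_l; reflexivity).
  rewrite sumR_minus, <- !(ev_scal_comps n) by auto. rewrite H by now apply Rn_scal. lra.
Qed.

(** The last hypothesis holds if [b] and [r] are the lowest degrees of [p] and [q], or their highest ones. *)
Lemma cev_pmul_ends n p q b r x : wf n p -> wf n q -> Rn n x ->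
  (forall m m', In m p -> In m' q ->
     (mdeg (snd m) + mdeg (snd m') = b + r)%nat -> mdeg (snd m) = b) ->
  cev (b + r) (pmul p q) x = cev b p x * cev r q x.
Proof.
  unfold wf. intros Hp Hq Hx H. rewrite !cev_eq.
  erewrite (sumR_pmul n); [|auto|auto|intros; reflexivity]. rewrite <- sumR_prod.
  rewrite Forall_forall in Hp, Hq.
  apply sumR_ext; intros m Hm. apply sumR_ext; intros m' Hm'. simpl.
  rewrite (mdeg_addmi n), (mono_addmi n) by auto. specialize (H m m' Hm Hm').
  destruct (Nat.eqb_spec (mdeg (snd m) + mdeg (snd m')) (b + r)),
    (Nat.eqb_spec (mdeg (snd m)) b), (Nat.eqb_spec (mdeg (snd m')) r); try ring; lia.
Qed.

Lemma degs_pcomp j p : degs j j (pcomp j p).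
Proof.
  apply Forall_forall. intros m Hm. apply filter_In in Hm. destruct Hm as [_ Hm].
  apply Nat.eqb_eq in Hm. lia.
Qed.

Lemma degs_app lo hi p q : degs lo hi p -> degs lo hi q -> degs lo hi (p ++ q).
Proof. intros; apply Forall_app; auto. Qed.

Lemma degs_pw w lo hi p : degs lo hi p -> degs lo hi (pw w p).
Proof. intros H. apply Forall_map. exact H. Qed.

Lemma degs_pmul n lo hi lo' hi' p q : wf n p -> wf n q -> degs lo hi p -> degs lo' hi' q ->
  degs (lo + lo') (hi + hi') (pmul p q).
Proof.
  unfold wf, degs. rewrite !Forall_forall. intros Hp Hq H H' m Hm. apply in_flat_map in Hm.
  destruct Hm as (m1 & H1 & Hm). apply in_map_iff in Hm. destruct Hm as (m2 & <- & H2).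
  simpl. rewrite (mdeg_addmi n) by auto. specialize (H m1 H1). specialize (H' m2 H2). lia.
Qed.

(** * Sup-norm balls and restrictions to segments *)

(** Sup-norm balls, in place of the Euclidean balls of [dist2]. *)
Definition nb (r : R) (x z : list R) : Prop := Forall2 (fun u v => Rabs (u - v) < r) x z.

Lemma nb_refl r x : 0 < r -> nb r x x.
Proof. intros Hr. induction x; constructor; auto. now rewrite Rminus_diag, Rabs_R0. Qed.
Lemma nb_mono r s x z : r <= s -> nb r x z -> nb s x z.
Proof. intros Hr H; induction H; constructor; auto. lra. Qed.
Lemma nb_length r x z : nb r x z -> length x = length z.
Proof. intros H; induction H; simpl; auto. Qed.
Lemma nb_Rn n r x z : nb r x z -> Rn n x -> Rn n z.
Proof. intros H <-. red. now rewrite (nb_length _ _ _ H). Qed.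
Lemma nb_trans r s x y z : nb r x y -> nb s y z -> nb (r + s) x z.
Proof.
  intros H. revert z. induction H; intros z' H'; inversion H'; subst; constructor.
  - match goal with |- Rabs (?a - ?c) < _ =>
     match goal with H : Rabs (a - ?b) < r |- _ =>
       replace (a - c) with ((a - b) + (b - c)) by ring end end.
    eapply Rle_lt_trans; [apply Rabs_triang|]. lra.
  - now apply IHForall2.
Qed.

Lemma dist2_cons x0 x z0 z : dist2 (x0 :: x) (z0 :: z) = (x0 - z0) ^ 2 + dist2 x z.
Proof. reflexivity. Qed.

Lemma nb_of_dist2 n r x z : 0 < r -> Rn n x -> Rn n z -> dist2 x z < r ^ 2 -> nb r x z.
Proof.
  intros Hr. revert x z; induction n as [|n IH]; intros [|x0 x] [|z0 z] Hx Hz; try discriminate; intros H.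
  - constructor.
  - injection Hx as Hx. injection Hz as Hz. rewrite dist2_cons in H.
    assert (0 <= dist2 x z) by (apply sumR_nonneg; intros; apply pow2_ge_0).
    assert (Rsqr (x0 - z0) < Rsqr r) by (unfold Rsqr; nra).
    constructor.
    + rewrite <- (Rabs_pos_eq r) by lra. now apply Rsqr_lt_abs_0.
    + apply IH; auto. pose proof (pow2_ge_0 (x0 - z0)). lra.
Qed.

Lemma dist2_of_nb n r : 0 < r -> exists r', 0 < r' /\
  forall x z, Rn n x -> nb r' x z -> dist2 x z < r ^ 2.
Proof.
  intros Hr. exists (r / (INR n + 1)). pose proof (pos_INR n) as Hn.
  assert (Hr' : 0 < r / (INR n + 1)) by (apply Rdiv_lt_0_compat; lra).
  split; [exact Hr'|]. intros x z Hx Hnb.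
  apply Rle_lt_trans with (INR n * (r / (INR n + 1)) ^ 2).
  - set (w := r / (INR n + 1)) in *. clearbody w. rewrite <- Hx. clear Hx.
    induction Hnb as [|x0 z0 x z H0 Hnb IH].
    + unfold dist2; simpl; lra.
    + change (length (x0 :: x)) with (S (length x)). rewrite S_INR, dist2_cons.
      assert ((x0 - z0) ^ 2 <= w ^ 2); [|lra].
      rewrite <- !Rsqr_pow2. apply Rsqr_le_abs_1. rewrite (Rabs_pos_eq w); lra.
  - replace (INR n * (r / (INR n + 1)) ^ 2) with (r ^ 2 * (INR n / ((INR n + 1) * (INR n + 1)))) by (field; lra).
    assert (0 < r ^ 2) by (apply pow_lt; lra).
    rewrite <- (Rmult_1_r (r ^ 2)) at 2. apply Rmult_lt_compat_l; auto.
    apply Rmult_lt_reg_r with ((INR n + 1) * (INR n + 1)); [nra|].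
    unfold Rdiv. rewrite Rmult_assoc, Rinv_l; nra.
Qed.

Definition cont (f : list R -> R) (x : list R) : Prop :=
  forall eps, 0 < eps -> exists d, 0 < d /\ forall z, nb d x z -> Rabs (f z - f x) < eps.

Lemma mult_continuous u v eps : 0 < eps -> exists d, 0 < d /\
  forall u' v', Rabs (u' - u) < d -> Rabs (v' - v) < d -> Rabs (u' * v' - u * v) < eps.
Proof.
  intros He. pose proof (Rabs_pos u). pose proof (Rabs_pos v).
  assert (Hd : 0 < eps / (Rabs u + Rabs v + 1)) by (apply Rdiv_lt_0_compat; lra).
  exists (Rmin 1 (eps / (Rabs u + Rabs v + 1))). split; [apply Rmin_pos; lra|].
  set (d := Rmin _ _). assert (Hd1 : d <= 1) by apply Rmin_l.
  assert (Hd2 : d <= eps / (Rabs u + Rabs v + 1)) by apply Rmin_r.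
  assert (Hd3 : d * (Rabs u + Rabs v + 1) <= eps).
  { apply Rmult_le_compat_r with (r := Rabs u + Rabs v + 1) in Hd2; [|lra].
    replace (eps / (Rabs u + Rabs v + 1) * (Rabs u + Rabs v + 1)) with eps in Hd2 by (field; lra). exact Hd2. }
  intros u' v' Hu Hv.
  replace (u' * v' - u * v) with ((u' - u) * (v' - v) + (u * (v' - v) + v * (u' - u))) by ring.
  eapply Rle_lt_trans; [apply Rabs_triang|].
  eapply Rle_lt_trans; [apply Rplus_le_compat_l, Rabs_triang|]. rewrite !Rabs_mult.
  pose proof (Rabs_pos (u' - u)). pose proof (Rabs_pos (v' - v)). nra.
Qed.

Lemma cont_mono a x : cont (fun z => mono z a) x.
Proof.
  revert x; induction a as [|a0 a IH]; intros [|x0 x] eps He.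
  - exists 1; split; [lra|]. intros z Hz; inversion Hz; simpl. rewrite Rminus_diag, Rabs_R0; lra.
  - exists 1; split; [lra|]. intros z Hz; inversion Hz; simpl. rewrite Rminus_diag, Rabs_R0; lra.
  - exists 1; split; [lra|]. intros z Hz; inversion Hz; simpl. rewrite Rminus_diag, Rabs_R0; lra.
  - destruct (mult_continuous (x0 ^ a0) (mono x a) eps He) as (d & Hd & H).
    destruct (pow_continuous x0 a0 d Hd) as (d1 & Hd1 & H1).
    destruct (IH x d Hd) as (d2 & Hd2 & H2).
    exists (Rmin d1 d2). split; [now apply Rmin_pos|]. intros z Hz.
    inversion Hz as [|? z0 ? z' Hz0 Hz']; subst. simpl. apply H.
    + apply H1. rewrite Rabs_minus_sym. pose proof (Rmin_l d1 d2); lra.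
    + apply H2. eapply nb_mono; [apply Rmin_r|exact Hz'].
Qed.

Lemma cont_ev p x : cont (ev p) x.
Proof.
  induction p as [|m p IH]; intros eps He.
  - exists 1; split; [lra|]. intros; unfold ev; simpl. rewrite Rminus_diag, Rabs_R0; lra.
  - pose proof (Rabs_pos (fst m)).
    destruct (cont_mono (snd m) x (eps / 2 / (Rabs (fst m) + 1))) as (d1 & Hd1 & H1).
    { apply Rdiv_lt_0_compat; lra. }
    destruct (IH (eps / 2)) as (d2 & Hd2 & H2); [lra|].
    exists (Rmin d1 d2). split; [now apply Rmin_pos|]. intros z Hz.
    specialize (H1 z (nb_mono _ _ _ _ (Rmin_l d1 d2) Hz)).
    specialize (H2 z (nb_mono _ _ _ _ (Rmin_r d1 d2) Hz)).
    unfold ev in *. simpl.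
    replace (_ - _) with (fst m * (mono z (snd m) - mono x (snd m)) +
      (sumR p (fun m => fst m * mono z (snd m)) - sumR p (fun m => fst m * mono x (snd m)))) by ring.
    eapply Rle_lt_trans; [apply Rabs_triang|]. rewrite Rabs_mult.
    assert (Rabs (fst m) * Rabs (mono z (snd m) - mono x (snd m)) <= eps / 2); [|lra].
    apply Rle_trans with (Rabs (fst m) * (eps / 2 / (Rabs (fst m) + 1))).
    + apply Rmult_le_compat_l; lra.
    + apply Rmult_le_reg_r with (Rabs (fst m) + 1); [lra|].
      replace (Rabs (fst m) * (eps / 2 / (Rabs (fst m) + 1)) * (Rabs (fst m) + 1)) with (Rabs (fst m) * (eps / 2)) by (field; lra).
      nra.
Qed.

Lemma ev_pos_near p x c : c < ev p x -> exists d, 0 < d /\ forall z, nb d x z -> c < ev p z.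
Proof.
  intros H. destruct (cont_ev p x (ev p x - c)) as (d & Hd & Hz); [lra|].
  exists d; split; auto. intros z Hn. specialize (Hz z Hn). apply Rabs_def2 in Hz. lra.
Qed.

Lemma ev_neg_near p x c : ev p x < c -> exists d, 0 < d /\ forall z, nb d x z -> ev p z < c.
Proof.
  intros H. destruct (cont_ev p x (c - ev p x)) as (d & Hd & Hz); [lra|].
  exists d; split; auto. intros z Hn. specialize (Hz z Hn). apply Rabs_def2 in Hz. lra.
Qed.

Lemma mono_bounded b a x : 0 <= b -> Forall (fun t => Rabs t <= b) x -> Rabs (mono x a) <= (b + 1) ^ mdeg a.
Proof.
  intros Hb. revert x; induction a as [|a0 a IH]; intros x Hx; destruct Hx as [|x0 x H0 Hx].
  1-3: simpl mono; rewrite Rabs_R1; apply pow_R1_Rle; lra.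
  change (mdeg (a0 :: a)) with (a0 + mdeg a)%nat. simpl mono.
  rewrite Rabs_mult, pow_add. apply Rmult_le_compat; auto using Rabs_pos.
  rewrite <- RPow_abs. apply pow_incr. split; [apply Rabs_pos|lra].
Qed.

Lemma ev_bounded b p : 0 <= b -> exists C, 0 <= C /\
  forall x, Forall (fun t => Rabs t <= b) x -> Rabs (ev p x) <= C.
Proof.
  intros Hb. exists (sumR p (fun m => Rabs (fst m) * (b + 1) ^ mdeg (snd m))). split.
  - apply sumR_nonneg. intros. apply Rmult_le_pos; [apply Rabs_pos|apply pow_le; lra].
  - intros x Hx. eapply Rle_trans; [apply sumR_abs|]. apply sumR_le. intros m _.
    rewrite Rabs_mult. apply Rmult_le_compat_l; [apply Rabs_pos|]. now apply mono_bounded.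
Qed.

Definition seg (x z : list R) (s : R) : list R :=
  map (fun pr => fst pr + s * (snd pr - fst pr)) (combine x z).

Lemma Rn_seg n x z s : Rn n x -> Rn n z -> Rn n (seg x z s).
Proof. unfold Rn, seg. rewrite length_map, length_combine. lia. Qed.

Lemma seg_0 n x z : Rn n x -> Rn n z -> seg x z 0 = x.
Proof.
  revert x z; induction n as [|n IH]; intros [|x0 x] [|z0 z] Hx Hz; try discriminate; auto.
  injection Hx as Hx. injection Hz as Hz. unfold seg in *; simpl. rewrite IH by auto. f_equal; ring.
Qed.
Lemma seg_1 n x z : Rn n x -> Rn n z -> seg x z 1 = z.
Proof.
  revert x z; induction n as [|n IH]; intros [|x0 x] [|z0 z] Hx Hz; try discriminate; auto.
  injection Hx as Hx. injection Hz as Hz. unfold seg in *; simpl. rewrite IH by auto. f_equal; ring.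
Qed.
Lemma seg_scal x u s : seg x (scal u x) s = scal (1 + s * (u - 1)) x.
Proof.
  induction x as [|x0 x IH]; [easy|]. unfold seg, scal in *; simpl. rewrite IH. f_equal; ring.
Qed.
Lemma seg_zero n x s : Rn n x -> seg (repeat 0 n) x s = scal s x.
Proof.
  intros <-. induction x as [|x0 x IH]; [easy|]. unfold seg, scal in *; simpl. rewrite IH. f_equal; ring.
Qed.

Lemma nb_seg r c x z s : nb r c x -> nb r c z -> 0 <= s <= 1 -> nb r c (seg x z s).
Proof.
  intros Hx. revert z; induction Hx as [|c0 x0 c x H0 Hx IH]; intros z Hz Hs; inversion Hz; subst.
  - constructor.
  - unfold seg; simpl. constructor.
    + match goal with H : Rabs (c0 - ?z0) < r |- context [?x1 + s * (?z0 - _)] =>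
        replace (c0 - (x1 + s * (z0 - x1))) with ((1 - s) * (c0 - x1) + s * (c0 - z0)) by ring;
        eapply Rle_lt_trans; [apply Rabs_triang|]; rewrite !Rabs_mult, (Rabs_pos_eq s), (Rabs_pos_eq (1 - s)) by lra
      end.
      match goal with |- (1 - s) * ?a + s * ?b < r => destruct (Rle_dec a b); nra end.
    + now apply IH.
Qed.

Lemma seg_continuous n x z d : Rn n x -> Rn n z -> 0 < d -> exists e, 0 < e /\
  forall s t, Rabs (s - t) < e -> nb d (seg x z s) (seg x z t).
Proof.
  revert x z; induction n as [|n IH]; intros [|x0 x] [|z0 z] Hx Hz Hd; try discriminate.
  - exists 1; split; [lra|]. constructor.
  - injection Hx as Hx. injection Hz as Hz. destruct (IH x z Hx Hz Hd) as (e & He & H).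
    pose proof (Rabs_pos (z0 - x0)).
    assert (Hq : 0 < d / (Rabs (z0 - x0) + 1)) by (apply Rdiv_lt_0_compat; lra).
    exists (Rmin e (d / (Rabs (z0 - x0) + 1))). split; [now apply Rmin_pos|].
    intros s t Hst. unfold seg; simpl. constructor.
    + replace (_ - _) with ((s - t) * (z0 - x0)) by ring. rewrite Rabs_mult.
      pose proof (Rmin_r e (d / (Rabs (z0 - x0) + 1))).
      apply Rle_lt_trans with (Rabs (s - t) * (Rabs (z0 - x0) + 1)).
      * apply Rmult_le_compat_l; [apply Rabs_pos|lra].
      * apply Rlt_le_trans with (d / (Rabs (z0 - x0) + 1) * (Rabs (z0 - x0) + 1)).
        -- apply Rmult_lt_compat_r; lra.
        -- right; field; lra.
    + apply H. pose proof (Rmin_l e (d / (Rabs (z0 - x0) + 1))). lra.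
Qed.

(** Polynomial functions of one variable. *)
Inductive P1 : (R -> R) -> Prop :=
| P1c c f : (forall t, f t = c) -> P1 f
| P1s c g f : P1 g -> (forall t, f t = c + t * g t) -> P1 f.

Lemma P1_ext f g : P1 f -> (forall t, f t = g t) -> P1 g.
Proof.
  intros [c f' H|c g' f' Hg H] E; [eapply P1c|eapply P1s; [exact Hg|]]; intros t; rewrite <- E; auto.
Qed.

Lemma P1_add_const f k : P1 f -> P1 (fun t => k + f t).
Proof.
  intros [c f' H|c g f' Hg H].
  - apply P1c with (k + c). intros; now rewrite H.
  - apply P1s with (k + c) g; auto. intros; rewrite H; ring.
Qed.

Lemma P1_add f g : P1 f -> P1 g -> P1 (fun t => f t + g t).
Proof.
  intros Hf. revert g; induction Hf as [c f H|c f' f Hf' IH H]; intros g Hg.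
  - apply P1_ext with (fun t => c + g t); [now apply P1_add_const|]. intros; now rewrite H.
  - destruct Hg as [k g E|k g' g Hg' E].
    + apply P1s with (k + c) f'; auto. intros; rewrite H, E; ring.
    + apply P1s with (c + k) (fun t => f' t + g' t); auto. intros; rewrite H, E; ring.
Qed.

Lemma P1_scal f k : P1 f -> P1 (fun t => k * f t).
Proof.
  induction 1 as [c f H|c g f Hg IH H].
  - apply P1c with (k * c). intros; now rewrite H.
  - apply P1s with (k * c) (fun t => k * g t); auto. intros; rewrite H; ring.
Qed.

Lemma P1_mul f g : P1 f -> P1 g -> P1 (fun t => f t * g t).
Proof.
  intros Hf Hg; induction Hf as [c f H|c f' f Hf' IH H].
  - apply P1_ext with (fun t => c * g t); [now apply P1_scal|]. intros; now rewrite H.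
  - apply P1_ext with (fun t => c * g t + (0 + t * (f' t * g t))).
    + apply P1_add; [now apply P1_scal|]. now apply P1s with 0 (fun t => f' t * g t).
    + intros; rewrite H; ring.
Qed.

Lemma P1_affine a b : P1 (fun t => a + t * b).
Proof. apply P1s with a (fun _ => b); auto. now apply P1c with b. Qed.

Lemma P1_pow f k : P1 f -> P1 (fun t => f t ^ k).
Proof.
  intros H; induction k; simpl; [now apply P1c with 1|]. now apply P1_mul.
Qed.

Lemma P1_comp_affine f a b : P1 f -> P1 (fun t => f (a + t * b)).
Proof.
  induction 1 as [c f H|c g f Hg IH H].
  - apply P1c with c; auto.
  - apply P1_ext with (fun t => c + (a + t * b) * g (a + t * b)).
    + apply P1_add_const, P1_mul; [apply P1_affine|auto].
    + intros; now rewrite H.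
Qed.

Lemma P1_bounded f : P1 f -> exists C, 0 <= C /\ forall t, 0 < t < 1 -> Rabs (f t) <= C.
Proof.
  induction 1 as [c f H|c g f Hg (C & HC & IH) H].
  - exists (Rabs c). split; [apply Rabs_pos|]. intros; rewrite H; lra.
  - exists (Rabs c + C). pose proof (Rabs_pos c). split; [lra|]. intros t Ht. rewrite H.
    eapply Rle_trans; [apply Rabs_triang|]. apply Rplus_le_compat_l. rewrite Rabs_mult.
    rewrite Rabs_pos_eq by lra. specialize (IH t Ht). pose proof (Rabs_pos (g t)). nra.
Qed.

(** The recursion of [P1] splits off powers of [t] until a nonzero constant term appears, which
    dominates the rest near [0]. *)
Lemma P1_dichotomy f : P1 f -> (forall t, f t = 0) \/
  exists d, 0 < d /\ forall t, 0 < t < d -> f t <> 0.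
Proof.
  induction 1 as [c f H|c g f Hg IH H].
  - destruct (Req_dec c 0) as [->|Hc]; [now left|right].
    exists 1. split; [lra|]. intros; now rewrite H.
  - destruct (Req_dec c 0) as [->|Hc].
    + destruct IH as [IH|(d & Hd & IH)].
      * left. intros; rewrite H, IH; ring.
      * right. exists d. split; auto. intros t Ht. rewrite H, Rplus_0_l.
        apply Rmult_integral_contrapositive_currified; [lra|auto].
    + right. destruct (P1_bounded g Hg) as (C & HC & Hb).
      apply Rabs_pos_lt in Hc.
      assert (0 < Rabs c / (C + 1)) by (apply Rdiv_lt_0_compat; lra).
      exists (Rmin 1 (Rabs c / (C + 1))). split; [apply Rmin_pos; lra|]. intros t Ht E.
      pose proof (Rmin_l 1 (Rabs c / (C + 1))). pose proof (Rmin_r 1 (Rabs c / (C + 1))).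
      rewrite H in E. assert (Rabs c = t * Rabs (g t)).
      { rewrite <- (Rabs_pos_eq t) at 1 by lra. rewrite <- Rabs_mult, <- (Rabs_Ropp (t * g t)). f_equal; lra. }
      specialize (Hb t ltac:(lra)).
      assert (t * Rabs (g t) <= t * C) by (apply Rmult_le_compat_l; lra).
      assert (t * (C + 1) < Rabs c / (C + 1) * (C + 1)) by (apply Rmult_lt_compat_r; lra).
      replace (Rabs c / (C + 1) * (C + 1)) with (Rabs c) in * by (field; lra). lra.
Qed.

Lemma P1_mono_seg n x z a : Rn n x -> Rn n z -> P1 (fun s => mono (seg x z s) a).
Proof.
  revert x z a; induction n as [|n IH]; intros [|x0 x] [|z0 z] a Hx Hz; try discriminate.
  - apply P1c with 1. now intros.
  - injection Hx as Hx. injection Hz as Hz. destruct a as [|a0 a].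
    + apply P1c with 1. now intros.
    + unfold seg. simpl. apply (P1_mul (fun s => (x0 + s * (z0 - x0)) ^ a0) (fun s => mono (seg x z s) a)).
      * apply P1_pow, P1_affine.
      * now apply IH.
Qed.

Lemma P1_ev_seg n p x z : Rn n x -> Rn n z -> P1 (fun s => ev p (seg x z s)).
Proof.
  intros Hx Hz. induction p as [|m p IH].
  - apply P1c with 0. now intros.
  - apply (P1_add (fun s => fst m * mono (seg x z s) (snd m)) (fun s => ev p (seg x z s))); auto.
    apply P1_scal. now apply (P1_mono_seg n).
Qed.

Lemma fnz_seg n p x z : Rn n x -> Rn n z -> ev p z <> 0 ->
  exists d, 0 < d /\ forall s, 0 < s < d -> ev p (seg x z s) <> 0.
Proof.
  intros Hx Hz H. destruct (P1_dichotomy _ (P1_ev_seg n p x z Hx Hz)) as [H0|H0]; auto.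
  elim H. rewrite <- (seg_1 n x z) by auto. apply H0.
Qed.

(** Move from [x] towards a point where [p] is nonzero: on that segment the zeros do not accumulate
    at [x]. *)
Lemma fnz_dense n p x r : fnz n p -> Rn n x -> 0 < r -> exists z, nb r x z /\ ev p z <> 0.
Proof.
  intros (z & Hz & H) Hx Hr. destruct (fnz_seg n p x z Hx Hz H) as (d & Hd & Hs).
  destruct (seg_continuous n x z r Hx Hz Hr) as (e & He & Hc).
  pose proof (Rmin_l d e). pose proof (Rmin_r d e). assert (0 < Rmin d e) by now apply Rmin_pos.
  exists (seg x z (Rmin d e / 2)). split.
  - rewrite <- (seg_0 n x z) at 1 by auto. apply Hc.
    replace (0 - Rmin d e / 2) with (- (Rmin d e / 2)) by lra.
    rewrite Rabs_Ropp, Rabs_pos_eq; lra.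
  - apply Hs; lra.
Qed.

(** Polynomial functions form an integral domain: where [p] is nonzero it stays so on a ball, and
    the nonzero set of [q] is dense. *)
Lemma fnz_pmul n p q : wf n p -> wf n q -> fnz n p -> fnz n q -> fnz n (pmul p q).
Proof.
  intros Hp Hq (x & Hx & Hpx) (z & Hz & Hqz).
  destruct (ev_pos_near (pmul p p) x 0) as (d & Hd & Hn).
  { rewrite (ev_pmul n) by auto. now apply Rlt_0_sqr. }
  destruct (fnz_dense n q x d) as (w & Hw & Hqw); auto; [now exists z|].
  specialize (Hn w Hw). pose proof (nb_Rn _ _ _ _ Hw Hx) as HwR.
  exists w. split; auto. rewrite (ev_pmul n) in * by auto. intros E.
  apply Rmult_integral in E as [E|E]; [rewrite E in Hn; lra|easy].
Qed.

Lemma not_fnz n p : ~ fnz n p -> forall x, Rn n x -> ev p x = 0.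
Proof. intros H x Hx. apply NNPP. intros Hn. apply H. now exists x. Qed.

(** * Multi-index sums and homogeneous components *)

Lemma sumR_mis_S n k (f : list nat -> R) :
  sumR (mis (S n) k) f = sumR (seq 0 (S k)) (fun j => sumR (mis n (k - j)) (fun a => f (j :: a))).
Proof.
  simpl mis. rewrite <- (app_nil_r (map (cons 0%nat) (mis n (k - 0)))), <- app_assoc. simpl app at 2.
  change (map (cons 0%nat) (mis n (k - 0)) ++ flat_map (fun j => map (cons j) (mis n (k - j))) (seq 1 k))
   with (flat_map (fun j => map (cons j) (mis n (k - j))) (seq 0 (S k))).
  rewrite sumR_flat_map. apply sumR_ext; intros. apply sumR_map.
Qed.

Lemma in_mis n k a : In a (mis n k) <-> length a = n /\ (mdeg a <= k)%nat.
Proof.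
  revert k a; induction n as [|n IH]; intros k a.
  - simpl. split; [intros [<-|[]]; simpl; split; auto; lia|]. intros [H _]. destruct a; [now left|discriminate].
  - change (mis (S n) k) with (flat_map (fun j => map (cons j) (mis n (k - j))) (seq 0 (S k))).
    rewrite in_flat_map. split.
    + intros (j & Hj & Ha). apply in_seq in Hj. apply in_map_iff in Ha. destruct Ha as (a' & <- & Ha').
      apply IH in Ha'. simpl. unfold mdeg in *. simpl. split; [f_equal; tauto|lia].
    + intros [Hl Hd]. destruct a as [|j a]; [discriminate|]. injection Hl as Hl.
      unfold mdeg in *. simpl in Hd. exists j. split; [apply in_seq; lia|].
      apply in_map, IH. split; auto. unfold mdeg. lia.
Qed.

Lemma sumR_mis_single n k a (f : list nat -> R) : In a (mis n k) ->
  sumR (mis n k) (fun b => if list_eq_dec Nat.eq_dec a b then f b else 0) = f a.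
Proof.
  revert k a f; induction n as [|n IH]; intros k a f Ha.
  - destruct Ha as [<-|[]]. simpl. lra.
  - rewrite sumR_mis_S. apply in_mis in Ha. destruct Ha as [Hl Hd].
    destruct a as [|j a]; [discriminate|]. injection Hl as Hl. unfold mdeg in Hd; simpl in Hd.
    rewrite <- (IH (k - j)%nat a (fun a => f (j :: a))) by (apply in_mis; unfold mdeg; split; auto; lia).
    rewrite <- (sumR_seq_single (S k) j
      (fun i => sumR (mis n (k - i)) (fun b => if list_eq_dec Nat.eq_dec a b then f (i :: b) else 0))) by lia.
    apply sumR_ext. intros i _. destruct (Nat.eqb_spec j i) as [->|Hne].
    + apply sumR_ext. intros b _.
      destruct (list_eq_dec Nat.eq_dec (i :: a) (i :: b)), (list_eq_dec Nat.eq_dec a b); congruence.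
    + apply sumR_zero. intros b _. destruct (list_eq_dec Nat.eq_dec (j :: a) (i :: b)); congruence.
Qed.

Lemma sumR_mis_le n k k' (f : list nat -> R) : (k <= k')%nat ->
  (forall a, In a (mis n k') -> (k < mdeg a)%nat -> f a = 0) ->
  sumR (mis n k') f = sumR (mis n k) f.
Proof.
  revert k k' f; induction n as [|n IH]; intros k k' f Hk Hf; [easy|].
  rewrite !sumR_mis_S. replace (S k') with (S k + (k' - k))%nat by lia.
  rewrite seq_app, sumR_app. rewrite (sumR_zero (seq (0 + S k) (k' - k))).
  - rewrite Rplus_0_r. apply sumR_ext. intros j Hj. apply in_seq in Hj. apply IH; [lia|].
    intros a Ha Hm. apply Hf.
    + apply in_mis in Ha. apply in_mis. unfold mdeg in *. simpl. split; [f_equal; tauto|lia].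
    + unfold mdeg in *. simpl. lia.
  - intros j Hj. apply in_seq in Hj. apply sumR_zero. intros a Ha. apply in_mis in Ha. apply Hf.
    + apply in_mis. unfold mdeg in *. simpl. split; [f_equal; tauto|lia].
    + unfold mdeg in *. simpl. lia.
Qed.

(** As a polynomial in the first coordinate the sum has coefficients that are polynomials in the
    others; uniqueness in one variable gives the induction. *)
Lemma mis_coef_zero n k (c : list nat -> R) :
  (forall x, Rn n x -> sumR (mis n k) (fun a => c a * mono x a) = 0) ->
  forall a, In a (mis n k) -> c a = 0.
Proof.
  revert k c; induction n as [|n IH]; intros k c H a Ha.
  - destruct Ha as [<-|[]]. specialize (H [] eq_refl). simpl in H. lra.
  - apply in_mis in Ha. destruct Ha as [Hl Hd].
    destruct a as [|j a]; [discriminate|]. injection Hl as Hl. unfold mdeg in Hd; simpl in Hd.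
    apply (IH (k - j)%nat (fun a => c (j :: a))); [|apply in_mis; unfold mdeg; split; auto; lia].
    intros x Hx.
    apply (poly1_uniq (S k) (fun j => sumR (mis n (k - j)) (fun a => c (j :: a) * mono x a))); [|lia].
    intros t _. rewrite <- (H (t :: x)) by (unfold Rn in *; simpl; auto). rewrite sumR_mis_S.
    apply sumR_ext. intros i _. rewrite <- sumR_scal. apply sumR_ext. intros b _. simpl. ring.
Qed.

Definition of_poly (n : nat) (p : Defs.poly) : pl := map (fun a => (pcoef p a, a)) (mis n (pbound p)).

Lemma ev_of_poly n (p : Defs.poly) x : ev (of_poly n p) x = peval n p x.
Proof. unfold ev, of_poly, peval. now rewrite sumR_map. Qed.

Lemma wf_of_poly n p : wf n (of_poly n p).
Proof. apply Forall_map, Forall_forall. intros a Ha. now apply in_mis in Ha. Qed.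

Lemma to_poly n p : wf n p -> exists P, forall x, peval n P x = ev p x.
Proof.
  intros Hp. destruct (degs_exists p) as (hi & Hd).
  exists (mkpoly hi (fun a => sumR p (fun m => if list_eq_dec Nat.eq_dec (snd m) a then fst m else 0))).
  intros x. unfold peval, ev. cbn [pbound pcoef].
  erewrite sumR_ext by (intros; rewrite <- sumR_scalr; reflexivity). rewrite sumR_swap.
  apply sumR_ext. intros m Hm. red in Hp, Hd. rewrite Forall_forall in Hp, Hd.
  rewrite <- (sumR_mis_single n hi (snd m) (fun a => fst m * mono x a))
    by (apply in_mis; split; [auto|now apply Hd]).
  apply sumR_ext. intros a _. destruct (list_eq_dec Nat.eq_dec (snd m) a); ring.
Qed.

Definition drop (j : nat) (p : pl) : pl := filter (fun m => negb (Nat.eqb (mdeg (snd m)) j)) p.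

Lemma ev_drop j p x : ev p x = ev (drop j p) x + cev j p x.
Proof.
  unfold cev, ev, drop, pcomp. induction p as [|m p IH]; simpl; [lra|].
  destruct (Nat.eqb (mdeg (snd m)) j); simpl; rewrite IH; lra.
Qed.

Lemma wf_drop n j p : wf n p -> wf n (drop j p).
Proof. intros H. apply incl_Forall with p; auto. apply incl_filter. Qed.

Lemma degs_drop_top b k p : degs b (b + S k) p -> degs b (b + k) (drop (b + S k) p).
Proof.
  unfold degs. rewrite !Forall_forall. intros H m Hm. apply filter_In in Hm. destruct Hm as [Hm E].
  specialize (H m Hm). apply Bool.negb_true_iff, Nat.eqb_neq in E. lia.
Qed.

Lemma degs_drop_low b k p : degs b (b + S k) p -> degs (S b) (S b + k) (drop b p).
Proof.
  unfold degs. rewrite !Forall_forall. intros H m Hm. apply filter_In in Hm. destruct Hm as [Hm E].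
  specialize (H m Hm). apply Bool.negb_true_iff, Nat.eqb_neq in E. lia.
Qed.

Lemma feq_drop n j p : ~ fnz n (pcomp j p) -> feq n p (drop j p).
Proof. intros H x Hx. rewrite (ev_drop j p x). unfold cev. rewrite (not_fnz n _ H) by auto. ring. Qed.

Lemma fnz_feq n p q : feq n p q -> fnz n p -> fnz n q.
Proof. intros H (x & Hx & E). exists x. rewrite <- H; auto. Qed.

(** The extreme degrees [b] and [b + k] are attained by components that are nonzero as functions;
    [k] is the width. *)
Definition ends (n b k : nat) (p : pl) : Prop :=
  wf n p /\ degs b (b + k) p /\ fnz n (pcomp b p) /\ fnz n (pcomp (b + k) p).

(** The terms of an extreme degree may cancel as a function; such a component is discarded, and the
    range of degrees shrinks. *)
Lemma ends_exists n p : wf n p -> fnz n p -> exists b k p', ends n b k p' /\ feq n p p'.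
Proof.
  intros Hp Hn. destruct (degs_exists p) as (hi & Hd).
  change hi with (0 + hi)%nat in Hd. revert p Hp Hn Hd. generalize 0%nat.
  induction hi as [|k IH]; intros b p Hp Hn Hd.
  - assert (E : pcomp b p = p).
    { clear - Hd; unfold degs, pcomp in *; induction Hd as [|m p Hm Hd IH]; simpl; auto.
      destruct (Nat.eqb_spec (mdeg (snd m)) b); [now rewrite IH|lia]. }
    exists b, 0%nat, p. split; [|now intros x Hx]. repeat split; auto.
    + now rewrite E.
    + now rewrite Nat.add_0_r, E.
  - destruct (classic (fnz n (pcomp b p))) as [H1|H1].
    + destruct (classic (fnz n (pcomp (b + S k) p))) as [H2|H2].
      * exists b, (S k), p. split; [|now intros x Hx]. now repeat split.
      * destruct (IH b (drop (b + S k) p)) as (b' & k' & p' & He & E).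
        -- now apply wf_drop.
        -- apply (fnz_feq n p); auto. now apply feq_drop.
        -- now apply degs_drop_top.
        -- exists b', k', p'. split; auto. intros x Hx. rewrite <- E by auto. now apply (feq_drop n).
    + destruct (IH (S b) (drop b p)) as (b' & k' & p' & He & E).
      * now apply wf_drop.
      * apply (fnz_feq n p); auto. now apply feq_drop.
      * now apply degs_drop_low.
      * exists b', k', p'. split; auto. intros x Hx. rewrite <- E by auto. now apply (feq_drop n).
Qed.

Lemma fnz_cev_mul n i j p q r : wf n p -> wf n q -> fnz n (pcomp i p) -> fnz n (pcomp j q) ->
  (forall x, Rn n x -> cev (i + j) r x = cev i p x * cev j q x) -> exists x, Rn n x /\ cev (i + j) r x <> 0.
Proof.
  intros Hp Hq H1 H2 E. destruct (fnz_pmul n (pcomp i p) (pcomp j q)) as (x & Hx & Hn); auto with wf.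
  exists x. split; auto. rewrite E by auto. rewrite (ev_pmul n) in Hn by auto with wf. exact Hn.
Qed.

(** Extreme components multiply to nonzero extreme components, so a nonzero multiple of [g] is at
    least as wide as [g]. *)
Lemma width_pmul n b k lo hi g w p : ends n b k g -> wf n w -> wf n p -> degs lo hi p -> fnz n p ->
  (forall x, Rn n x -> ev p x = ev g x * ev w x) -> (lo + k <= hi)%nat.
Proof.
  intros (Hg & Hdg & Hg1 & Hg2) Hw Hp Hdp Hnp E.
  assert (Hnw : fnz n w).
  { destruct Hnp as (x & Hx & Hn). exists x. split; auto. rewrite E in Hn by auto.
    intros E0. apply Hn. rewrite E0; ring. }
  destruct (ends_exists n w Hw Hnw) as (r & s & w' & (Hw' & Hdw & Hw1 & Hw2) & Ew).
  assert (F : feq n p (pmul g w')).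
  { intros x Hx. rewrite (ev_pmul n), E, Ew by auto. ring. }
  pose proof (feq_cev n p (pmul g w')) as C.
  red in Hdg, Hdw. rewrite Forall_forall in Hdg, Hdw.
  assert (H1 : (lo <= b + r)%nat).
  { destruct (fnz_cev_mul n b r g w' p) as (x & Hx & Hn); auto.
    - intros x Hx. rewrite C by auto with wf. apply (cev_pmul_ends n); auto.
      intros m m' Hm Hm'. specialize (Hdg m Hm). specialize (Hdw m' Hm'). lia.
    - destruct (Nat.le_gt_cases lo (b + r)); auto. elim Hn. apply (cev_out lo hi); auto. }
  assert (H2 : (b + k + (r + s) <= hi)%nat).
  { destruct (fnz_cev_mul n (b + k) (r + s) g w' p) as (x & Hx & Hn); auto.
    - intros x Hx. rewrite C by auto with wf. apply (cev_pmul_ends n); auto.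
      intros m m' Hm Hm'. specialize (Hdg m Hm). specialize (Hdw m' Hm'). lia.
    - destruct (Nat.le_gt_cases (b + k + (r + s)) hi); auto. elim Hn. apply (cev_out lo hi); auto. }
  lia.
Qed.

Lemma ev_nil x : ev [] x = 0.
Proof. reflexivity. Qed.

Lemma cev_pcomp j p x : cev j (pcomp j p) x = cev j p x.
Proof.
  rewrite !cev_eq. unfold pcomp. induction p as [|m p IH]; simpl; auto.
  destruct (Nat.eqb (mdeg (snd m)) j) eqn:E; simpl; rewrite ?E, IH; lra.
Qed.

Lemma cev_app j p q x : cev j (p ++ q) x = cev j p x + cev j q x.
Proof. rewrite !cev_eq. apply sumR_app. Qed.

Lemma cev_pw (w : nat -> R) j p x : cev j (pw (fun a => w (mdeg a)) p) x = w j * cev j p x.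
Proof.
  rewrite !cev_eq. unfold pw. rewrite sumR_map, <- sumR_scal. apply sumR_ext. intros m _. simpl.
  destruct (Nat.eqb_spec (mdeg (snd m)) j) as [->|]; ring.
Qed.

(** Division with remainder with respect to the width (top minus bottom degree): the homogeneous
    factor [c] plays the role of a scalar. *)
Lemma pseudo_division n b k g : ends n b (S k) g -> forall l lo a, wf n a -> degs lo (lo + l) a ->
  exists c j q r lo', wf n c /\ wf n q /\ wf n r /\ degs j j c /\ fnz n c /\ degs lo' (lo' + k) r /\
  forall x, Rn n x -> ev c x * ev a x = ev g x * ev q x + ev r x.
Proof.
  intros (Hg & Hdg & Hg1 & Hg2). induction l as [l IH] using lt_wf_ind. intros lo a Ha Hda.
  destruct (Nat.le_gt_cases l k) as [Hlk|Hlk].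
  - exists (pconst n 1), 0%nat, [], a, lo. repeat split; auto with wf; try constructor.
    + simpl. rewrite mdeg_repeat. lia.
    + constructor.
    + exists (repeat 0 n). split; [apply repeat_length|]. rewrite ev_pconst. lra.
    + apply (degs_weaken lo (lo + l)); auto; lia.
    + intros x Hx. rewrite ev_pconst, ev_nil. ring.
  - destruct l as [|l]; [lia|].
    set (gt := pcomp (b + S k) g) in *. set (at_ := pcomp (lo + S l) a).
    assert (Hgt : wf n gt) by (unfold gt; auto with wf).
    assert (Hat : wf n at_) by (unfold at_; auto with wf).
    (* Cross-multiplication by the top components cancels the degree [L + S l]. Since [k <= l], the
       lowest degree does not fall below [L], so the width drops by one. *)
    set (a1 := pmul gt a ++ pscal (- 1) (pmul g at_)). set (L := (b + S k + lo)%nat).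
    assert (Ha1 : wf n a1) by (unfold a1; auto with wf).
    assert (Hd1 : degs L (L + S l) a1).
    { unfold a1. apply degs_app.
      - apply (degs_weaken (b + S k + lo) (b + S k + (lo + S l))); [unfold L; lia|unfold L; lia|].
        apply (degs_pmul n); auto. apply degs_pcomp.
      - apply degs_pw. apply (degs_weaken (b + (lo + S l)) (b + S k + (lo + S l))); [unfold L; lia|unfold L; lia|].
        apply (degs_pmul n); auto. apply degs_pcomp. }
    assert (Hz : ~ fnz n (pcomp (L + S l) a1)).
    { intros (x & Hx & Hn). apply Hn. fold (cev (L + S l) a1 x). unfold a1. rewrite cev_app.
      unfold pscal. rewrite (cev_pw (fun _ => - 1)). unfold L.
      replace (b + S k + lo + S l)%nat with ((b + S k) + (lo + S l))%nat by lia.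
      pose proof (degs_pcomp (b + S k) g) as Hgc. pose proof (degs_pcomp (lo + S l) a) as Hac.
      fold gt in Hgc. fold at_ in Hac. unfold degs in *. rewrite Forall_forall in *.
      rewrite !(cev_pmul_ends n); auto.
      - unfold gt, at_. rewrite !cev_pcomp. ring.
      - intros m m' Hm Hm'. specialize (Hdg m Hm). specialize (Hac m' Hm'). lia.
      - intros m m' Hm Hm'. specialize (Hgc m Hm). specialize (Hda m' Hm'). lia. }
    destruct (IH l (Nat.lt_succ_diag_r l) L (drop (L + S l) a1)) as
      (c & j & q & r & lo' & Hc & Hq & Hr & Hdc & Hnc & Hdr & E).
    { now apply wf_drop. } { now apply degs_drop_top. }
    exists (pmul c gt), (j + (b + S k))%nat, (q ++ pmul c at_), r, lo'.
    repeat split; auto with wf.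
    + apply (degs_pmul n); auto. apply degs_pcomp.
    + now apply fnz_pmul.
    + intros x Hx. specialize (E x Hx). rewrite <- (feq_drop n (L + S l) a1 Hz x Hx) in E.
      unfold a1 in E. rewrite ev_app, ev_pscal, !(ev_pmul n) in E by auto.
      rewrite ev_app, !(ev_pmul n) by auto. lra.
Qed.

(** * The ideal generated by h and E h *)

(** [h] generates the vanishing ideal of its own real zero set. *)
Definition generates (n : nat) (h : pl) : Prop := wf n h /\
  forall p, wf n p -> (forall x, Rn n x -> ev h x = 0 -> ev p x = 0) ->
  exists q, wf n q /\ forall x, Rn n x -> ev p x = ev h x * ev q x.

(** Apply [E] to [U f = h V] and multiply by [U]. *)
Lemma kills_pE n h U f : generates n h -> wf n U -> wf n f ->
  (forall x, Rn n x -> ev h x = 0 -> ev U x * ev (pE h) x = 0) ->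
  (forall x, Rn n x -> ev h x = 0 -> ev U x * ev f x = 0) ->
  forall x, Rn n x -> ev h x = 0 -> ev U x * ev (pE f) x = 0.
Proof.
  intros [Hh Hgen] HU Hf Hk H x Hx Hhx.
  destruct (Hgen (pmul U f)) as (V & HV & E); auto with wf.
  { intros z Hz Hhz. rewrite (ev_pmul n) by auto. auto. }
  assert (F : feq n (pmul U f) (pmul h V)).
  { intros z Hz. rewrite E, (ev_pmul n) by auto. easy. }
  apply feq_pE in F; auto with wf. specialize (F x Hx).
  rewrite !(ev_pE_pmul n) in F by auto. rewrite Hhx in F.
  specialize (Hk x Hx Hhx). specialize (H x Hx Hhx).
  assert (E2 : (ev U x * ev (pE f) x) * ev U x = 0).
  { replace (ev U x * ev (pE f) x) with (ev (pE h) x * ev V x - ev (pE U) x * ev f x) by lra.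
    transitivity ((ev U x * ev (pE h) x) * ev V x - ev (pE U) x * (ev U x * ev f x)); [ring|].
    rewrite Hk, H. ring. }
  apply Rmult_integral in E2 as [E2|E2]; auto. rewrite E2; ring.
Qed.

Lemma cev_0 n p x : wf n p -> Rn n x -> cev 0 p x = ev p (repeat 0 n).
Proof.
  intros Hp Hx. destruct (degs_exists p) as (hi & Hd).
  rewrite <- (scal_0 n x Hx), (ev_scal_comps n p 0 x hi) by auto. simpl.
  rewrite (sumR_zero (seq 1 hi)); [ring|]. intros j Hj. apply in_seq in Hj.
  rewrite pow_ne_zero by lia. ring.
Qed.

(** [E h] is a non-zero-divisor modulo [h]: the polynomials [f] with [U f = 0] on [h = 0] are stable
    under [E], hence contain [(E-1)(E-2)...(E-d) h], a nonzero multiple of the constant [h(0)]. *)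
Lemma pE_regular n h U : generates n h -> ev h (repeat 0 n) <> 0 -> wf n U ->
  (forall x, Rn n x -> ev h x = 0 -> ev U x * ev (pE h) x = 0) ->
  forall x, Rn n x -> ev h x = 0 -> ev U x = 0.
Proof.
  intros Hgen H0 HU Hk. pose proof Hgen as [Hh _]. destruct (degs_exists h) as (d & Hd).
  assert (Hind : forall k, exists f c, wf n f /\ degs 0 d f /\ c <> 0 /\
    (forall x, Rn n x -> ev h x = 0 -> ev U x * ev f x = 0) /\
    (forall x, cev 0 f x = c * cev 0 h x) /\
    forall j x, (0 < j <= k)%nat -> cev j f x = 0).
  { induction k as [|k (f & c & Hf & Hdf & Hc & Hkf & E0 & Ej)].
    - exists h, 1. split; [auto|split; [auto|split; [apply R1_neq_R0|split; [|split]]]].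
      + intros x Hx E. rewrite E. ring.
      + intros; ring.
      + intros; lia.
    (* [E - (k + 1)] kills the component of degree [k + 1], leaves those killed before at zero and
       multiplies the constant term by [- (k + 1)]. *)
    - exists (pw (fun a => INR (mdeg a) - INR (S k)) f), (- INR (S k) * c).
      split; [auto with wf|]. split; [now apply degs_pw|]. split; [|split; [|split]].
      + apply Rmult_integral_contrapositive_currified; auto.
        apply Ropp_neq_0_compat, not_0_INR. lia.
      + intros x Hx Hhx.
        replace (ev (pw (fun a => INR (mdeg a) - INR (S k)) f) x) with (ev (pE f) x - INR (S k) * ev f x).
        * pose proof (kills_pE n h U f Hgen HU Hf Hk Hkf x Hx Hhx). specialize (Hkf x Hx Hhx).
          replace (ev U x * (ev (pE f) x - INR (S k) * ev f x)) with
            (ev U x * ev (pE f) x - INR (S k) * (ev U x * ev f x)) by ring.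
          rewrite H, Hkf. ring.
        * unfold ev, pE, pw. rewrite !sumR_map, <- sumR_scal, <- sumR_minus.
          apply sumR_ext. intros m _. cbn [fst snd]. ring.
      + intros x. rewrite (cev_pw (fun j => INR j - INR (S k))), E0. simpl INR at 1. ring.
      + intros j x Hj. rewrite (cev_pw (fun j => INR j - INR (S k))).
        destruct (Nat.eq_dec j (S k)) as [->|Hne]; [ring|]. rewrite Ej by lia. ring. }
  destruct (Hind d) as (f & c & Hf & Hdf & Hc & Hkf & E0 & Ej).
  intros x Hx Hhx. specialize (Hkf x Hx Hhx).
  rewrite (ev_comps n f x d) in Hkf by auto. simpl in Hkf.
  rewrite (sumR_zero (seq 1 d)) in Hkf by (intros j Hj; apply in_seq in Hj; apply Ej; lia).
  rewrite E0, (cev_0 n) in Hkf by auto. rewrite Rplus_0_r in Hkf.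
  apply Rmult_integral in Hkf as [E|E]; auto.
  apply Rmult_integral in E as [E|E]; contradiction.
Qed.

Definition in_ideal2 (n : nat) (f g p : pl) : Prop :=
  exists u v, wf n u /\ wf n v /\ forall x, Rn n x -> ev p x = ev u x * ev f x + ev v x * ev g x.

Lemma least_nat (P : nat -> Prop) : (exists k, P k) -> exists k, P k /\ forall j, (j < k)%nat -> ~ P j.
Proof.
  intros (k & Hk). revert Hk. induction k as [k IH] using lt_wf_ind. intros Hk.
  destruct (classic (exists j, (j < k)%nat /\ P j)) as [(j & Hj & HP)|Hno].
  - now apply (IH j).
  - exists k. split; auto. intros j Hj HP. apply Hno. now exists j.
Qed.

(** Otherwise a nonzero element of least width of the ideal [(h, E h)] divides both generators up to
    homogeneous factors, which contradicts [pE_regular]. *)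
Lemma homogeneous_in_ideal n h : generates n h -> ev h (repeat 0 n) <> 0 ->
  exists j D, wf n D /\ degs j j D /\ fnz n D /\ in_ideal2 n h (pE h) D.
Proof.
  intros Hgen H0. pose proof Hgen as [Hh Hq].
  assert (Hnh : fnz n h) by (exists (repeat 0 n); split; [apply repeat_length|auto]).
  set (P := fun k => exists b g, wf n g /\ degs b (b + k) g /\ fnz n g /\ in_ideal2 n h (pE h) g).
  destruct (least_nat P) as (k & (b & g & Hg & Hdg & Hng & Ig) & Hmin).
  { destruct (degs_exists h) as (d & Hd). exists d, 0%nat, h. repeat split; auto.
    exists (pconst n 1), []. repeat split; auto with wf; [constructor|].
    intros x Hx. rewrite ev_pconst, ev_nil. ring. }
  destruct k as [|k].
  { exists b, g. rewrite Nat.add_0_r in Hdg. auto. }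
  exfalso.
  (* A vanishing extreme component could be dropped, giving a narrower element of the ideal. *)
  assert (He : ends n b (S k) g).
  { split; [|split; [|split]]; auto; apply NNPP; intros Hno; apply (Hmin k); auto.
    - exists (S b), (drop b g). split; [now apply wf_drop|]. split; [now apply degs_drop_low|].
      pose proof (feq_drop n b g Hno) as F. split; [now apply (fnz_feq n g)|].
      destruct Ig as (u & v & Hu & Hv & E). exists u, v. repeat split; auto.
      intros x Hx. rewrite <- F by auto. auto.
    - exists b, (drop (b + S k) g). split; [now apply wf_drop|]. split; [now apply degs_drop_top|].
      pose proof (feq_drop n (b + S k) g Hno) as F. split; [now apply (fnz_feq n g)|].
      destruct Ig as (u & v & Hu & Hv & E). exists u, v. repeat split; auto.
      intros x Hx. rewrite <- F by auto. auto. }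
  assert (Hdiv : forall a, wf n a -> in_ideal2 n h (pE h) a ->
     exists c j q, wf n c /\ wf n q /\ degs j j c /\ fnz n c /\
       forall x, Rn n x -> ev c x * ev a x = ev g x * ev q x).
  { intros a Ha (u' & v' & Hu' & Hv' & E'). destruct (degs_exists a) as (l & Hda).
    destruct (pseudo_division n b k g He l 0 a Ha Hda) as
      (c & j & q & r & lo' & Hc & Hq' & Hr & Hdc & Hnc & Hdr & E).
    exists c, j, q. repeat split; auto. intros x Hx. rewrite E by auto.
    destruct (classic (fnz n r)) as [Hnr|Hnr].
    (* The remainder lies in the ideal and is narrower than [g]. *)
    - elim (Hmin k (Nat.lt_succ_diag_r k)). exists lo', r. repeat split; auto.
      destruct Ig as (u & v & Hu & Hv & Eg).
      exists (pmul c u' ++ pscal (- 1) (pmul q u)), (pmul c v' ++ pscal (- 1) (pmul q v)).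
      repeat split; auto with wf. intros z Hz. rewrite !ev_app, !ev_pscal, !(ev_pmul n) by auto.
      specialize (E z Hz). rewrite E', Eg in E by auto. lra.
    - rewrite (not_fnz n r Hnr) by auto. ring. }
  destruct (Hdiv h Hh) as (c1 & j1 & q1 & Hc1 & Hq1 & Hd1 & Hn1 & E1).
  { exists (pconst n 1), []. repeat split; auto with wf; [constructor|].
    intros x Hx. rewrite ev_pconst, ev_nil. ring. }
  destruct (Hdiv (pE h)) as (c2 & j2 & q2 & Hc2 & Hq2 & Hd2 & Hn2 & E2); auto with wf.
  { exists [], (pconst n 1). repeat split; auto with wf; [constructor|].
    intros x Hx. rewrite ev_pconst, ev_nil. ring. }
  (* On [h = 0] one has [q1 c2 (E h) = q1 g q2 = q2 c1 h = 0], so the regularity of [E h] makes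
     [q1 c2] vanish there, and it becomes a multiple [h w]. *)
  assert (HU : forall x, Rn n x -> ev h x = 0 -> ev (pmul q1 c2) x = 0).
  { apply (pE_regular n h); auto with wf. intros x Hx Hhx. rewrite (ev_pmul n) by auto.
    transitivity (ev q1 x * (ev c2 x * ev (pE h) x)); [ring|]. rewrite E2 by auto.
    transitivity (ev q2 x * (ev g x * ev q1 x)); [ring|]. rewrite <- E1, Hhx by auto. ring. }
  destruct (Hq (pmul q1 c2)) as (w & Hw & Ew); auto with wf.
  (* [h c1 c2 = g q1 c2 = g h w], and [h] cancels in an integral domain. *)
  assert (Ec : forall x, Rn n x -> ev (pmul c1 c2) x = ev g x * ev w x).
  { set (z := pmul c1 c2 ++ pscal (- 1) (pmul g w)).
    assert (Hz : wf n z) by (unfold z; auto with wf).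
    assert (Hno : ~ fnz n z).
    { intros Hnz. destruct (fnz_pmul n z h) as (x & Hx & Hn); auto. apply Hn.
      rewrite (ev_pmul n) by auto. unfold z. rewrite ev_app, ev_pscal, !(ev_pmul n) by auto.
      specialize (Ew x Hx). rewrite (ev_pmul n) in Ew by auto. specialize (E1 x Hx).
      transitivity ((ev c1 x * ev h x) * ev c2 x - ev g x * (ev h x * ev w x)); [ring|].
      rewrite E1, <- Ew. ring. }
    intros x Hx. pose proof (not_fnz n z Hno x Hx) as E. unfold z in E.
    rewrite ev_app, ev_pscal, (ev_pmul n g) in E by auto. lra. }
  (* [c1 c2] is homogeneous, hence too narrow to be a multiple of [g]. *)
  pose proof (width_pmul n b (S k) (j1 + j2) (j1 + j2) g w (pmul c1 c2) He Hw) as Hwidth.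
  assert (j1 + j2 + S k <= j1 + j2)%nat; [|lia].
  apply Hwidth; auto with wf.
  - now apply (degs_pmul n).
  - now apply fnz_pmul.
Qed.

(** * Orientation of the boundary *)

Definition open_nb (n : nat) (G : list R -> Prop) : Prop :=
  forall x, G x -> Rn n x /\ exists r, 0 < r /\ forall z, nb r x z -> G z.

Definition clos (G : list R -> Prop) (x : list R) : Prop :=
  forall r, 0 < r -> exists z, G z /\ nb r x z.

(** The conditions are invariant under [h -> - h], which reduces the cases of negative sign to the
    positive ones. *)
Definition bounded_by_zeros (n : nat) (G : list R -> Prop) (h : pl) : Prop :=
  wf n h /\ open_nb n G /\
  (forall x, Rn n x -> (exists r, 0 < r /\ forall z, nb r x z -> clos G z) -> G x) /\
  (forall x, Rn n x -> (ev h x = 0 <-> clos G x /\ ~ G x)).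

(** At zeros of [h] the property to be propagated carries no information, so it is compared only on
    a dense set [V]. Local constancy along [V] is required around every [t], also outside [V], and
    lets the supremum argument step over such points. *)
Lemma interval_connected (V P : R -> Prop) : V 0 -> V 1 ->
  (forall a b, 0 <= a < b -> b <= 1 -> exists t, a < t < b /\ V t) ->
  (forall t, 0 <= t <= 1 -> exists d, 0 < d /\ forall s s', 0 <= s <= 1 -> 0 <= s' <= 1 ->
     Rabs (s - t) < d -> Rabs (s' - t) < d -> V s -> V s' -> (P s <-> P s')) ->
  (P 0 <-> P 1).
Proof.
  intros V0 V1 Hdense Hloc.
  set (T := fun t => 0 <= t <= 1 /\ forall s, 0 <= s <= t -> V s -> (P s <-> P 0)).
  assert (T0 : T 0).
  { split; [lra|]. intros s Hs _. replace s with 0 by lra. tauto. }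
  destruct (completeness T) as (m & Hub & Hlub).
  { exists 1. intros t [Ht _]. lra. } { now exists 0. }
  assert (Hm0 : 0 <= m) by now apply Hub.
  assert (Hm1 : m <= 1) by (apply Hlub; intros t [Ht _]; lra).
  destruct (Hloc m) as (d & Hd & Hl); [lra|].
  destruct (classic (exists t, T t /\ m - d < t)) as [(t & Tt & Htd)|Hno].
  2:{ exfalso. assert (m <= m - d); [|lra]. apply Hlub. intros t Tt.
      destruct (Rle_dec t (m - d)); auto. elim Hno. exists t. split; auto; lra. }
  assert (Htm : t <= m) by now apply Hub.
  assert (Hs0 : exists s0, 0 <= s0 <= t /\ V s0 /\ Rabs (s0 - m) < d).
  { destruct (Req_dec t 0) as [->|Ht0].
    - exists 0. repeat split; try lra; auto. apply Rabs_def1; lra.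
    - destruct Tt as [Ht _].
      pose proof (Rmax_l 0 (m - d)). pose proof (Rmax_r 0 (m - d)).
      destruct (Hdense (Rmax 0 (m - d)) t) as (s0 & Hs0 & Vs0); [|lra|].
      + split; auto. apply Rmax_lub_lt; lra.
      + exists s0. repeat split; try lra; auto. apply Rabs_def1; lra. }
  destruct (Hs0) as (s0 & Hs0t & Vs0 & Hs0m). clear Hs0.
  pose proof (Rmin_l 1 (m + d / 2)). pose proof (Rmin_r 1 (m + d / 2)).
  assert (Tm : T (Rmin 1 (m + d / 2))).
  { split; [split; [apply Rmin_glb; lra|lra]|]. intros s Hs Vs.
    destruct Tt as [Ht Tt]. destruct (Rle_dec s t) as [Hst|Hst]; [apply Tt; auto; lra|].
    rewrite <- (Tt s0 Hs0t Vs0). apply Hl; auto; try lra. apply Rabs_def1; lra. }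
  assert (Hle : Rmin 1 (m + d / 2) <= m) by now apply Hub.
  assert (E : Rmin 1 (m + d / 2) = 1).
  { unfold Rmin in *. destruct (Rle_dec 1 (m + d / 2)); lra. }
  rewrite E in Tm. destruct Tm as [_ Tm]. symmetry. apply Tm; auto; lra.
Qed.

Lemma status_local n G h x : bounded_by_zeros n G h -> Rn n x -> ev h x <> 0 ->
  exists r, 0 < r /\ forall z, nb r x z -> (G z <-> G x).
Proof.
  intros (_ & Ho & _ & Hz) Hx Hn. destruct (classic (G x)) as [HG|HG].
  - destruct (Ho x HG) as (_ & r & Hr & H). exists r. split; auto. intros z Hxz. specialize (H z Hxz). tauto.
  - assert (Hc : ~ clos G x) by (intros Hc; apply Hn, Hz; auto).
    apply not_all_ex_not in Hc. destruct Hc as (r & Hc). apply imply_to_and in Hc. destruct Hc as [Hr Hc].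
    exists r. split; auto. intros z Hxz. split; [|tauto]. intros Gz. elim Hc. now exists z.
Qed.

Lemma status_segment n G h x z : bounded_by_zeros n G h -> Rn n x -> Rn n z ->
  (forall s, 0 <= s <= 1 -> ev h (seg x z s) <> 0) -> (G x <-> G z).
Proof.
  intros HG Hx Hz Hn.
  assert (H : G (seg x z 0) <-> G (seg x z 1)); [|now rewrite (seg_0 n), (seg_1 n) in H].
  apply (interval_connected (fun _ => True) (fun s => G (seg x z s))); auto.
  - intros a b Hab Hb. exists ((a + b) / 2). split; auto; lra.
  - intros t Ht. destruct (status_local n G h (seg x z t) HG) as (r & Hr & H); auto; [now apply Rn_seg|].
    destruct (seg_continuous n x z r Hx Hz Hr) as (d & Hd & Hc).
    exists d. split; auto. intros s s' _ _ Hs Hs' _ _.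
    rewrite (H (seg x z s)), (H (seg x z s')); [tauto| |]; apply Hc; now rewrite Rabs_minus_sym.
Qed.

Lemma ev_ray_lt n h x s t : wf n h -> Rn n x -> 0 < s < t ->
  (forall u, s <= u <= t -> 0 < ev (pE h) (scal u x)) -> ev h (scal s x) < ev h (scal t x).
Proof.
  intros Hh Hx Hst Hpos.
  destruct (MVT_cor2 (fun u => ev h (scal u x)) (fun u => ev (pE h) (scal u x) / u) s t) as (c & Hc & Hc').
  - lra.
  - intros u Hu. destruct (ev_ray_derivable n h x u Hh Hx) as (d & Hd & E).
    rewrite <- E. replace (u * d / u) with d by (field; lra). exact Hd.
  - assert (0 < ev (pE h) (scal c x) / c * (t - s)).
    { apply Rmult_lt_0_compat; [|lra]. apply Rdiv_lt_0_compat; [apply Hpos|]; lra. }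
    lra.
Qed.

Lemma scal_near x0 d : 0 < d -> exists r, 0 < r < 1 /\
  forall x t, nb r x0 x -> Rabs (t - 1) <= r -> nb d x0 (scal t x).
Proof.
  intros Hd. induction x0 as [|u x0 (r & Hr & IH)].
  - exists (1/2). split; [lra|]. intros x t Hx _. inversion Hx. constructor.
  - pose proof (Rabs_pos u).
    assert (Hq : 0 < d / (2 * (Rabs u + 2))) by (apply Rdiv_lt_0_compat; lra).
    set (q := d / (2 * (Rabs u + 2))) in *.
    assert (Eq : q * (Rabs u + 2) = d / 2) by (unfold q; field; lra).
    pose proof (Rmin_l r q). pose proof (Rmin_r r q).
    exists (Rmin r q). split; [split; [apply Rmin_pos; lra|lra]|]. intros x t Hx Ht.
    inversion Hx as [|? v ? x' Hv Hx']; subst. unfold scal; simpl. constructor.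
    + replace (u - t * v) with ((u - v) + (1 - t) * v) by ring.
      eapply Rle_lt_trans; [apply Rabs_triang|]. rewrite Rabs_mult, (Rabs_minus_sym 1).
      assert (Rabs v <= Rabs u + 1).
      { replace v with (u - (u - v)) by ring. eapply Rle_trans; [apply Rabs_triang|]. rewrite Rabs_Ropp. lra. }
      pose proof (Rabs_pos v). pose proof (Rabs_pos (t - 1)).
      assert (Rabs (t - 1) * Rabs v <= q * (Rabs u + 1)) by (apply Rmult_le_compat; lra). lra.
    + apply IH; [|lra]. apply nb_mono with (Rmin r q); auto.
Qed.

Lemma nb_scal r t x z : nb r x z -> 0 < t <= 2 -> nb (2 * r) (scal t x) (scal t z).
Proof.
  intros H Ht; induction H as [|u v x z Huv H IH]; constructor; auto.
  replace (t * u - t * v) with (t * (u - v)) by ring. rewrite Rabs_mult, Rabs_pos_eq by lra.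
  pose proof (Rabs_pos (u - v)). nra.
Qed.

(** Near a boundary point with [E h <> 0] the boundary separates [h > 0] from [h < 0]; by regularity
    exactly one of the two sides is in [G]. *)
Lemma wall_pos n G h x0 : bounded_by_zeros n G h -> Rn n x0 -> ev h x0 = 0 -> 0 < ev (pE h) x0 ->
  exists r, 0 < r /\ forall x x', nb r x0 x -> nb r x0 x' -> ev h x <> 0 -> ev h x' <> 0 ->
    ((G x <-> 0 < ev h x) <-> (G x' <-> 0 < ev h x')).
Proof.
  intros HG Hx0 E0 He. pose proof HG as (Hh & Ho & Hreg & Hz).
  destruct (ev_pos_near (pE h) x0 0 He) as (d1 & Hd1 & H1).
  destruct (scal_near x0 d1 Hd1) as (rho & Hrho & Hs).
  assert (Hpos : forall x t, nb rho x0 x -> 1 - rho <= t <= 1 + rho -> 0 < ev (pE h) (scal t x)).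
  { intros x t Hx Ht. apply H1, Hs; auto. apply Rabs_le. lra. }
  (* Reference points on the two sides of the wall. A point near [x0] with [h > 0] is pushed
     outwards along its own ray, where [h] increases, until it is near [p]; one with [h < 0] is
     pulled inwards towards [m]. *)
  set (p := scal (1 + rho) x0). set (m := scal (1 - rho) x0).
  assert (Hp : 0 < ev h p).
  { rewrite <- E0, <- (scal_1 x0). apply (ev_ray_lt n); auto; [lra|]. intros u Hu.
    apply Hpos; [apply nb_refl|]; lra. }
  assert (Hm : ev h m < 0).
  { rewrite <- E0, <- (scal_1 x0). apply (ev_ray_lt n); auto; [lra|]. intros u Hu.
    apply Hpos; [apply nb_refl|]; lra. }
  destruct (ev_pos_near h p 0 Hp) as (d2 & Hd2 & H2).
  destruct (ev_neg_near h m 0 Hm) as (d3 & Hd3 & H3).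
  set (r := Rmin rho (Rmin (d2 / 2) (d3 / 2))).
  assert (Hr : 0 < r) by (repeat apply Rmin_pos; lra).
  assert (Hr1 : r <= rho) by apply Rmin_l.
  assert (Hr2 : 2 * r <= d2).
  { pose proof (Rmin_r rho (Rmin (d2 / 2) (d3 / 2))). pose proof (Rmin_l (d2 / 2) (d3 / 2)). fold r in H. lra. }
  assert (Hr3 : 2 * r <= d3).
  { pose proof (Rmin_r rho (Rmin (d2 / 2) (d3 / 2))). pose proof (Rmin_r (d2 / 2) (d3 / 2)). fold r in H. lra. }
  assert (Hplus : forall x, nb r x0 x -> 0 < ev h x -> (G x <-> G p)).
  { intros x Hx Hhx. assert (Hxn : Rn n x) by now apply nb_Rn with r x0.
    assert (Hx' : nb rho x0 x) by now apply nb_mono with r.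
    transitivity (G (scal (1 + rho) x)).
    - apply (status_segment n G h); auto; [now apply Rn_scal|]. intros s Hs'. rewrite seg_scal.
      apply Rgt_not_eq. destruct (Req_dec s 0) as [->|Hs0].
      + rewrite Rmult_0_l, Rplus_0_r, scal_1. exact Hhx.
      + apply Rlt_trans with (ev h x); auto. rewrite <- (scal_1 x) at 1. apply (ev_ray_lt n); auto.
        * split; [lra|]. nra.
        * intros u Hu. apply Hpos; auto. nra.
    - assert (Hn : nb d2 p (scal (1 + rho) x)).
      { apply nb_mono with (2 * r); auto. apply nb_scal; auto; lra. }
      apply (status_segment n G h); auto; try (now apply Rn_scal). intros s Hs'.
      apply Rgt_not_eq, H2, nb_seg; auto. now apply nb_refl. }
  assert (Hminus : forall x, nb r x0 x -> ev h x < 0 -> (G x <-> G m)).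
  { intros x Hx Hhx. assert (Hxn : Rn n x) by now apply nb_Rn with r x0.
    assert (Hx' : nb rho x0 x) by now apply nb_mono with r.
    transitivity (G (scal (1 - rho) x)).
    - apply (status_segment n G h); auto; [now apply Rn_scal|]. intros s Hs'. rewrite seg_scal.
      apply Rlt_not_eq. destruct (Req_dec s 0) as [->|Hs0].
      + rewrite Rmult_0_l, Rplus_0_r, scal_1. exact Hhx.
      + apply Rlt_trans with (ev h x); auto. rewrite <- (scal_1 x) at 2. apply (ev_ray_lt n); auto.
        * split; [|]; nra.
        * intros u Hu. apply Hpos; auto. nra.
    - assert (Hn : nb d3 m (scal (1 - rho) x)).
      { apply nb_mono with (2 * r); auto. apply nb_scal; auto; lra. }
      apply (status_segment n G h); auto; try (now apply Rn_scal). intros s Hs'.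
      apply Rlt_not_eq, H3, nb_seg; auto. now apply nb_refl. }
  (* With both sides in [G] a whole ball around [x0] would lie in the closure, and [x0] would belong
     to [G]. *)
  assert (Hnot : ~ (G p /\ G m)).
  { intros [Gp Gm]. destruct (proj1 (Hz x0 Hx0) E0) as [_ Hno]. apply Hno, Hreg; auto.
    exists r. split; auto. intros z Hxz. assert (Hzn : Rn n z) by now apply nb_Rn with r x0.
    destruct (Rtotal_order (ev h z) 0) as [Hl|[Hl|Hl]].
    - intros q Hq. exists z. split; [now apply Hminus|now apply nb_refl].
    - now apply Hz.
    - intros q Hq. exists z. split; [now apply Hplus|now apply nb_refl]. }
  assert (Hor : G p \/ G m).
  { destruct (proj1 (Hz x0 Hx0) E0) as [Hc _]. destruct (Hc r Hr) as (z & Gz & Hxz).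
    assert (Hzn : Rn n z) by now apply nb_Rn with r x0.
    destruct (Rtotal_order (ev h z) 0) as [Hl|[Hl|Hl]].
    - right. now apply (Hminus z).
    - apply Hz in Hl; tauto.
    - left. now apply (Hplus z). }
  assert (Hcase : forall x, nb r x0 x -> ev h x <> 0 -> ((G x <-> 0 < ev h x) <-> G p)).
  { intros x Hx Hn. destruct (Rtotal_order (ev h x) 0) as [Hl|[Hl|Hl]]; [|tauto|].
    - pose proof (Hminus x Hx Hl). assert (~ 0 < ev h x) by lra. tauto.
    - pose proof (Hplus x Hx Hl). tauto. }
  exists r. split; auto. intros x x' Hx Hx' Hn Hn'. rewrite (Hcase x), (Hcase x'); tauto.
Qed.

Lemma wall n G h x0 : bounded_by_zeros n G h -> Rn n x0 -> ev h x0 = 0 -> ev (pE h) x0 <> 0 ->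
  exists r, 0 < r /\ forall x x', nb r x0 x -> nb r x0 x' -> ev h x <> 0 -> ev h x' <> 0 ->
    ((G x <-> 0 < ev h x) <-> (G x' <-> 0 < ev h x')).
Proof.
  intros HG Hx0 E0 He. destruct (Rtotal_order (ev (pE h) x0) 0) as [Hl|[Hl|Hl]]; [|easy|now apply (wall_pos n)].
  destruct (wall_pos n G (pscal (- 1) h) x0) as (r & Hr & H); auto.
  - destruct HG as (Hh & Ho & Hreg & Hz). split; [auto with wf|split; [auto|split; [auto|]]].
    intros x Hx. rewrite ev_pscal, <- Hz by auto. lra.
  - rewrite ev_pscal, E0. ring.
  - rewrite ev_pE_pscal. lra.
  - exists r. split; auto. intros x x' Hx Hx' Hn Hn'. specialize (H x x' Hx Hx').
    rewrite !ev_pscal in H. specialize (H ltac:(lra) ltac:(lra)).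
    assert (0 < - 1 * ev h x <-> ~ 0 < ev h x) by lra.
    assert (0 < - 1 * ev h x' <-> ~ 0 < ev h x') by lra. tauto.
Qed.

Lemma ev_homogeneous n j p t x : wf n p -> degs j j p -> Rn n x -> ev p (scal t x) = t ^ j * ev p x.
Proof.
  intros Hp Hd Hx. rewrite (ev_scal n) by auto. unfold ev. rewrite <- sumR_scal. apply sumR_ext.
  intros m Hm. red in Hd. rewrite Forall_forall in Hd. specialize (Hd m Hm).
  now replace (mdeg (snd m)) with j by lia.
Qed.

(** Along a generic ray through [0] all zeros of [h] are simple, hence [G] and the sign of [h] change
    simultaneously. *)
Lemma constant_orientation n G h : bounded_by_zeros n G h -> generates n h -> ev h (repeat 0 n) <> 0 ->
  forall x, Rn n x -> ev h x <> 0 ->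
  ((G x <-> 0 < ev h x) <-> (G (repeat 0 n) <-> 0 < ev h (repeat 0 n))).
Proof.
  intros HG Hgen H0 x Hx Hnx.
  assert (Hloc : forall x, Rn n x -> ev h x <> 0 -> exists r, 0 < r /\ forall z, nb r x z ->
     ev h z <> 0 /\ ((G z <-> 0 < ev h z) <-> (G x <-> 0 < ev h x))).
  { clear x Hx Hnx. intros x Hx Hnx. destruct (status_local n G h x HG Hx Hnx) as (r & Hr & H).
    destruct (Rlt_dec 0 (ev h x)) as [Hl|Hl].
    - destruct (ev_pos_near h x 0 Hl) as (d & Hd & Hdz). exists (Rmin r d). split; [now apply Rmin_pos|].
      intros z Hxz. specialize (H z (nb_mono _ _ _ _ (Rmin_l _ _) Hxz)).
      specialize (Hdz z (nb_mono _ _ _ _ (Rmin_r _ _) Hxz)). split; [lra|tauto].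
    - destruct (ev_neg_near h x 0) as (d & Hd & Hdz); [lra|]. exists (Rmin r d). split; [now apply Rmin_pos|].
      intros z Hxz. specialize (H z (nb_mono _ _ _ _ (Rmin_l _ _) Hxz)).
      specialize (Hdz z (nb_mono _ _ _ _ (Rmin_r _ _) Hxz)). split; [lra|].
      assert (~ 0 < ev h z) by lra. tauto. }
  destruct (homogeneous_in_ideal n h Hgen H0) as (j & D & HD & HdD & HnD & (u & v & Hu & Hv & ED)).
  destruct (Hloc x Hx Hnx) as (r & Hr & Hxr).
  (* [x] is replaced by a nearby point [z] of the same status with [D z <> 0]. *)
  destruct (fnz_dense n D x r HnD Hx Hr) as (z & Hxz & HDz).
  assert (Hz : Rn n z) by now apply nb_Rn with r x.
  destruct (Hxr z Hxz) as [Hnz Hiff]. rewrite <- Hiff. clear x Hx Hnx r Hr Hxr Hxz Hiff.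
  pose proof HG as (Hh & _).
  assert (Hzero : Rn n (repeat 0 n)) by apply repeat_length.
  set (P := fun t => G (scal t z) <-> 0 < ev h (scal t z)).
  assert (HP : P 0 <-> P 1).
  { apply (interval_connected (fun t => ev h (scal t z) <> 0) P).
    - now rewrite (scal_0 n z).
    - now rewrite scal_1.
    (* [h] is not identically zero on the ray because [h(0) <> 0], so it is nonzero just to the
       right of [a]. *)
    - intros a b Ha Hb.
      pose proof (P1_comp_affine _ a 1 (P1_ev_seg n h (repeat 0 n) z Hzero Hz)) as HP1.
      destruct (P1_dichotomy _ HP1) as [Hall|(d & Hd & Hne)].
      + elim H0. specialize (Hall (- a)). replace (a + - a * 1) with 0 in Hall by ring.
        now rewrite (seg_0 n) in Hall.
      + assert (Hq : 0 < Rmin d (b - a)) by (apply Rmin_pos; lra).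
        pose proof (Rmin_l d (b - a)). pose proof (Rmin_r d (b - a)).
        exists (a + Rmin d (b - a) / 2). split; [lra|].
        specialize (Hne (Rmin d (b - a) / 2) ltac:(lra)). rewrite (seg_zero n) in Hne by auto.
        now rewrite Rmult_1_r in Hne.
    - intros t Ht. set (x0 := scal t z). assert (Hx0 : Rn n x0) by now apply Rn_scal.
      assert (Hw : exists r, 0 < r /\ forall x x', nb r x0 x -> nb r x0 x' -> ev h x <> 0 -> ev h x' <> 0 ->
         ((G x <-> 0 < ev h x) <-> (G x' <-> 0 < ev h x'))).
      { destruct (Req_dec (ev h x0) 0) as [E|E].
        - apply (wall n); auto. intros E'.
          (* A common zero of [h] and [E h] would be a zero of [D], but [D (t z) = t ^ j D z] is
             nonzero; [t <> 0] because [h(0) <> 0]. *)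
          assert (Hne : ev D x0 <> 0).
          { unfold x0. rewrite (ev_homogeneous n j) by auto.
            apply Rmult_integral_contrapositive_currified; auto. apply pow_nonzero. intros ->.
            apply H0. rewrite <- (scal_0 n z Hz). exact E. }
          apply Hne. rewrite ED, E, E' by auto. ring.
        - destruct (Hloc x0 Hx0 E) as (r & Hr & H). exists r. split; auto.
          intros x x' Hx Hx' _ _. rewrite (proj2 (H x Hx)), (proj2 (H x' Hx')). tauto. }
      destruct Hw as (r & Hr & Hw).
      destruct (seg_continuous n (repeat 0 n) z r Hzero Hz Hr) as (d & Hd & Hc).
      exists d. split; auto. intros s s' _ _ Hs Hs' Vs Vs'. apply Hw; auto.
      + unfold x0. rewrite <- !(seg_zero n) by auto. apply Hc. now rewrite Rabs_minus_sym.
      + unfold x0. rewrite <- !(seg_zero n) by auto. apply Hc. now rewrite Rabs_minus_sym. }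
  unfold P in HP. rewrite scal_1, (scal_0 n z) in HP by auto. tauto.
Qed.

(** All points off the boundary share the orientation of [0], which need not lie in [G]; its two
    possible values give the two cases. *)
Lemma constant_sign n G h : bounded_by_zeros n G h -> generates n h -> ev h (repeat 0 n) <> 0 ->
  (forall x, G x -> 0 < ev h x) \/ (forall x, G x -> ev h x < 0).
Proof.
  intros HG Hgen H0. pose proof (constant_orientation n G h HG Hgen H0) as H.
  destruct HG as (_ & Ho & _ & Hz).
  assert (Hne : forall x, G x -> Rn n x /\ ev h x <> 0).
  { intros x Gx. destruct (Ho x Gx) as [Hx _]. split; auto. intros E. apply Hz in E; tauto. }
  destruct (classic (G (repeat 0 n) <-> 0 < ev h (repeat 0 n))) as [Hs|Hs].
  - left. intros x Gx. destruct (Hne x Gx) as [Hx Hn]. specialize (H x Hx Hn). tauto.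
  - right. intros x Gx. destruct (Hne x Gx) as [Hx Hn]. specialize (H x Hx Hn).
    assert (~ 0 < ev h x) by tauto. lra.
Qed.

(** * The divergence theorem *)

(** The Riesz functional: [L y p] is the integral of [p] over [G] when [y] are the moments of [G]. *)
Definition L (y : list nat -> R) (p : pl) : R := sumR p (fun m => fst m * y (snd m)).

Lemma L_app y p q : L y (p ++ q) = L y p + L y q.
Proof. apply sumR_app. Qed.
Lemma L_pscal y c p : L y (pscal c p) = c * L y p.
Proof. unfold L, pscal, pw. rewrite sumR_map, <- sumR_scal. apply sumR_ext; intros; simpl; ring. Qed.

Definition moments (n : nat) (G : list R -> Prop) (y : list nat -> R) : Prop :=
  forall a, length a = n -> IntegralRn n (fun x => indic G x * mono x a) (y a).

Lemma indic_true G x : G x -> indic G x = 1.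
Proof. unfold indic; destruct (excluded_middle_informative (G x)); easy. Qed.
Lemma indic_false G x : ~ G x -> indic G x = 0.
Proof. unfold indic; destruct (excluded_middle_informative (G x)); easy. Qed.

Lemma riemann_box_zero n a f : (forall x, Rn n x -> f x = 0) -> riemann_box n a f 0.
Proof.
  intros Hf eps He. exists 0%nat. intros N _ HN t Ht. rewrite sumR_zero.
  - rewrite Rmult_0_r, Rminus_diag, Rabs_R0. exact He.
  - intros k Hk. apply Hf. red. rewrite (in_cell_length _ _ _ _ (Ht k Hk)). now apply grid_length with N.
Qed.

(** The finitely many moments in [p] come with different cubes; from the largest one on they can be
    combined, and [b] remains free to be enlarged. *)
Lemma riemann_L n G y p : moments n G y -> wf n p -> exists b0, 0 < b0 /\
  forall b, b0 <= b -> riemann_box n b (fun x => indic G x * ev p x) (L y p).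
Proof.
  intros Hy Hp. induction Hp as [|m p Hm Hp (b0 & Hb0 & IH)].
  - exists 1. split; [lra|]. intros b _. apply riemann_box_zero. intros x _. unfold ev; simpl. ring.
  - destruct (Hy (snd m) Hm) as (a & Ha & Hsupp & Hint).
    exists (Rmax a b0). split; [apply Rlt_le_trans with a; auto; apply Rmax_l|]. intros b Hb.
    pose proof (Rmax_l a b0). pose proof (Rmax_r a b0).
    apply riemann_box_ext with (fun x => fst m * (indic G x * mono x (snd m)) + indic G x * ev p x).
    { intros x _. unfold ev; simpl. ring. }
    apply riemann_box_plus; [|apply IH; lra]. apply riemann_box_scal.
    apply riemann_box_enlarge with a ((a + 1) ^ mdeg (snd m)); auto; [lra|apply pow_le; lra|].
    intros x Hx. destruct (Req_dec (indic G x * mono x (snd m)) 0) as [->|Hne].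
    + rewrite Rabs_R0. apply pow_le; lra.
    + specialize (Hsupp x Hx Hne). rewrite Rabs_mult.
      apply Rle_trans with (1 * Rabs (mono x (snd m))).
      * apply Rmult_le_compat_r; [apply Rabs_pos|]. unfold indic.
        destruct (excluded_middle_informative (G x)); rewrite ?Rabs_R0, ?Rabs_R1; lra.
      * rewrite Rmult_1_l. apply mono_bounded; [lra|]. revert Hsupp. apply Forall_impl. intros; lra.
Qed.

(** All tags give the same limit, so one favourable choice on every fine grid bounds the
    integral. *)
Lemma riemann_box_le n b f v s : 0 < b -> riemann_box n b f v ->
  (exists N1, forall N, (N1 <= N)%nat -> (0 < N)%nat -> exists t, (forall k, In k (grid n N) -> in_cell b N k (t k)) /\
     (2 * b / INR N) ^ n * sumR (grid n N) (fun k => f (t k)) <= s) -> v <= s.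
Proof.
  intros Hb Hv (N1 & Ht). destruct (Rle_dec v s) as [Hle|Hle]; auto.
  destruct (Hv (v - s)) as (N0 & HN0); [lra|].
  set (N := S (Nat.max N0 N1)). destruct (Ht N) as (t & Htag & Hs); [unfold N; lia|unfold N; lia|].
  specialize (HN0 N ltac:(unfold N; lia) ltac:(unfold N; lia) t Htag). apply Rabs_def2 in HN0. lra.
Qed.

Lemma L_nonpos n G y p : moments n G y -> wf n p -> (forall x, G x -> ev p x <= 0) -> L y p <= 0.
Proof.
  intros Hy Hp Hle. destruct (riemann_L n G y p Hy Hp) as (b & Hb & H).
  apply (riemann_box_le n b (fun x => indic G x * ev p x)); auto; [apply H; lra|].
  exists 0%nat. intros N _ HN. exists (corner b N). split.
  - intros k _. now apply corner_in_cell.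
  - pose proof (mesh_pos b N Hb HN).
    assert (sumR (grid n N) (fun k => indic G (corner b N k) * ev p (corner b N k)) <= 0).
    { rewrite <- (sumR_zero (grid n N) (fun _ => 0)) by auto. apply sumR_le. intros k _.
      unfold indic. destruct (excluded_middle_informative (G (corner b N k))) as [HG|HG]; [|lra].
      specialize (Hle _ HG). lra. }
    pose proof (pow_lt (2 * b / INR N) n ltac:(lra)). nra.
Qed.

Lemma L_le n G y p q : moments n G y -> wf n p -> wf n q ->
  (forall x, G x -> ev p x <= ev q x) -> L y p <= L y q.
Proof.
  intros Hy Hp Hq H. assert (L y (p ++ pscal (- 1) q) <= 0); [|rewrite L_app, L_pscal in H0; lra].
  apply (L_nonpos n G); auto with wf. intros x Gx. rewrite ev_app, ev_pscal. specialize (H x Gx). lra.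
Qed.

Lemma L_ext n G y p q : moments n G y -> wf n p -> wf n q ->
  (forall x, G x -> ev p x = ev q x) -> L y p = L y q.
Proof.
  intros Hy Hp Hq H. apply Rle_antisym; apply (L_le n G); auto; intros x Gx; rewrite H; auto; lra.
Qed.

Lemma coords_bounded (c : list R) : exists b, 0 < b /\ Forall (fun u => Rabs u <= b) c.
Proof.
  induction c as [|u c (b & Hb & IH)]; [exists 1; split; [lra|constructor]|].
  pose proof (Rabs_pos u). exists (b + Rabs u). split; [lra|]. constructor; [lra|].
  revert IH; apply Forall_impl. intros; lra.
Qed.

(** [(rho / 2) ^ n] is a lower bound for the volume of the ball [nb rho c]. *)
Lemma L_neg_on_ball n G y p c rho kappa : moments n G y -> wf n p -> Rn n c -> 0 < rho -> 0 <= kappa ->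
  (forall x, G x -> ev p x <= 0) ->
  (forall x, nb rho c x -> G x /\ ev p x <= - kappa) -> L y p <= - (kappa * (rho / 2) ^ n).
Proof.
  intros Hy Hp Hc Hr Hk Hle Hball. destruct (riemann_L n G y p Hy Hp) as (b0 & Hb0 & H).
  destruct (coords_bounded c) as (b1 & Hb1 & Hcb).
  set (b := b0 + b1 + rho). assert (Hb : 0 < b) by (unfold b; lra).
  apply (riemann_box_le n b (fun x => indic G x * ev p x)); auto; [apply H; unfold b; lra|].
  destruct (mesh_small b (rho / 4) Hb) as (M0 & HM0); [lra|].
  exists M0. intros N HM HN. specialize (HM0 N HM HN). exists (corner b N). split.
  { intros k _. now apply corner_in_cell. }
  pose proof (mesh_pos b N Hb HN) as Hh. set (h := 2 * b / INR N) in *.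
  (* The box of side [rho] lies in the ball, and a mesh below [rho / 4] leaves at least
     [(rho / 2) ^ n] of its volume in the count. *)
  set (B := map (fun u => (u - rho / 2, u + rho / 2)) c).
  assert (Hcount : (rho - 2 * h) ^ n <=
     h ^ n * sumR (grid n N) (fun k => chi (in_hbox B (corner b N k)))).
  { apply count_hbox_ge; auto.
    - unfold B. now rewrite length_map.
    - intros k _. now apply corner_in_cell.
    - fold h. lra.
    - intros I HI. apply in_map_iff in HI. destruct HI as (u & <- & Hu). simpl.
      rewrite Forall_forall in Hcb. specialize (Hcb u Hu). pose proof (Rle_abs u). pose proof (Rle_abs (- u)) as Hu'.
      rewrite Rabs_Ropp in Hu'. unfold b; repeat split; lra. }
  assert (Hpow : (rho / 2) ^ n <= (rho - 2 * h) ^ n) by (apply pow_incr; lra).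
  assert (Hsum : sumR (grid n N) (fun k => indic G (corner b N k) * ev p (corner b N k)) <=
     - kappa * sumR (grid n N) (fun k => chi (in_hbox B (corner b N k)))).
  { rewrite <- sumR_scal. apply sumR_le. intros k _.
    destruct (classic (in_hbox B (corner b N k))) as [HB|HB].
    - rewrite chi_true by auto.
      assert (Hnb : nb rho c (corner b N k)).
      { clear - HB Hr. unfold B in HB. revert HB. generalize (corner b N k). induction c as [|u c IH];
         intros x HB; inversion HB; subst; constructor.
        - simpl in *. apply Rabs_def1; lra.
        - now apply IH. }
      destruct (Hball _ Hnb) as [HG Hl]. rewrite indic_true by auto. lra.
    - rewrite chi_false by auto. unfold indic.
      destruct (excluded_middle_informative (G (corner b N k))) as [HG|HG]; [|lra].
      specialize (Hle _ HG). lra. }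
  assert (Hhn : 0 < h ^ n) by now apply pow_lt.
  apply Rle_trans with (h ^ n * (- kappa * sumR (grid n N) (fun k => chi (in_hbox B (corner b N k))))).
  { apply Rmult_le_compat_l; lra. }
  nra.
Qed.

(** Starting in [V] at [a], the first exit from [V] is a zero of [u], and the mean value theorem up
    to it accounts for [u a]. If [a] is outside [V], the length [l] is [0]. *)
Lemma exit_point (V : R -> Prop) (u u' : R -> R) a c0 :
  (forall t, derivable_pt_lim u t (u' t)) ->
  (forall t, V t -> exists d, 0 < d /\ forall s, Rabs (s - t) < d -> V s) ->
  (forall t, ~ V t -> (forall d, 0 < d -> exists s, Rabs (s - t) < d /\ V s) -> u t = 0) ->
  a <= c0 -> ~ V c0 ->
  exists s l, a <= s <= c0 /\ 0 <= l <= c0 - a /\ - (chi (V a) * u a) = chi (V s) * u' s * l.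
Proof.
  intros Hd Ho Hz Hac Hc0. destruct (classic (V a)) as [Va|Va].
  2:{ exists a, 0. repeat split; try lra. rewrite chi_false by auto. ring. }
  set (T := fun t => a <= t <= c0 /\ forall s, a <= s <= t -> V s).
  destruct (completeness T) as (c & Hub & Hlub).
  { exists c0. intros t [Ht _]. lra. }
  { exists a. split; [lra|]. intros s Hs. now replace s with a by lra. }
  assert (Hac' : a <= c).
  { apply Hub. split; [lra|]. intros s Hs. now replace s with a by lra. }
  assert (Hcc : c <= c0) by (apply Hlub; intros t [Ht _]; lra).
  assert (Hbelow : forall s, a <= s < c -> V s).
  { intros s Hs. apply NNPP. intros Vs. assert (c <= s); [|lra]. apply Hlub. intros t [Ht HV].
    destruct (Rle_dec t s); auto. elim Vs. apply HV. lra. }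
  assert (Vc : ~ V c).
  { intros Vc. assert (Hne : c <> c0) by (intros ->; auto).
    destruct (Ho c Vc) as (d & Hd0 & HV). assert (0 < Rmin (d / 2) (c0 - c)) by (apply Rmin_pos; lra).
    pose proof (Rmin_l (d / 2) (c0 - c)). pose proof (Rmin_r (d / 2) (c0 - c)).
    assert (c + Rmin (d / 2) (c0 - c) <= c); [|lra]. apply Hub. split; [lra|]. intros s Hs.
    destruct (Rlt_dec s c); [apply Hbelow; lra|]. apply HV. apply Rabs_def1; lra. }
  assert (Hac2 : a < c). { destruct (Req_dec a c) as [->|]; [contradiction|lra]. }
  assert (uc : u c = 0).
  { apply Hz; auto. intros d Hd0. exists (Rmax a (c - d / 2)).
    pose proof (Rmax_l a (c - d / 2)). pose proof (Rmax_r a (c - d / 2)).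
    assert (Rmax a (c - d / 2) < c) by (apply Rmax_lub_lt; lra).
    split; [apply Rabs_def1; lra|]. apply Hbelow; lra. }
  destruct (MVT_cor2 u u' a c Hac2) as (s & Hs & Hs'); [intros; auto|].
  exists s, (c - a). repeat split; try lra. rewrite !chi_true; auto; [lra|]. apply Hbelow; lra.
Qed.

(** If [V] does not contain [[a, b]], the pieces of [V] at both ends lead to zeros of [u]; of their two
    mean value points and a point outside [V] the best one is taken. *)
Lemma mean_value_tag (V : R -> Prop) (u u' : R -> R) a b :
  (forall t, derivable_pt_lim u t (u' t)) ->
  (forall t, V t -> exists d, 0 < d /\ forall s, Rabs (s - t) < d -> V s) ->
  (forall t, ~ V t -> (forall d, 0 < d -> exists s, Rabs (s - t) < d /\ V s) -> u t = 0) ->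
  a < b ->
  exists t, a <= t <= b /\ chi (V b) * u b - chi (V a) * u a <= (b - a) * (chi (V t) * u' t).
Proof.
  intros Hd Ho Hz Hab. destruct (classic (forall t, a <= t <= b -> V t)) as [Hall|Hno].
  - destruct (MVT_cor2 u u' a b Hab) as (s & Hs & Hs'); [intros; auto|].
    exists s. split; [lra|]. rewrite !chi_true; try (apply Hall; lra). lra.
  - apply not_all_ex_not in Hno. destruct Hno as (c0 & Hc0). apply imply_to_and in Hc0.
    destruct Hc0 as [Hc0 Vc0].
    destruct (exit_point V u u' a c0) as (s1 & l1 & Hs1 & Hl1 & E1); auto; [lra|].
    destruct (exit_point (fun t => V (- t)) (fun t => u (- t)) (fun t => - u' (- t)) (- b) (- c0))
      as (s2 & l2 & Hs2 & Hl2 & E2).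
    + intros t. replace (- u' (- t)) with (u' (- t) * - 1) by ring.
      apply (derivable_pt_lim_comp Ropp u); [|apply Hd].
      replace (-1) with (- (1)) by ring. apply (derivable_pt_lim_opp (fun t => t)), derivable_pt_lim_id.
    + intros t Vt. destruct (Ho _ Vt) as (d & Hd0 & H). exists d. split; auto. intros s Hs. apply H.
      replace (- s - - t) with (- (s - t)) by ring. now rewrite Rabs_Ropp.
    + intros t Vt H. apply Hz; auto. intros d Hd0. destruct (H d Hd0) as (s & Hs & Vs).
      exists (- s). split; auto. replace (- s - - t) with (- (s - t)) by ring. now rewrite Rabs_Ropp.
    + lra.
    + now rewrite Ropp_involutive.
    + rewrite Ropp_involutive in E2. set (s3 := - s2) in *.
      assert (E : chi (V b) * u b - chi (V a) * u a = chi (V s1) * u' s1 * l1 + chi (V s3) * u' s3 * l2) by lra.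
      rewrite E. set (f1 := chi (V s1) * u' s1) in *. set (f2 := chi (V s3) * u' s3) in *.
      (* As [l1 + l2 <= b - a], the increment is at most [b - a] times the largest of [f1], [f2] and
         [0]; the point [c0] outside [V] realises the value [0]. *)
      destruct (Rle_dec f1 f2) as [Hf|Hf]; [destruct (Rle_dec f2 0) as [Hf0|Hf0]|destruct (Rle_dec f1 0) as [Hf0|Hf0]].
      * exists c0. split; auto. rewrite chi_false by auto. nra.
      * exists s3. split; [unfold s3; lra|]. fold f2. nra.
      * exists c0. split; auto. rewrite chi_false by auto. nra.
      * exists s1. split; [lra|]. fold f1. nra.
Qed.

Fixpoint upd {A} (i : nat) (t : A) (x : list A) : list A :=
  match x, i with
  | [], _ => []
  | _ :: x', O => t :: x'
  | x0 :: x', S i' => x0 :: upd i' t x'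
  end.

Lemma length_upd {A} i (t : A) x : length (upd i t x) = length x.
Proof. revert i; induction x as [|x0 x IH]; intros [|i]; simpl; auto. Qed.

Lemma map_upd {A B} (f : A -> B) i t x : map f (upd i t x) = upd i (f t) (map f x).
Proof. revert i; induction x as [|x0 x IH]; intros [|i]; simpl; auto. now rewrite IH. Qed.

Lemma upd_nth {A} (d : A) i x : (i < length x)%nat -> upd i (nth i x d) x = x.
Proof.
  revert i; induction x as [|x0 x IH]; intros [|i]; simpl; intros; try lia; auto. rewrite IH; auto; lia.
Qed.

Lemma mono_upd i t x a : (i < length x)%nat -> length a = length x ->
  mono (upd i t x) a = t ^ nth i a 0%nat * mono (upd i 1 x) a.
Proof.
  revert i a; induction x as [|x0 x IH]; intros [|i] [|a0 a]; simpl; intros Hi Ha; try lia; try discriminate.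
  - rewrite pow1. ring.
  - rewrite IH by lia. ring.
Qed.

Lemma nb_upd d i s t x : 0 < d -> Rabs (s - t) < d -> nb d (upd i s x) (upd i t x).
Proof.
  intros Hd Hst. revert i; induction x as [|x0 x IH]; intros [|i]; simpl; constructor; auto.
  - now apply nb_refl.
  - now rewrite Rminus_diag, Rabs_R0.
  - apply IH.
Qed.

Lemma in_cell_upd b N i t k : 0 < b -> (0 < N)%nat -> (i < length k)%nat ->
  node b N (nth i k 0%nat) <= t <= node b N (S (nth i k 0%nat)) -> in_cell b N k (upd i t (corner b N k)).
Proof.
  intros Hb HN. revert i; induction k as [|j k IH]; intros [|i]; simpl; intros Hi Ht; try lia.
  - constructor; [exact Ht|now apply corner_in_cell].
  - constructor; [|apply IH; auto; lia].
    fold (node b N j) (node b N (S j)). pose proof (node_mono b N j (S j) Hb HN ltac:(lia)). lra.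
Qed.

(** The sum telescopes along each line in direction [i]; the index [N], one past the last cell,
    labels the right face of the cube. *)
Lemma grid_telescope n i N (F : list nat -> R) : (i < n)%nat ->
  (forall k, length k = n -> nth i k 0%nat = 0%nat \/ nth i k 0%nat = N -> F k = 0) ->
  sumR (grid n N) (fun k => F (upd i (S (nth i k 0%nat)) k) - F k) = 0.
Proof.
  revert i F; induction n as [|n IH]; intros i F Hi HF; [lia|].
  rewrite sumR_grid_S. destruct i as [|i]; simpl.
  - rewrite sumR_swap. apply sumR_zero. intros k Hk. apply grid_length in Hk.
    rewrite (sumR_seq_telescope (fun j => F (j :: k))). simpl.
    rewrite !HF; simpl; auto; lra.
  - apply sumR_zero. intros j _. apply (IH i (fun k => F (j :: k))); [lia|].
    intros k Hk H. apply HF; simpl; auto.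
Qed.

Definition pDi (i : nat) (p : pl) : pl := pw (fun a => INR (S (nth i a 0%nat))) p.

(** [pDi i p] represents [d/dx_i (x_i p)]. *)
Lemma derivable_upd n i p x t : wf n p -> Rn n x -> (i < n)%nat ->
  derivable_pt_lim (fun s => s * ev p (upd i s x)) t (ev (pDi i p) (upd i t x)).
Proof.
  intros Hp Hx Hi. red in Hp. rewrite Forall_forall in Hp. unfold Rn in Hx.
  assert (H : derivable_pt_lim
     (fun s => sumR p (fun m => s ^ S (nth i (snd m) 0%nat) * (fst m * mono (upd i 1 x) (snd m)))) t
     (sumR p (fun m => INR (S (nth i (snd m) 0%nat)) * t ^ nth i (snd m) 0%nat * (fst m * mono (upd i 1 x) (snd m))))).
  { apply derivable_pt_lim_sumR. intros m _. set (q := nth i (snd m) 0%nat). set (w := fst m * _).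
    replace (INR (S q) * t ^ q * w) with (INR (S q) * t ^ pred (S q) * w + t ^ S q * 0) by (simpl pred; ring).
    apply (derivable_pt_lim_mult (fun s => s ^ S q) (fun _ => w)).
    - apply derivable_pt_lim_pow.
    - apply derivable_pt_lim_const. }
  assert (E1 : forall s, s * ev p (upd i s x) =
     sumR p (fun m => s ^ S (nth i (snd m) 0%nat) * (fst m * mono (upd i 1 x) (snd m)))).
  { intros s. unfold ev. rewrite <- sumR_scal. apply sumR_ext. intros m Hm.
    rewrite mono_upd by (rewrite ?Hp; auto; lia). simpl. ring. }
  replace (ev (pDi i p) (upd i t x)) with
     (sumR p (fun m => INR (S (nth i (snd m) 0%nat)) * t ^ nth i (snd m) 0%nat * (fst m * mono (upd i 1 x) (snd m)))).
  - intros eps He. destruct (H eps He) as (dl & Hdl). exists dl. intros hh Hh0 Hh. rewrite !E1. now apply Hdl.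
  - unfold ev, pDi, pw. rewrite sumR_map. apply sumR_ext. intros m Hm. cbn [fst snd].
    rewrite (mono_upd i t) by (rewrite ?Hp; auto; lia). ring.
Qed.

Lemma nth_corner b N i k : (i < length k)%nat -> nth i (corner b N k) 0 = node b N (nth i k 0%nat).
Proof.
  intros Hi. unfold corner. rewrite (nth_indep _ 0 (node b N 0%nat)) by now rewrite length_map. apply map_nth.
Qed.

Lemma in_box_nth a x i : in_box a x -> (i < length x)%nat -> Rabs (nth i x 0) < a.
Proof.
  unfold in_box. intros H Hi. rewrite Forall_forall in H. apply H. now apply nth_In.
Qed.

(** The discrete version of integrating [d/dx_i (x_i p)] along lines parallel to the [i]-th axis: with
    the tags of [mean_value_tag] every Riemann sum dominates a telescoping sum equal to [0]. *)
Lemma L_pDi_nonneg n G y p i a0 : moments n G y -> wf n p -> (i < n)%nat ->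
  open_nb n G -> 0 < a0 -> (forall x, G x -> in_box a0 x) ->
  (forall x, Rn n x -> clos G x -> ~ G x -> ev p x = 0) ->
  0 <= L y (pDi i p).
Proof.
  intros Hy Hp Hi Ho Ha0 Hbox Hvan. apply Ropp_le_cancel. rewrite Ropp_0.
  destruct (riemann_L n G y (pDi i p) Hy) as (b0 & Hb0 & H); [unfold pDi; auto with wf|].
  (* The cube must serve for the Riemann sums and keep [G] away from its faces, so that the
     telescoping sum has no end terms. *)
  set (b := b0 + a0). assert (Hb : 0 < b) by (unfold b; lra).
  replace (- L y (pDi i p)) with (- 1 * L y (pDi i p)) by ring.
  apply (riemann_box_le n b (fun x => - 1 * (indic G x * ev (pDi i p) x)) _ _ Hb).
  { apply riemann_box_scal, H. unfold b; lra. }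
  exists 0%nat. intros N _ HN. pose proof (mesh_pos b N Hb HN) as Hh. set (h := 2 * b / INR N) in *.
  assert (Htag : forall k, exists x, In k (grid n N) -> in_cell b N k x /\
     indic G (corner b N (upd i (S (nth i k 0%nat)) k)) *
       (node b N (S (nth i k 0%nat)) * ev p (corner b N (upd i (S (nth i k 0%nat)) k)))
     - indic G (corner b N k) * (node b N (nth i k 0%nat) * ev p (corner b N k))
     <= h * (indic G x * ev (pDi i p) x)).
  { intros k. destruct (classic (In k (grid n N))) as [Hk|Hk]; [|exists []; tauto].
    apply grid_length in Hk. set (j := nth i k 0%nat). set (x := corner b N k).
    assert (Hx : Rn n x) by (unfold x, corner, Rn; now rewrite length_map).
    destruct (mean_value_tag (fun t => G (upd i t x)) (fun t => t * ev p (upd i t x))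
       (fun t => ev (pDi i p) (upd i t x)) (node b N j) (node b N (S j))) as (t & Ht & Hle).
    - intros t. now apply (derivable_upd n).
    - intros t Vt. destruct (Ho _ Vt) as (_ & r & Hr & Hball). exists r. split; auto.
      intros s Hs. apply Hball, nb_upd; auto. now rewrite Rabs_minus_sym.
    - intros t Vt Hlim. rewrite (Hvan (upd i t x)); [ring| | |auto].
      + unfold Rn in *. now rewrite length_upd.
      + intros r Hr. destruct (Hlim r Hr) as (s & Hs & Vs). exists (upd i s x). split; auto.
        apply nb_upd; auto. now rewrite Rabs_minus_sym.
    - rewrite node_S. fold h. lra.
    - exists (upd i t x). intros _. split.
      + apply in_cell_upd; auto. lia.
      + assert (Ec : corner b N (upd i (S j) k) = upd i (node b N (S j)) x) by apply map_upd.
        assert (Ex : x = upd i (node b N j) x).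
        { unfold j, x. rewrite <- nth_corner by lia. symmetry. apply upd_nth. unfold Rn in Hx.
          fold x. lia. }
        rewrite Ec. rewrite Ex at 3 4.
        replace (node b N (S j) - node b N j) with h in Hle by (rewrite node_S; fold h; ring).
        exact Hle. }
  destruct (ClassicalEpsilon.choice _ Htag) as (t & Ht). clear Htag.
  exists t. split; [intros k Hk; now apply Ht|].
  pose proof (grid_telescope n i N (fun k => indic G (corner b N k) *
     (node b N (nth i k 0%nat) * ev p (corner b N k))) Hi) as Htel.
  assert (Hsum : 0 <= sumR (grid n N) (fun k => h * (indic G (t k) * ev (pDi i p) (t k)))).
  { rewrite <- Htel.
    - apply sumR_le. intros k Hk. destruct (Ht k Hk) as [_ Hle].
      assert (En : nth i (upd i (S (nth i k 0%nat)) k) 0%nat = S (nth i k 0%nat)).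
      { apply grid_length in Hk. rewrite <- Hk in Hi. clear - Hi. generalize (S (nth i k 0%nat)). revert i Hi.
        induction k as [|k0 k IH]; intros [|i]; simpl; intros; try lia; auto. apply IH; lia. }
      rewrite En. exact Hle.
    - intros k Hk Hends. rewrite indic_false; [ring|]. intros HG. specialize (Hbox _ HG).
      apply (in_box_nth _ _ i) in Hbox; [|unfold corner; rewrite length_map; lia].
      rewrite nth_corner in Hbox by lia. apply Rabs_def2 in Hbox.
      destruct Hends as [E|E]; rewrite E in Hbox; rewrite ?node_0, ?node_M in Hbox by auto; unfold b in *; lra. }
  rewrite sumR_scal in *. assert (0 < h ^ n) by (apply pow_lt; lra).
  assert (0 <= sumR (grid n N) (fun k => indic G (t k) * ev (pDi i p) (t k))) by nra. nra.
Qed.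

(** The divergence of the vector field [p(x) x]. *)
Definition pdiv (n : nat) (p : pl) : pl := pw (fun a => INR (n + mdeg a)) p.

Lemma ev_pdiv n p x : ev (pdiv n p) x = INR n * ev p x + ev (pE p) x.
Proof.
  unfold ev, pdiv, pE, pw. rewrite !sumR_map, <- sumR_scal, <- sumR_plus.
  apply sumR_ext; intros m _. cbn [fst snd]. rewrite plus_INR. ring.
Qed.

Lemma wf_pdiv n p : wf n p -> wf n (pdiv n p).
Proof. apply wf_pw. Qed.

#[global] Hint Resolve wf_pdiv : wf.

Lemma sum_nth_mdeg a : sumR (seq 0 (length a)) (fun i => INR (S (nth i a 0%nat))) = INR (length a + mdeg a).
Proof.
  induction a as [|a0 a IH]; [easy|]. change (length (a0 :: a)) with (S (length a)).
  cbn [seq sumR]. rewrite <- seq_shift, sumR_map. cbn [nth]. rewrite IH, <- plus_INR. f_equal.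
  change (mdeg (a0 :: a)) with (a0 + mdeg a)%nat. lia.
Qed.

Lemma L_pdiv_sum n y p : wf n p -> L y (pdiv n p) = sumR (seq 0 n) (fun i => L y (pDi i p)).
Proof.
  intros Hp. unfold L, pdiv, pDi, pw. rewrite sumR_map.
  erewrite (sumR_ext (seq 0 n)) by (intros; apply sumR_map). rewrite sumR_swap.
  apply sumR_ext. intros m Hm. red in Hp. rewrite Forall_forall in Hp. cbn [fst snd].
  rewrite (sumR_ext _ _ (fun i => INR (S (nth i (snd m) 0%nat)) * (fst m * y (snd m)))) by (intros; ring).
  rewrite sumR_scalr. rewrite <- (Hp m Hm), sum_nth_mdeg. ring.
Qed.

(** Every coordinate contributes zero separately: the one-sided bound is applied to [p] and to
    [- p]. *)
Lemma divergence_theorem n G y p a0 : moments n G y -> wf n p ->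
  open_nb n G -> 0 < a0 -> (forall x, G x -> in_box a0 x) ->
  (forall x, Rn n x -> clos G x -> ~ G x -> ev p x = 0) ->
  L y (pdiv n p) = 0.
Proof.
  intros Hy Hp Ho Ha0 Hbox Hvan. rewrite L_pdiv_sum by auto. apply sumR_zero. intros i Hi.
  apply in_seq in Hi. apply Rle_antisym.
  - apply Ropp_le_cancel. rewrite Ropp_0.
    replace (- L y (pDi i p)) with (L y (pDi i (pscal (- 1) p))).
    + apply (L_pDi_nonneg n G y _ i a0); auto with wf; [lia|].
      intros x Hx H1 H2. rewrite ev_pscal, Hvan by auto. ring.
    + unfold L, pDi, pscal, pw. rewrite !sumR_map.
      replace (- sumR p _) with (- 1 * sumR p (fun m => INR (S (nth i (snd m) 0%nat)) * fst m * y (snd m))) by (cbn; ring).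
      rewrite <- sumR_scal. apply sumR_ext; intros; cbn [fst snd]. ring.
  - apply (L_pDi_nonneg n G y p i a0); auto. lia.
Qed.

(** * Concentration at the boundary *)

(** Bolzano-Weierstrass one coordinate at a time: a subsequence settles the first coordinate, and
    the induction hypothesis is applied to the tails along it. *)
Lemma cell_accumulation b N c (u : nat -> list R) : (forall p, in_cell b N c (u p)) ->
  exists l, in_cell b N c l /\ forall r P, 0 < r -> exists p, (P <= p)%nat /\ nb r l (u p).
Proof.
  revert u; induction c as [|j c IH]; intros u Hu.
  - exists []. split; [constructor|]. intros r P _. exists P. split; auto.
    specialize (Hu P). inversion Hu. constructor.
  - set (lo := node b N j). set (hi := node b N (S j)).
    assert (Hd : forall p, exists x0 x, u p = x0 :: x /\ lo <= x0 <= hi /\ in_cell b N c x).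
    { intros p. specialize (Hu p). inversion Hu; subst. eauto. }
    destruct (Bolzano_Weierstrass (fun p => hd 0 (u p)) (fun t => lo <= t <= hi)) as (l0 & Hl0).
    { apply compact_P3. }
    { intros p. destruct (Hd p) as (x0 & x & -> & H & _). exact H. }
    assert (Hnear : forall r P, 0 < r -> exists p, (P <= p)%nat /\ Rabs (hd 0 (u p) - l0) < r).
    { intros r P Hr. destruct (Hl0 (disc l0 (mkposreal r Hr)) P) as (p & Hp & H).
      - exists (mkposreal r Hr). intros t Ht. exact Ht.
      - exists p. split; auto. }
    assert (Hl : lo <= l0 <= hi).
    { split; apply Rnot_lt_le; intros Hlt.
      - destruct (Hnear (lo - l0) 0%nat) as (p & _ & H); [lra|].
        destruct (Hd p) as (x0 & x & E & H' & _). rewrite E in H. apply Rabs_def2 in H. simpl in H. lra.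
      - destruct (Hnear (l0 - hi) 0%nat) as (p & _ & H); [lra|].
        destruct (Hd p) as (x0 & x & E & H' & _). rewrite E in H. apply Rabs_def2 in H. simpl in H. lra. }
    assert (Hphi : forall q : nat, exists p, (q <= p)%nat /\ Rabs (hd 0 (u p) - l0) < / INR (S q)).
    { intros q. apply Hnear. apply Rinv_0_lt_compat, lt_0_INR. lia. }
    destruct (ClassicalEpsilon.choice _ Hphi) as (phi & Hp).
    destruct (IH (fun q => tl (u (phi q)))) as (l & Hlc & Hacc).
    { intros q. destruct (Hd (phi q)) as (x0 & x & -> & _ & H). exact H. }
    exists (l0 :: l). split; [constructor; auto|]. intros r P Hr.
    destruct (archimed_cor1 r Hr) as (Q & HQ & HQ0).
    destruct (Hacc r (Nat.max P Q) Hr) as (q & Hq & Hn). exists (phi q). destruct (Hp q) as [Hp1 Hp2].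
    split; [lia|]. destruct (Hd (phi q)) as (x0 & x & E & _). rewrite E in *. constructor; auto.
    rewrite Rabs_minus_sym. cbn [hd] in Hp2. eapply Rlt_trans; [exact Hp2|].
    eapply Rle_lt_trans; [|exact HQ]. apply Rinv_le_contravar; [now apply lt_0_INR|]. apply le_INR. lia.
Qed.

(** Points with values approaching [v] would accumulate in the closed cell, and continuity would
    force the value there up to [v]. *)
Lemma cell_max_lt b N c p v : (forall x, in_cell b N c x -> ev p x < v) ->
  exists q, q < v /\ forall x, in_cell b N c x -> ev p x <= q.
Proof.
  intros H. apply NNPP. intros Hno.
  assert (Hseq : forall j : nat, exists x, in_cell b N c x /\ v - / INR (S j) < ev p x).
  { intros j. apply NNPP. intros Hj. apply Hno. exists (v - / INR (S j)). split.
    - assert (0 < / INR (S j)) by (apply Rinv_0_lt_compat, lt_0_INR; lia). lra.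
    - intros x Hx. apply Rnot_lt_le. intros Hlt. apply Hj. now exists x. }
  destruct (ClassicalEpsilon.choice _ Hseq) as (u & Hu).
  destruct (cell_accumulation b N c u) as (l & Hl & Hacc); [intros; now apply Hu|].
  specialize (H l Hl). destruct (ev_neg_near p l ((v + ev p l) / 2)) as (d & Hd & Hn); [lra|].
  destruct (archimed_cor1 ((v - ev p l) / 2)) as (Q & HQ & HQ0); [lra|].
  destruct (Hacc d Q Hd) as (j & Hj & Hnb). specialize (Hn _ Hnb). destruct (Hu j) as [_ Hlt].
  assert (/ INR (S j) <= / INR Q) by (apply Rinv_le_contravar; [now apply lt_0_INR|apply le_INR; lia]).
  lra.
Qed.

Lemma common_bound {A} (l : list A) (P : A -> R -> Prop) v :
  (forall a q q', P a q -> q <= q' -> P a q') ->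
  (forall a, In a l -> exists q, q < v /\ P a q) -> exists q, q < v /\ forall a, In a l -> P a q.
Proof.
  intros Hm. induction l as [|a l IH]; intros H.
  - exists (v - 1). split; [lra|]. easy.
  - destruct IH as (q & Hq & Hl); [intros; apply H; now right|].
    destruct (H a) as (q' & Hq' & Ha); [now left|].
    exists (Rmax q q'). split; [now apply Rmax_lub_lt|]. intros a' [<-|Ha'].
    + apply Hm with q'; auto. apply Rmax_r.
    + apply Hm with q; auto. apply Rmax_l.
Qed.

Lemma indic_01 G x : 0 <= indic G x <= 1.
Proof. unfold indic; destruct (excluded_middle_informative (G x)); lra. Qed.

(** [G] is Jordan measurable (its indicator is Riemann integrable), so up to a small volume it consists
    of closed cells contained in [G], on each of which [beta] is bounded away from [1]. *)
Lemma L_ppow_small n G y beta a0 eps : moments n G y -> wf n beta ->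
  (forall x, G x -> Rn n x) -> (forall x, G x -> in_box a0 x) ->
  (forall x, G x -> 0 <= ev beta x < 1) -> 0 < eps ->
  exists m0, forall m, (m0 <= m)%nat -> L y (ppow n beta m) <= eps.
Proof.
  intros Hy Hbeta HGn Hbox Hb01 He.
  destruct (riemann_L n G y (pconst n 1) Hy) as (b1 & Hb1 & Hint); auto with wf.
  set (a := Rmax b1 a0). assert (Hb1a : b1 <= a) by apply Rmax_l. assert (Ha0a : a0 <= a) by apply Rmax_r.
  assert (Ha : 0 < a) by lra.
  destruct (Hint a Hb1a (eps / 4)) as (N0 & HN0); [lra|].
  set (N := S N0). specialize (HN0 N ltac:(unfold N; lia) ltac:(unfold N; lia)).
  assert (HN : (0 < N)%nat) by (unfold N; lia). clearbody N.
  pose proof (mesh_pos a N Ha HN) as Hw. set (w := 2 * a / INR N) in *.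
  (* [t] picks a point of [G] in every cell that meets [G], [t'] a point outside [G] in every cell
     not contained in [G]; the two indicators differ exactly on the mixed cells. *)
  assert (Hin : forall c, exists x, in_cell a N c x /\ forall z, in_cell a N c z -> G z -> G x).
  { intros c. destruct (classic (exists z, in_cell a N c z /\ G z)) as [(z & Hz & Gz)|Hno].
    - exists z; auto.
    - exists (corner a N c). split; [now apply corner_in_cell|]. intros z Hz Gz. elim Hno; eauto. }
  assert (Hout : forall c, exists x, in_cell a N c x /\ forall z, in_cell a N c z -> ~ G z -> ~ G x).
  { intros c. destruct (classic (exists z, in_cell a N c z /\ ~ G z)) as [(z & Hz & Gz)|Hno].
    - exists z; auto.
    - exists (corner a N c). split; [now apply corner_in_cell|]. intros z Hz Gz. elim Hno; eauto. }
  destruct (ClassicalEpsilon.choice _ Hin) as (t & Ht).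
  destruct (ClassicalEpsilon.choice _ Hout) as (t' & Ht').
  (* Both Riemann sums are within [eps / 4] of the volume of [G], so the mixed cells have small
     total volume. *)
  assert (Hdiff : w ^ n * sumR (grid n N) (fun c => indic G (t c) - indic G (t' c)) <= eps / 2).
  { pose proof (HN0 t ltac:(intros; apply Ht)) as H1. pose proof (HN0 t' ltac:(intros; apply Ht')) as H2.
    apply Rabs_def2 in H1, H2. rewrite sumR_minus.
    erewrite sumR_ext in H1 by (intros; rewrite ev_pconst, Rmult_1_r; reflexivity).
    erewrite sumR_ext in H2 by (intros; rewrite ev_pconst, Rmult_1_r; reflexivity). lra. }
  destruct (common_bound (grid n N)
     (fun c q => (forall x, in_cell a N c x -> G x) -> forall x, in_cell a N c x -> ev beta x <= q) 1)
     as (q0 & Hq0 & Hq).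
  { intros c q q' H Hqq HG x Hx. specialize (H HG x Hx). lra. }
  { intros c _. destruct (classic (forall x, in_cell a N c x -> G x)) as [HG|HG].
    - destruct (cell_max_lt a N c beta 1) as (q & Hq & H); [intros; now apply Hb01, HG|].
      exists q. split; auto.
    - exists 0. split; [lra|]. tauto. }
  set (q := Rmax q0 0). assert (Hq1 : 0 <= q < 1) by (unfold q; split; [apply Rmax_r|apply Rmax_lub_lt; lra]).
  assert (Hqq : q0 <= q) by apply Rmax_l.
  assert (HV : 0 < (2 * a) ^ n) by (apply pow_lt; lra).
  destruct (pow_lt_1_zero q ltac:(rewrite Rabs_pos_eq; lra) (eps / 8 / (2 * a) ^ n)) as (m0 & Hm0).
  { apply Rdiv_lt_0_compat; lra. }
  exists m0. intros m Hm. specialize (Hm0 m Hm). rewrite Rabs_pos_eq in Hm0 by (apply pow_le; lra).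
  assert (Hqm : 0 <= q ^ m <= 1).
  { split; [apply pow_le; lra|]. rewrite <- (pow1 m). apply pow_incr; lra. }
  destruct (riemann_L n G y (ppow n beta m) Hy) as (b2 & Hb2 & Hint2); auto with wf.
  set (b := Rmax a b2). assert (Hab : a <= b) by apply Rmax_l. assert (Hb2b : b2 <= b) by apply Rmax_r.
  destruct (cell_comparison n a N b 2 (eps / 8)) as (M0 & HM0); auto; try lra.
  apply (riemann_box_le n b (fun x => indic G x * ev (ppow n beta m) x)); [lra|now apply Hint2|].
  exists M0. intros M HM HM'. exists (corner b M). split; [intros; apply corner_in_cell; auto; lra|].
  (* A step function above [indic G * beta ^ m]: at least [1] on mixed cells and [q ^ m] on those
     inside [G]. Its integral is at most [eps / 2 + eps / 8]. *)
  set (s := fun c => (indic G (t c) - indic G (t' c)) + q ^ m).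
  assert (Hdiff0 : forall c, 0 <= indic G (t c) - indic G (t' c)).
  { intros c. unfold indic at 2. destruct (excluded_middle_informative (G (t' c))) as [HG|HG].
    - rewrite indic_true; [lra|]. apply (proj2 (Ht c) (t' c)); [apply Ht'|auto].
    - pose proof (indic_01 G (t c)). lra. }
  eapply Rle_trans.
  - apply (HM0 M HM HM' (corner b M) ltac:(intros; apply corner_in_cell; auto; lra)
       (fun x => indic G x * ev (ppow n beta m) x) s).
    + intros x Hx Hne. destruct (classic (G x)) as [HG|HG].
      * specialize (Hbox x HG). revert Hbox. apply Forall_impl. intros; lra.
      * elim Hne. rewrite indic_false by auto. ring.
    + intros c _. specialize (Hdiff0 c). pose proof (indic_01 G (t c)). pose proof (indic_01 G (t' c)).
      unfold s. apply Rabs_le. lra.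
    + intros k c _ Hc Hkc. set (x := corner b M k) in *. apply in_hcell_cell in Hkc.
      destruct (classic (G x)) as [HG|HG].
      * rewrite indic_true, Rmult_1_l, (ev_ppow n) by auto. unfold s.
        rewrite (indic_true G (t c)) by (apply (proj2 (Ht c) x); auto).
        destruct (Hb01 x HG) as [Hx0 Hx1].
        destruct (classic (forall z, in_cell a N c z -> G z)) as [Hpure|Hmix].
        -- apply Rle_trans with (q ^ m).
           ++ apply pow_incr. split; auto. specialize (Hq c Hc Hpure x Hkc). lra.
           ++ pose proof (indic_01 G (t' c)). lra.
        -- apply not_all_ex_not in Hmix. destruct Hmix as (z & Hz). apply imply_to_and in Hz.
           rewrite (indic_false G (t' c)) by (now apply (proj2 (Ht' c) z)).
           apply Rle_trans with 1; [|lra]. rewrite <- (pow1 m). apply pow_incr; lra.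
      * rewrite indic_false, Rmult_0_l by auto. unfold s. specialize (Hdiff0 c). lra.
  - unfold s. rewrite sumR_plus, sumR_const, card_grid. fold w.
    assert (E : w ^ n * (INR N ^ n * q ^ m) = (2 * a) ^ n * q ^ m).
    { rewrite <- Rmult_assoc, <- Rpow_mult_distr. f_equal. f_equal. unfold w. field. apply not_0_INR. lia. }
    assert ((2 * a) ^ n * q ^ m <= eps / 8).
    { apply Rmult_lt_compat_l with (r := (2 * a) ^ n) in Hm0; auto.
      replace ((2 * a) ^ n * (eps / 8 / (2 * a) ^ n)) with (eps / 8) in Hm0 by (field; lra). lra. }
    lra.
Qed.

(** * Zero flux *)

Lemma ev_bounded_on G a0 p : 0 < a0 -> (forall x, G x -> in_box a0 x) ->
  exists C, 0 <= C /\ forall x, G x -> Rabs (ev p x) <= C.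
Proof.
  intros Ha Hbox. destruct (ev_bounded a0 p) as (C & HC & H); [lra|]. exists C. split; auto.
  intros x Gx. apply H. specialize (Hbox x Gx). revert Hbox. apply Forall_impl. intros; lra.
Qed.

Lemma ev_pdiv_pmul n f g x : wf n f -> wf n g -> Rn n x ->
  ev (pdiv n (pmul f g)) x = ev (pdiv n f) x * ev g x + ev f x * ev (pE g) x.
Proof.
  intros Hf Hg Hx. rewrite !ev_pdiv, (ev_pmul n), (ev_pE_pmul n) by auto. ring.
Qed.

(** For [q >= 0] on [G] and [H] above its values there, a weight with values in [[0, 1]] on [G],
    equal to [1] where [q] vanishes. *)
Definition pbeta (n : nat) (H : R) (q : pl) : pl := pconst n 1 ++ pscal (- / H) q.

Lemma wf_pbeta n H q : wf n q -> wf n (pbeta n H q).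
Proof. unfold pbeta; auto with wf. Qed.
#[global] Hint Resolve wf_pbeta : wf.

Lemma ev_pbeta n H q x : ev (pbeta n H q) x = 1 - ev q x / H.
Proof. unfold pbeta. rewrite ev_app, ev_pconst, ev_pscal. unfold Rdiv. ring. Qed.

Lemma ev_pE_pbeta n H q x : ev (pE (pbeta n H q)) x = - (ev (pE q) x / H).
Proof. unfold pbeta. rewrite ev_pE_app, ev_pE_pconst, ev_pE_pscal. unfold Rdiv. ring. Qed.

(** Replacing [f] by [f (1 - h/H)^m] does not change the flux through the boundary; as [m] grows the
    integral of the divergence concentrates at the boundary, where only [f E((1 - h/H)^m)] survives. *)
Lemma flux_nonpos n G h y a0 f : bounded_by_zeros n G h -> moments n G y ->
  0 < a0 -> (forall x, G x -> in_box a0 x) -> (forall x, G x -> 0 < ev h x) ->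
  wf n f -> (forall x, G x -> 0 <= ev f x * ev (pE h) x) -> L y (pdiv n f) <= 0.
Proof.
  intros (Hh & Ho & Hreg & Hz) Hy Ha0 Hbox Hpos Hf Hsign.
  destruct (ev_bounded_on G a0 h Ha0 Hbox) as (C & HC & HhC).
  destruct (ev_bounded_on G a0 (pdiv n f) Ha0 Hbox) as (K & HK & HfK).
  set (H := C + 1). set (beta := pbeta n H h).
  assert (HH : 0 < H) by (unfold H; lra).
  assert (Hbeta : wf n beta) by (unfold beta; auto with wf).
  assert (Hb01 : forall x, G x -> 0 <= ev beta x < 1).
  { intros x Gx. unfold beta. rewrite ev_pbeta. specialize (Hpos x Gx). specialize (HhC x Gx).
    rewrite Rabs_pos_eq in HhC by lra.
    assert (0 < ev h x / H) by now apply Rdiv_lt_0_compat.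
    assert (ev h x / H <= 1); [|lra]. apply Rmult_le_reg_r with H; auto.
    unfold Rdiv. rewrite Rmult_assoc, Rinv_l; unfold H; lra. }
  apply Rnot_lt_le. intros Hlt.
  (* The tolerance is such that [K] times it is at most half of the flux, assumed positive. *)
  destruct (L_ppow_small n G y beta a0 (L y (pdiv n f) / (2 * (K + 1)))) as (m0 & Hm0); auto.
  { intros x Gx. now apply Ho. } { apply Rdiv_lt_0_compat; lra. }
  set (m := S m0). specialize (Hm0 m ltac:(unfold m; lia)). set (theta := ppow n beta m) in *.
  assert (Htheta : wf n theta) by (unfold theta; auto with wf).
  (* The difference is the divergence integral of [f (1 - theta)], which vanishes on the boundary
     because [theta = 1] there. *)
  assert (E : L y (pdiv n f) = L y (pdiv n (pmul f theta))).
  { assert (E0 : L y (pdiv n (pmul f (pconst n 1 ++ pscal (- 1) theta))) = 0).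
    { apply (divergence_theorem n G y _ a0); auto with wf.
      intros x Hx Hc HG. rewrite (ev_pmul n) by auto with wf. rewrite ev_app, ev_pconst, ev_pscal.
      unfold theta. rewrite (ev_ppow n) by auto. unfold beta. rewrite ev_pbeta.
      rewrite (proj2 (Hz x Hx)) by auto. replace (1 - 0 / H) with 1 by (field; lra). rewrite pow1. ring. }
    assert (E1 : L y (pdiv n (pmul f (pconst n 1 ++ pscal (- 1) theta))) =
      L y (pdiv n f ++ pscal (- 1) (pdiv n (pmul f theta)))).
    { apply (L_ext n G); auto with wf. intros x Gx. destruct (Ho x Gx) as [Hx _].
      rewrite ev_app, ev_pscal, !ev_pdiv_pmul by auto with wf.
      rewrite ev_app, ev_pconst, ev_pscal, ev_pE_app, ev_pE_pconst, ev_pE_pscal. ring. }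
    rewrite E1, L_app, L_pscal in E0. lra. }
  (* In [div (f theta x) = theta div (f x) + f (E theta)] the last term is nonpositive, because
     [E beta = - (E h) / H] and [f (E h) >= 0] on [G]. *)
  assert (Hle : L y (pdiv n (pmul f theta)) <= L y (pscal K theta)).
  { apply (L_le n G); auto with wf. intros x Gx. destruct (Ho x Gx) as [Hx _].
    rewrite ev_pdiv_pmul, ev_pscal by auto. unfold theta, m. rewrite (ev_pE_ppow n) by auto.
    rewrite (ev_ppow n) by auto. unfold beta at 3. rewrite ev_pE_pbeta.
    destruct (Hb01 x Gx) as [Hb _]. specialize (HfK x Gx). specialize (Hsign x Gx).
    assert (Hpw : 0 <= ev beta x ^ S m0) by now apply pow_le.
    assert (Hpw' : 0 <= ev beta x ^ m0) by now apply pow_le.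
    assert (ev (pdiv n f) x <= K) by (eapply Rle_trans; [apply Rle_abs|auto]).
    assert (0 <= INR (S m0) * ev beta x ^ m0 * (ev f x * ev (pE h) x / H)).
    { apply Rmult_le_pos; [apply Rmult_le_pos; auto; apply pos_INR|].
      apply Rmult_le_pos; auto. left; now apply Rinv_0_lt_compat. }
    replace (ev f x * (INR (S m0) * ev beta x ^ m0 * - (ev (pE h) x / H))) with
      (- (INR (S m0) * ev beta x ^ m0 * (ev f x * ev (pE h) x / H))) by (unfold Rdiv; ring).
    nra. }
  rewrite L_pscal in Hle.
  assert (K * L y theta <= K * (L y (pdiv n f) / (2 * (K + 1)))) by (apply Rmult_le_compat_l; auto).
  assert (K * (L y (pdiv n f) / (2 * (K + 1))) <= L y (pdiv n f) / 2); [|lra].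
  replace (L y (pdiv n f) / 2) with ((K + 1) * (L y (pdiv n f) / (2 * (K + 1)))) by (field; lra).
  apply Rmult_le_compat_r; [|lra]. left. apply Rdiv_lt_0_compat; lra.
Qed.

(** A measure of one sign with total mass zero vanishes: the weights [C + w] and [C - w] are
    nonnegative on [G], both give a nonpositive flux, and the constant [C] contributes nothing. *)
Lemma flux_zero n G h y a0 f w : bounded_by_zeros n G h -> moments n G y ->
  0 < a0 -> (forall x, G x -> in_box a0 x) -> (forall x, G x -> 0 < ev h x) ->
  wf n f -> wf n w -> (forall x, G x -> 0 <= ev f x * ev (pE h) x) ->
  L y (pdiv n f) = 0 -> L y (pdiv n (pmul f w)) = 0.
Proof.
  intros HG Hy Ha0 Hbox Hpos Hf Hw Hsign H0.
  destruct (ev_bounded_on G a0 w Ha0 Hbox) as (C & HC & HwC).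
  assert (HGn : forall x, G x -> Rn n x) by (intros x Gx; now apply HG).
  assert (Hgen : forall s, (s = 1 \/ s = -1) -> s * L y (pdiv n (pmul f w)) <= 0).
  { intros s Hs. set (w' := pconst n C ++ pscal s w).
    assert (E : L y (pdiv n (pmul f w')) = L y (pscal C (pdiv n f) ++ pscal s (pdiv n (pmul f w)))).
    { unfold w'. apply (L_ext n G); auto with wf. intros x Gx. specialize (HGn x Gx).
      rewrite ev_app, !ev_pscal, !ev_pdiv_pmul by auto with wf.
      rewrite ev_app, ev_pconst, ev_pscal, ev_pE_app, ev_pE_pconst, ev_pE_pscal. ring. }
    rewrite L_app, !L_pscal, H0 in E.
    assert (L y (pdiv n (pmul f w')) <= 0); [|lra].
    unfold w'. apply (flux_nonpos n G h y a0); auto with wf. intros x Gx.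
    rewrite (ev_pmul n), ev_app, ev_pconst, ev_pscal by auto with wf.
    replace (ev f x * (C + s * ev w x) * ev (pE h) x) with ((ev f x * ev (pE h) x) * (C + s * ev w x)) by ring.
    apply Rmult_le_pos; auto. specialize (HwC x Gx). pose proof (Rle_abs (ev w x)).
    pose proof (Rle_abs (- ev w x)) as H1. rewrite Rabs_Ropp in H1. destruct Hs as [-> | ->]; lra. }
  pose proof (Hgen 1 (or_introl eq_refl)). pose proof (Hgen (-1) (or_intror eq_refl)). lra.
Qed.

Definition pvar (n i : nat) : pl := [(1, upd i 1%nat (repeat 0%nat n))].

Lemma wf_pvar n i : wf n (pvar n i).
Proof. constructor; [|constructor]. simpl. now rewrite length_upd, repeat_length. Qed.
#[global] Hint Resolve wf_pvar : wf.

Lemma ev_pvar n i x : Rn n x -> (i < n)%nat -> ev (pvar n i) x = nth i x 0.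
Proof.
  intros <-. unfold ev, pvar. simpl. intros Hi. rewrite Rplus_0_r, Rmult_1_l.
  revert i Hi. induction x as [|x0 x IH]; intros [|i]; simpl; intros Hi; try lia.
  - rewrite mono_repeat. ring.
  - rewrite IH by lia. ring.
Qed.

Definition psqdist (n : nat) (c : list R) : pl :=
  flat_map (fun i => ppow n (pvar n i ++ pconst n (- nth i c 0)) 2) (seq 0 n).

Lemma wf_psqdist n c : wf n (psqdist n c).
Proof.
  unfold wf, psqdist. rewrite Forall_flat_map. apply Forall_forall. intros i _.
  apply wf_ppow. auto with wf.
Qed.
#[global] Hint Resolve wf_psqdist : wf.

Lemma ev_psqdist n c x : Rn n c -> Rn n x -> ev (psqdist n c) x = dist2 c x.
Proof.
  intros Hc Hx. unfold ev, psqdist. rewrite sumR_flat_map.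
  rewrite (sumR_ext _ _ (fun i => (nth i c 0 - nth i x 0) ^ 2)).
  - revert c x Hc Hx. induction n as [|n IH]; intros [|c0 c] [|x0 x] Hc Hx; try discriminate; [easy|].
    injection Hc as Hc. injection Hx as Hx. rewrite dist2_cons, <- IH by auto.
    cbn [seq sumR]. rewrite <- seq_shift, sumR_map. reflexivity.
  - intros i Hi. apply in_seq in Hi. fold (ev (ppow n (pvar n i ++ pconst n (- nth i c 0)) 2) x).
    rewrite (ev_ppow n), ev_app, ev_pvar, ev_pconst by (auto with wf; lia). ring.
Qed.

(** The squared distance has zero gradient at its centre, so adding it to [h] leaves the value of
    [E h] at this point unchanged. *)
Lemma ev_pE_psqdist n c : Rn n c -> ev (pE (psqdist n c)) c = 0.
Proof.
  intros Hc. unfold psqdist, pE, pw. rewrite flat_map_concat_map, concat_map, map_map, <- flat_map_concat_map.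
  unfold ev. rewrite sumR_flat_map. apply sumR_zero. intros i Hi. apply in_seq in Hi.
  fold (pw (fun a => INR (mdeg a)) (ppow n (pvar n i ++ pconst n (- nth i c 0)) 2)).
  fold (pE (ppow n (pvar n i ++ pconst n (- nth i c 0)) 2)).
  fold (ev (pE (ppow n (pvar n i ++ pconst n (- nth i c 0)) 2)) c).
  rewrite (ev_pE_ppow n), ev_app, ev_pvar, ev_pconst by (auto with wf; lia). ring.
Qed.

Lemma geometric_gap q0 q1 c3 c4 : 0 <= q1 < q0 -> 0 < c3 -> 0 <= c4 ->
  exists k0, forall k, (k0 <= k)%nat -> q1 ^ k * c4 < q0 ^ k * c3.
Proof.
  intros Hq H3 H4. assert (Hr : 0 <= q1 / q0 < 1).
  { split; [apply Rmult_le_pos; [lra|left; apply Rinv_0_lt_compat; lra]|].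
    apply Rmult_lt_reg_r with q0; [lra|]. unfold Rdiv. rewrite Rmult_assoc, Rinv_l; lra. }
  destruct (pow_lt_1_zero (q1 / q0) ltac:(rewrite Rabs_pos_eq; lra) (c3 / (c4 + 1))) as (k0 & H).
  { apply Rdiv_lt_0_compat; lra. }
  exists k0. intros k Hk. specialize (H k Hk). rewrite Rabs_pos_eq in H by now apply pow_le.
  assert (E : q1 ^ k = (q1 / q0) ^ k * q0 ^ k).
  { rewrite <- Rpow_mult_distr. f_equal. field. lra. }
  assert (0 < q0 ^ k) by (apply pow_lt; lra).
  assert (0 <= (q1 / q0) ^ k) by now apply pow_le.
  assert ((q1 / q0) ^ k * (c4 + 1) < c3).
  { apply Rmult_lt_compat_r with (r := c4 + 1) in H; [|lra].
    replace (c3 / (c4 + 1) * (c4 + 1)) with c3 in H by (field; lra). exact H. }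
  rewrite E. nra.
Qed.

(** Test with the weights [(1 - (h + |x - x0|^2)/H)^m], which concentrate at [x0] as [m] grows. *)
Lemma flux_localized n G h y a0 f x0 : bounded_by_zeros n G h -> moments n G y ->
  0 < a0 -> (forall x, G x -> in_box a0 x) -> (forall x, G x -> 0 < ev h x) ->
  wf n f -> (forall w, wf n w -> L y (pdiv n (pmul f w)) = 0) ->
  Rn n x0 -> ev h x0 = 0 -> ev f x0 * ev (pE h) x0 <= 0.
Proof.
  intros HG Hy Ha0 Hbox Hpos Hf Hflux Hx0 E0. pose proof HG as (Hh & Ho & Hreg & Hz).
  apply Rnot_lt_le. intros Hc.
  (* On the closure of [G] this vanishes only at [x0], so the weight singles out this point. *)
  set (q := h ++ psqdist n x0). assert (Hq : wf n q) by (unfold q; auto with wf).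
  assert (Eq : forall x, Rn n x -> ev q x = ev h x + dist2 x0 x).
  { intros x Hx. unfold q. now rewrite ev_app, ev_psqdist. }
  set (F := pmul f (pE q)). assert (HF : wf n F) by (unfold F; auto with wf).
  assert (EF : forall x, Rn n x -> ev F x = ev f x * ev (pE q) x) by (intros; apply (ev_pmul n); auto with wf).
  assert (HF0 : 0 < ev F x0).
  { rewrite EF by auto. unfold q. now rewrite ev_pE_app, ev_pE_psqdist, Rplus_0_r. }
  set (c2 := ev F x0 / 2). destruct (ev_pos_near F x0 c2) as (r & Hr & HrF); [unfold c2; lra|].
  assert (Hc2 : 0 < c2) by (unfold c2; lra).
  destruct (ev_bounded_on G a0 q Ha0 Hbox) as (C & HC & HqC).
  destruct (ev_bounded_on G a0 (pdiv n f) Ha0 Hbox) as (C1 & HC1 & HfC).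
  destruct (ev_bounded_on G a0 F Ha0 Hbox) as (C2 & HC2 & HFC).
  assert (Hr2 : 0 < r ^ 2) by now apply pow_lt.
  (* [C + 1] keeps the weight in [[0, 1]] on [G], and [r ^ 2] keeps [q1] nonnegative. *)
  set (H := C + 1 + r ^ 2). assert (HH : 0 < H) by (unfold H; lra).
  (* The weight is at least [q0] where [q < r ^ 2 / 2] and at most [q1] on the points of [G] outside
     the ball of radius [r]. *)
  set (q0 := 1 - r ^ 2 / 2 / H). set (q1 := 1 - r ^ 2 / H).
  assert (Hiq : r ^ 2 / H <= 1).
  { apply Rmult_le_reg_r with H; auto. unfold Rdiv. rewrite Rmult_assoc, Rinv_l; unfold H; lra. }
  assert (Hiq0 : 0 < r ^ 2 / H) by now apply Rdiv_lt_0_compat.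
  assert (Hq01 : 0 <= q1 < q0).
  { unfold q0, q1. replace (r ^ 2 / 2 / H) with (r ^ 2 / H / 2) by (field; lra). lra. }
  (* As [x0] is in the closure of [G], there is a ball inside [G] close to it; it supplies the
     guaranteed negative contribution. *)
  assert (Hball : exists z rho, Rn n z /\ 0 < rho /\
     forall x, nb rho z x -> G x /\ nb r x0 x /\ ev q x < r ^ 2 / 2).
  { destruct (ev_neg_near q x0 (r ^ 2 / 2)) as (d & Hd & Hdq).
    { rewrite Eq, E0 by auto. assert (dist2 x0 x0 = 0); [|lra].
      clear. induction x0 as [|u x IH]; [reflexivity|]. rewrite dist2_cons, IH. ring. }
    assert (Hd' : 0 < Rmin d (r / 2)) by (apply Rmin_pos; lra).
    destruct (proj1 (Hz x0 Hx0) E0) as [Hcl _]. destruct (Hcl _ Hd') as (z & Gz & Hxz).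
    destruct (Ho z Gz) as (Hzn & r1 & Hr1 & Hz1).
    destruct (ev_neg_near q z (r ^ 2 / 2)) as (r2 & Hr2' & Hz2).
    { apply Hdq. eapply nb_mono; [apply Rmin_l|exact Hxz]. }
    exists z, (Rmin r1 (Rmin r2 (r / 2))). split; auto. split; [repeat apply Rmin_pos; lra|].
    intros x Hx. split; [|split].
    - apply Hz1. eapply nb_mono; [apply Rmin_l|exact Hx].
    - replace r with (r / 2 + r / 2) by field. apply nb_trans with z.
      + eapply nb_mono; [apply Rmin_r|exact Hxz].
      + eapply nb_mono; [|exact Hx]. eapply Rle_trans; apply Rmin_r.
    - apply Hz2. eapply nb_mono; [|exact Hx]. eapply Rle_trans; [apply Rmin_r|apply Rmin_l]. }
  destruct Hball as (z & rho & Hzn & Hrho & Hball).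
  set (V1 := (rho / 2) ^ n). assert (HV1 : 0 < V1) by (apply pow_lt; lra).
  set (Y := L y (pconst n 1)).
  assert (HY : 0 <= Y).
  { unfold Y. assert (L y (pscal (- 1) (pconst n 1)) <= 0); [|rewrite L_pscal in H0; lra].
    apply (L_nonpos n G); auto with wf. intros x _. rewrite ev_pscal, ev_pconst. lra. }
  (* [M * (q0 ^ k * c3)] bounds the gain near [x0] and [M * (q1 ^ k * c4)] the loss elsewhere. Both
     carry the factor [M], so the geometric decay decides. *)
  set (c3 := c2 / (2 * H) * V1). set (c4 := (C1 + C2 / H) * Y).
  assert (Hc3 : 0 < c3) by (apply Rmult_lt_0_compat; auto; apply Rdiv_lt_0_compat; lra).
  assert (HC2H : 0 <= C2 / H) by (apply Rmult_le_pos; auto; left; now apply Rinv_0_lt_compat).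
  assert (Hc4 : 0 <= c4) by (apply Rmult_le_pos; lra).
  destruct (geometric_gap q0 q1 c3 c4 Hq01 Hc3 Hc4) as (k0 & Hgap).
  (* [k1] lets half of the derivative term absorb the term without derivative, which is bounded by
     [C1]. *)
  destruct (INR_archimed (c2 / (2 * H)) C1) as (k1 & Hk1); [apply Rdiv_lt_0_compat; lra|].
  set (k := Nat.max k0 k1). specialize (Hgap k ltac:(unfold k; lia)).
  set (M := INR (S k)).
  assert (HM1 : 1 <= M) by (unfold M; rewrite S_INR; pose proof (pos_INR k); lra).
  assert (HMC : C1 <= M * (c2 / (2 * H))).
  { apply Rlt_le, Rlt_le_trans with (INR k1 * (c2 / (2 * H))); auto.
    apply Rmult_le_compat_r; [left; apply Rdiv_lt_0_compat; lra|]. apply le_INR. unfold k; lia. }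
  set (beta := pbeta n H q). assert (Hbeta : wf n beta) by (unfold beta; auto with wf).
  assert (Hdist : forall x, 0 <= dist2 x0 x) by (intros; apply sumR_nonneg; intros; apply pow2_ge_0).
  assert (Hb01 : forall x, G x -> 0 <= ev beta x <= 1).
  { intros x Gx. unfold beta. rewrite ev_pbeta. destruct (Ho x Gx) as [Hx _]. specialize (HqC x Gx).
    specialize (Hpos x Gx). pose proof (Eq x Hx) as E. specialize (Hdist x).
    rewrite Rabs_pos_eq in HqC by lra.
    assert (0 < ev q x / H) by (apply Rdiv_lt_0_compat; lra).
    assert (ev q x / H <= 1); [|lra]. apply Rmult_le_reg_r with H; auto.
    unfold Rdiv. rewrite Rmult_assoc, Rinv_l; unfold H; lra. }
  set (g := pdiv n (pmul f (ppow n beta (S k)))). assert (Hg : wf n g) by (unfold g; auto with wf).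
  assert (Eg : forall x, Rn n x -> ev g x = ev beta x ^ k * (ev beta x * ev (pdiv n f) x - M / H * ev F x)).
  { intros x Hx. unfold g. rewrite ev_pdiv_pmul, (ev_pE_ppow n), (ev_ppow n), EF by auto with wf.
    unfold beta at 3. rewrite ev_pE_pbeta. fold M. simpl (_ ^ S k). unfold Rdiv. ring. }
  assert (Hnear : forall x, G x -> nb r x0 x -> ev g x <= - (ev beta x ^ k * (M * (c2 / (2 * H))))).
  { intros x Gx Hnb. destruct (Ho x Gx) as [Hx _]. rewrite Eg by auto.
    destruct (Hb01 x Gx) as [Hb0 Hb1]. assert (0 <= ev beta x ^ k) by now apply pow_le.
    specialize (HrF x Hnb). specialize (HfC x Gx). pose proof (Rle_abs (ev (pdiv n f) x)).
    assert (ev beta x * ev (pdiv n f) x <= C1).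
    { apply Rle_trans with (ev beta x * C1); [apply Rmult_le_compat_l; lra|]. nra. }
    assert (M / H * c2 <= M / H * ev F x).
    { apply Rmult_le_compat_l; [|lra]. left; apply Rdiv_lt_0_compat; lra. }
    replace (M / H * c2) with (2 * (M * (c2 / (2 * H)))) in * by (field; lra).
    rewrite <- Ropp_mult_distr_r_reverse. apply Rmult_le_compat_l; auto. lra. }
  set (K := q1 ^ k * (C1 + M * (C2 / H))).
  assert (HK : 0 <= K).
  { apply Rmult_le_pos; [apply pow_le; lra|]. assert (0 <= M * (C2 / H)) by (apply Rmult_le_pos; lra). lra. }
  assert (Hc2M : 0 <= M * (c2 / (2 * H))) by lra.
  assert (Hfar : forall x, G x -> ~ nb r x0 x -> ev g x <= K).
  { intros x Gx Hnb. destruct (Ho x Gx) as [Hx _]. rewrite Eg by auto.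
    destruct (Hb01 x Gx) as [Hb0 Hb1].
    assert (Hd2 : r ^ 2 <= dist2 x0 x).
    { apply Rnot_lt_le. intros Hlt. apply Hnb. now apply (nb_of_dist2 n). }
    assert (Hbq : ev beta x <= q1).
    { unfold beta, q1. rewrite ev_pbeta. specialize (Hpos x Gx). pose proof (Eq x Hx) as E.
      assert (r ^ 2 / H <= ev q x / H); [|lra]. apply Rmult_le_compat_r; [|lra].
      left; now apply Rinv_0_lt_compat. }
    specialize (HfC x Gx). specialize (HFC x Gx). pose proof (Rle_abs (ev (pdiv n f) x)).
    pose proof (Rle_abs (- ev F x)) as HFabs. rewrite Rabs_Ropp in HFabs.
    assert (A1 : ev beta x * ev (pdiv n f) x <= C1).
    { apply Rle_trans with (ev beta x * C1); [apply Rmult_le_compat_l; lra|]. nra. }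
    assert (A2 : - (M / H * ev F x) <= M * (C2 / H)).
    { replace (- (M / H * ev F x)) with (M / H * - ev F x) by ring.
      replace (M * (C2 / H)) with (M / H * C2) by (field; lra).
      apply Rmult_le_compat_l; [|lra]. left; apply Rdiv_lt_0_compat; lra. }
    assert (A3 : 0 <= ev beta x ^ k <= q1 ^ k) by (split; [now apply pow_le|now apply pow_incr]).
    unfold K. assert (0 <= C1 + M * (C2 / H)).
    { assert (0 <= M * (C2 / H)) by (apply Rmult_le_pos; lra). lra. }
    apply Rle_trans with (ev beta x ^ k * (C1 + M * (C2 / H))).
    - apply Rmult_le_compat_l; lra.
    - apply Rmult_le_compat_r; lra. }
  assert (Hfinal : L y (g ++ pscal (- K) (pconst n 1)) <= - (q0 ^ k * (M * (c2 / (2 * H))) * V1)).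
  { apply (L_neg_on_ball n G y _ z rho); auto with wf.
    - apply Rmult_le_pos; auto. apply pow_le; lra.
    - intros x Gx. rewrite ev_app, ev_pscal, ev_pconst.
      destruct (classic (nb r x0 x)) as [Hnb|Hnb].
      + specialize (Hnear x Gx Hnb). destruct (Hb01 x Gx).
        assert (0 <= ev beta x ^ k) by now apply pow_le. nra.
      + specialize (Hfar x Gx Hnb). lra.
    - intros x Hx. destruct (Hball x Hx) as (Gx & Hnb & Hqx). split; auto.
      rewrite ev_app, ev_pscal, ev_pconst. specialize (Hnear x Gx Hnb).
      assert (q0 ^ k <= ev beta x ^ k).
      { apply pow_incr. split; [lra|]. unfold q0, beta. rewrite ev_pbeta.
        assert (ev q x / H <= r ^ 2 / 2 / H); [|lra]. apply Rmult_le_compat_r; [|lra].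
        left; now apply Rinv_0_lt_compat. }
      nra. }
  rewrite L_app, L_pscal in Hfinal. fold Y in Hfinal. unfold g in Hfinal. rewrite Hflux in Hfinal by auto with wf.
  assert (HKM : K <= q1 ^ k * (M * (C1 + C2 / H))).
  { unfold K. apply Rmult_le_compat_l; [apply pow_le; lra|]. nra. }
  assert (K * Y <= M * (q1 ^ k * c4)).
  { apply Rle_trans with (q1 ^ k * (M * (C1 + C2 / H)) * Y); [now apply Rmult_le_compat_r|].
    right. unfold c4. ring. }
  assert (q0 ^ k * (M * (c2 / (2 * H))) * V1 = M * (q0 ^ k * c3)) by (unfold c3; ring).
  nra.
Qed.

(** For [f = p (E h) p] the density [f (E h)] is the square of [p (E h)]: nonnegative on [G], as
    [flux_zero] requires, and zero wherever [flux_localized] makes it nonpositive. *)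
Lemma flux_vanishing n G h y a0 p : bounded_by_zeros n G h -> moments n G y ->
  0 < a0 -> (forall x, G x -> in_box a0 x) -> (forall x, G x -> 0 < ev h x) ->
  wf n p -> L y (pdiv n (pmul (pmul p (pE h)) p)) = 0 ->
  forall x, Rn n x -> ev h x = 0 -> ev p x * ev (pE h) x = 0.
Proof.
  intros HG Hy Ha0 Hbox Hpos Hp H0 x Hx Hhx. pose proof HG as (Hh & Ho & _).
  set (f := pmul (pmul p (pE h)) p). assert (Hf : wf n f) by (unfold f; auto with wf).
  assert (Ef : forall z, Rn n z -> ev f z * ev (pE h) z = (ev p z * ev (pE h) z) ^ 2).
  { intros z Hzn. unfold f. rewrite !(ev_pmul n) by auto with wf. ring. }
  assert (Hle : ev f x * ev (pE h) x <= 0).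
  { apply (flux_localized n G h y a0); auto. intros w Hw. apply (flux_zero n G h y a0); auto.
    intros z Gz. rewrite Ef by (now apply Ho). apply pow2_ge_0. }
  rewrite Ef in Hle by auto.
  destruct (Req_dec (ev p x * ev (pE h) x) 0) as [E|E]; auto.
  apply Rsqr_pos_lt in E. rewrite Rsqr_pow2 in E. lra.
Qed.

(** * Existence and uniqueness *)

Lemma closure_clos n G x : (forall z, G z -> Rn n z) -> Rn n x -> (closureRn n G x <-> clos G x).
Proof.
  intros HG Hx. split.
  - intros [_ H] r Hr. destruct (H r Hr) as (z & Gz & Hz). exists z. split; auto.
    apply (nb_of_dist2 n); auto.
  - intros H. split; auto. intros r Hr. destruct (dist2_of_nb n r Hr) as (r' & Hr' & Hd).
    destruct (H r' Hr') as (z & Gz & Hz). exists z. split; auto.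
Qed.

Lemma interior_nb n S x : Rn n x ->
  (interiorRn n S x <-> exists r, 0 < r /\ forall z, nb r x z -> S z).
Proof.
  intros Hx. split.
  - intros (_ & r & Hr & H). destruct (dist2_of_nb n r Hr) as (r' & Hr' & Hd).
    exists r'. split; auto. intros z Hz. apply H; auto. now apply nb_Rn with r' x.
  - intros (r & Hr & H). split; auto. exists r. split; auto. intros z Hz Hd.
    apply H. now apply (nb_of_dist2 n).
Qed.

Lemma open_nb_of n G : is_openRn n G -> open_nb n G.
Proof.
  intros [HG Ho] x Gx. split; auto. apply (interior_nb n); auto. split; auto.
Qed.

Lemma boundary_clos n G x : is_openRn n G -> Rn n x -> (boundaryRn n G x <-> clos G x /\ ~ G x).
Proof.
  intros Ho Hx. pose proof Ho as [HG Hball]. unfold boundaryRn. rewrite closure_clos by auto.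
  assert (interiorRn n G x <-> G x); [|tauto]. split.
  - rewrite (interior_nb n) by auto. intros (r & Hr & H). now apply H, nb_refl.
  - intros Gx. split; auto.
Qed.

(** The bound stored in a [poly] may exceed its degree; the width argument needs a formal sum that
    stops at [d]. *)
Definition trunc (n d : nat) (c : list nat -> R) : pl := map (fun a => (c a, a)) (mis n d).

Lemma wf_trunc n d c : wf n (trunc n d c).
Proof. apply Forall_map, Forall_forall. intros a Ha. now apply in_mis in Ha. Qed.

Lemma degs_trunc n d c : degs 0 d (trunc n d c).
Proof. apply Forall_map, Forall_forall. intros a Ha. apply in_mis in Ha. simpl. lia. Qed.

Lemma ev_trunc n d c x : ev (trunc n d c) x = sumR (mis n d) (fun a => c a * mono x a).
Proof. unfold ev, trunc. now rewrite sumR_map. Qed.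

Lemma cev_trunc_nz n d c a : In a (mis n d) -> c a <> 0 -> fnz n (pcomp (mdeg a) (trunc n d c)).
Proof.
  intros Ha Hc. apply NNPP. intros Hno. apply Hc.
  assert (E : (if Nat.eqb (mdeg a) (mdeg a) then c a else 0) = 0); [|now rewrite Nat.eqb_refl in E].
  apply (mis_coef_zero n d (fun b => if Nat.eqb (mdeg b) (mdeg a) then c b else 0)); auto.
  intros x Hx. pose proof (not_fnz n _ Hno x Hx) as E. fold (cev (mdeg a) (trunc n d c) x) in E.
  rewrite cev_eq in E. unfold trunc in E. rewrite sumR_map in E. refine (eq_trans _ E).
  apply sumR_ext. intros b _. cbn [fst snd]. destruct (Nat.eqb (mdeg b) (mdeg a)); ring.
Qed.

(** A monomial [x^a] of [q] produces row [a] of the moment matrix times [n + |a|]; a kernel vector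
    [c] thus makes this vanish for every [q] of degree at most [2 d]. *)
Lemma L_pdiv_pmul n d y c q : wf n q ->
  L y (pdiv n (pmul q (trunc n d c))) =
  sumR q (fun m => fst m * sumR (mis n d) (fun b =>
    INR (n + mdeg (snd m) + mdeg b) * c b * y (addmi (snd m) b))).
Proof.
  intros Hq. unfold L, pdiv, pw. rewrite sumR_map.
  erewrite (sumR_pmul n); [|auto|apply wf_trunc|intros; reflexivity].
  apply sumR_ext. intros m Hm. unfold trunc. rewrite sumR_map, <- sumR_scal.
  apply sumR_ext. intros b Hb. cbn [fst snd]. red in Hq. rewrite Forall_forall in Hq.
  apply in_mis in Hb. rewrite (mdeg_addmi n) by (auto; tauto). rewrite Nat.add_assoc. ring.
Qed.

Lemma mono_zero n a : length a = n -> mono (repeat 0 n) a = if Nat.eqb (mdeg a) 0 then 1 else 0.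
Proof.
  intros Hl. destruct (Nat.eqb_spec (mdeg a) 0) as [E|E].
  - apply mdeg_0 in E. rewrite E. apply mono_repeat.
  - rewrite <- (scal_0 n (repeat 0 n)) by apply repeat_length.
    rewrite mono_scal by (now rewrite repeat_length). rewrite pow_i by lia. ring.
Qed.

Lemma moment_row n d y c a : (1 <= n)%nat ->
  sumR (mis n d) (fun b => INR (n + mdeg a + mdeg b) * c b * y (addmi a b)) =
  INR (n + mdeg a) * sumR (mis n d) (fun b => Mentry n y a b * c b).
Proof.
  intros Hn. rewrite <- sumR_scal. apply sumR_ext. intros b _. unfold Mentry. field.
  apply not_0_INR. lia.
Qed.

Theorem theorem1 (n d : nat) (G : list R -> Prop) (y : list nat -> R) :
  (1 <= n)%nat ->
  is_openRn n G ->
  boundedRn n G ->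
  (forall x, Rn n x -> (G x <-> interiorRn n (closureRn n G) x)) ->
  real_algebraic n (boundaryRn n G) ->
  (exists h, generates_vanishing_ideal n h (boundaryRn n G) /\ has_degree n h d) ->
  ~ in_zero_set_of_vanishing_ideal n (boundaryRn n G) (repeat 0 n) ->
  (forall a, length a = n -> IntegralRn n (fun x => indic G x * mono x a) (y a)) ->
  exists g : list nat -> R,
    moment_system n d y g /\
    (forall g', moment_system n d y g' ->
       forall b, In b (mis n d) -> (0 < mdeg b)%nat -> g' b = g b) /\
    (forall x, boundaryRn n G x -> gpoly n d g x = 1).
Proof.
  intros Hn Hopen (a0 & Ha0 & Hbox) Hreg (Halg1 & ps & Halg) (h & [Hhv Hhg] & [(top & Htop & Hdtop & Hctop) Hdeg]) H0 Hy.
  pose proof Hopen as [HGn _]. pose proof (open_nb_of n G Hopen) as Ho.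
  assert (Hdb : (d <= pbound h)%nat) by (apply in_mis in Htop; lia).
  set (hp := trunc n d (pcoef h)).
  assert (Hhp : wf n hp) by apply wf_trunc.
  assert (Eh : forall x, ev hp x = peval n h x).
  { intros x. unfold hp. rewrite ev_trunc. unfold peval. symmetry. apply sumR_mis_le; auto.
    intros a Ha Hda. destruct (Req_dec (pcoef h a) 0) as [->|Hne]; [ring|]. specialize (Hdeg a Ha Hne). lia. }
  assert (Hzero : Rn n (repeat 0 n)) by apply repeat_length.
  assert (Hgen0 : forall p, wf n p -> (forall x, Rn n x -> clos G x -> ~ G x -> ev p x = 0) ->
     exists q, wf n q /\ forall x, Rn n x -> ev p x = ev hp x * ev q x).
  { intros p Hp Hv. destruct (to_poly n p Hp) as (P & EP).
    destruct (Hhg P) as (Q & EQ).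
    { intros x Hx. rewrite EP. pose proof (Halg1 x Hx). apply boundary_clos in Hx; auto. now apply Hv. }
    exists (of_poly n Q). split; [apply wf_of_poly|]. intros x Hx. rewrite ev_of_poly, Eh, <- EP. auto. }
  assert (Hh0 : ev hp (repeat 0 n) <> 0).
  { intros E. apply H0. intros p Hp. destruct (Hhg p Hp) as (q & Eq). rewrite Eq, <- Eh, E by auto. ring. }
  (* Each polynomial defining the boundary vanishes on it and is a multiple of [h], so [h] has no
     zeros elsewhere. *)
  assert (Hz : forall x, Rn n x -> (ev hp x = 0 <-> clos G x /\ ~ G x)).
  { intros x Hx. rewrite <- (boundary_clos n), Eh by auto. split; [|now apply Hhv].
    intros E. apply Halg; auto. apply Forall_forall. intros p Hp.
    destruct (Hhg p) as (q & Eq).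
    - intros z Hz. pose proof (Halg1 z Hz) as Hzn. apply Halg in Hz; auto. rewrite Forall_forall in Hz. auto.
    - rewrite Eq, E by auto. ring. }
  assert (HG : bounded_by_zeros n G hp).
  { split; [auto|split; [auto|split; [|auto]]]. intros x Hx (r & Hr & H). apply Hreg; auto.
    apply interior_nb; auto. exists r. split; auto. intros z Hxz.
    apply closure_clos; auto. now apply nb_Rn with r x. }
  assert (Hgen : generates n hp).
  { split; auto. intros p Hp Hv. apply Hgen0; auto. intros x Hx Hc HnG. apply Hv; auto. apply Hz; auto. }
  assert (Hc0 : ev hp (repeat 0 n) = pcoef h (repeat 0%nat n)).
  { rewrite <- (sumR_mis_single n d (repeat 0%nat n) (pcoef h)) by
      (apply in_mis; rewrite repeat_length, mdeg_repeat; split; auto; lia).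
    unfold hp. rewrite ev_trunc. apply sumR_ext. intros a Ha. apply in_mis in Ha. destruct Ha as [Hl _].
    rewrite mono_zero by auto.
    destruct (Nat.eqb_spec (mdeg a) 0) as [E|E], (list_eq_dec Nat.eq_dec (repeat 0%nat n) a) as [E'|E']; try ring.
    - elim E'. rewrite <- Hl. symmetry. now apply mdeg_0.
    - elim E. rewrite <- E'. apply mdeg_repeat. }
  set (h0 := pcoef h (repeat 0%nat n)) in *.
  (* The prescribed entry [-1] is the constant coefficient of [- h / h0]. *)
  assert (Eext : forall a, In a (mis n d) -> ext_vec (fun b => - pcoef h b / h0) a = - / h0 * pcoef h a).
  { intros a Ha. unfold ext_vec. destruct (Nat.eqb_spec (mdeg a) 0) as [E|E].
    - apply mdeg_0 in E. apply in_mis in Ha. destruct Ha as [El _]. rewrite El in E. rewrite E.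
      fold h0. field. now rewrite <- Hc0.
    - field. now rewrite <- Hc0. }
  set (g := fun b => - pcoef h b / h0) in *.
  assert (Hg : moment_system n d y g).
  { intros a Ha. rewrite (sumR_ext _ _ (fun b => - / h0 * (Mentry n y a b * pcoef h b))).
    2:{ intros b Hb. rewrite Eext by auto. ring. }
    assert (E : L y (pdiv n (pmul [(1, a)] hp)) = 0).
    { assert (Hw : wf n [(1, a)]) by (constructor; [now apply in_mis in Ha|constructor]).
      apply (divergence_theorem n G y _ a0); auto with wf.
      intros x Hx Hc HnG. rewrite (ev_pmul n) by auto. rewrite (proj2 (Hz x Hx)) by auto. ring. }
    unfold hp in E. rewrite L_pdiv_pmul in E by (constructor; [now apply in_mis in Ha|constructor]).
    simpl in E. rewrite moment_row in E by auto.
    assert (E1 : sumR (mis n d) (fun b => Mentry n y a b * pcoef h b) = 0).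
    { apply Rmult_eq_reg_l with (INR (n + mdeg a)); [lra|]. apply not_0_INR. lia. }
    rewrite sumR_scal, E1. ring. }
  exists g. split; [exact Hg|split].
  - intros g' Hg'.
    (* Both extended vectors have the entry [-1] at [0], so their difference has constant term [0]
       and lies in the kernel. *)
    set (c := fun b => if Nat.eqb (mdeg b) 0 then 0 else g' b - g b).
    assert (Hrow : forall a, In a (mis n (2 * d)) -> sumR (mis n d) (fun b => Mentry n y a b * c b) = 0).
    { intros a Ha. transitivity (sumR (mis n d) (fun b => Mentry n y a b * ext_vec g' b)
        - sumR (mis n d) (fun b => Mentry n y a b * ext_vec g b)).
      - rewrite <- sumR_minus. apply sumR_ext. intros b _. unfold c, ext_vec.
        destruct (Nat.eqb (mdeg b) 0); ring.
      - rewrite (Hg' a Ha), (Hg a Ha). ring. }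
    (* Dropping the formal constant term changes no value, but records that all degrees are at least
       [1]. *)
    clear Hg' Hg. set (p0 := trunc n d c). set (p := drop 0 p0).
    assert (Hp0 : wf n p0) by apply wf_trunc. assert (Hp : wf n p) by now apply wf_drop.
    assert (Epp : feq n p p0).
    { intros x _. unfold p. rewrite (ev_drop 0 p0 x), cev_eq, sumR_zero; [ring|].
      intros m Hm. apply in_map_iff in Hm. destruct Hm as (b & <- & _). unfold c. cbn [fst snd].
      destruct (Nat.eqb (mdeg b) 0); ring. }
    assert (Hdp : degs 1 d p).
    { pose proof (degs_trunc n d c) as Hd. fold p0 in Hd. unfold degs, p, drop in *.
      rewrite Forall_forall in *. intros m Hm. apply filter_In in Hm. destruct Hm as [Hm E].
      specialize (Hd m Hm). apply Bool.negb_true_iff, Nat.eqb_neq in E. lia. }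
    (* [p (E k)] has degree at most [2 d], the range of the rows; [k] will be [h] or [- h] according
       to the sign of [h] on [G]. *)
    assert (HT : forall k, wf n k -> degs 0 d k -> L y (pdiv n (pmul (pmul p (pE k)) p)) = 0).
    { intros k Hk Hdk. set (q := pmul p (pE k)). assert (Hq : wf n q) by (unfold q; auto with wf).
      assert (Hdq : degs 0 (d + d) q).
      { apply (degs_weaken (1 + 0) (d + d)); [lia|lia|]. apply (degs_pmul n); auto with wf. now apply degs_pw. }
      transitivity (L y (pdiv n (pmul q p0))).
      - apply (L_ext n G); auto with wf. intros x Gx. specialize (HGn x Gx).
        rewrite !ev_pdiv_pmul, Epp by auto. now rewrite (feq_pE n p p0).
      - unfold p0. rewrite L_pdiv_pmul by auto. apply sumR_zero. intros m Hm.
        rewrite moment_row, Hrow by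
          (auto; red in Hq, Hdq; rewrite Forall_forall in Hq, Hdq; specialize (Hq m Hm); specialize (Hdq m Hm);
           apply in_mis; split; auto; lia). ring. }
    assert (Hdh : degs 0 d hp) by apply degs_trunc.
    assert (HpE : forall x, Rn n x -> ev hp x = 0 -> ev p x * ev (pE hp) x = 0).
    { destruct (constant_sign n G hp HG Hgen Hh0) as [Hpos|Hneg].
      - apply (flux_vanishing n G hp y a0); auto.
      - intros x Hx E. assert (E1 : ev p x * ev (pE (pscal (- 1) hp)) x = 0).
        { apply (flux_vanishing n G (pscal (- 1) hp) y a0); auto with wf.
          - split; [auto with wf|split; [auto|split; [apply HG|]]]. intros z Hzn.
            rewrite ev_pscal, <- Hz by auto. lra.
          - intros z Gz. rewrite ev_pscal. specialize (Hneg z Gz). lra.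
          - apply HT; [auto with wf|]. now apply degs_pw.
          - rewrite ev_pscal, E. ring. }
        rewrite ev_pE_pscal in E1. lra. }
    assert (Hpz : forall x, Rn n x -> ev hp x = 0 -> ev p x = 0) by now apply (pE_regular n hp p).
    destruct (proj2 Hgen p Hp Hpz) as (q & Hq & Eq).
    assert (Hends : ends n 0 d hp).
    { split; [auto|split; [auto|split]].
      - exists (repeat 0 n). split; auto. fold (cev 0 hp (repeat 0 n)). now rewrite (cev_0 n).
      - simpl. unfold hp. rewrite <- Hdtop. apply cev_trunc_nz; auto. apply in_mis in Htop. apply in_mis.
        split; [tauto|lia]. }
    assert (Hno : ~ fnz n p).
    { intros Hnz. pose proof (width_pmul n 0 d 1 d hp q p Hends Hq Hp Hdp Hnz Eq). lia. }
    intros b Hb Hdb'.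
    assert (Ec : c b = 0).
    { apply (mis_coef_zero n d c); auto. intros x Hx. rewrite <- ev_trunc. fold p0. rewrite <- Epp by auto.
      now apply (not_fnz n). }
    unfold c in Ec. destruct (Nat.eqb_spec (mdeg b) 0); [lia|]. lra.
  - intros x Hx. pose proof (Halg1 x Hx) as Hxn. unfold gpoly.
    assert (E : sumR (mis n d) (fun b => pcoef h b * mono x b) = 0).
    { rewrite <- ev_trunc. fold hp. rewrite Eh. now apply Hhv. }
    (* The second sum is the [1] of [g = 1 - h / h0], which cancels the constant term of
       [- h / h0]. *)
    transitivity (- / h0 * sumR (mis n d) (fun b => pcoef h b * mono x b) +
      sumR (mis n d) (fun b => if list_eq_dec Nat.eq_dec (repeat 0%nat n) b then 1 else 0)).
    2:{ rewrite E, (sumR_mis_single n d (repeat 0%nat n) (fun _ => 1)); [ring|].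
        apply in_mis; rewrite repeat_length, mdeg_repeat; split; auto; lia. }
    rewrite <- sumR_scal, <- sumR_plus. apply sumR_ext. intros b Hb.
    apply in_mis in Hb. destruct Hb as [Hl _].
    assert (Hh0' : h0 <> 0) by now rewrite <- Hc0.
    destruct (Nat.eqb_spec (mdeg b) 0) as [E0|E0], (list_eq_dec Nat.eq_dec (repeat 0%nat n) b) as [E'|E'].
    + rewrite <- E'. fold h0. rewrite mono_repeat. field. auto.
    + elim E'. rewrite <- Hl. symmetry. now apply mdeg_0.
    + elim E0. rewrite <- E'. apply mdeg_repeat.
    + unfold g. field. auto.
Qed.
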